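(* The critical spherical catenoid in a geodesic ball $\mathbb B^3(r)$ of $\mathbb S^3_+$ ($0<r<\frac{\pi}{2}$) has index $4$. The critical spherical catenoid in a geodesic ball $\mathbb B^3(r)$ of $\mathbb H^3$ ($r>0$) has index at least $4$.
   Context: $\mathbb S^3_+$ is the upper hemisphere $\{x_0>0\}$ of the unit sphere in Euclidean $\mathbb R^4$; $\mathbb H^3$ is the upper sheet of $-x_0^2+x_1^2+x_2^2+x_3^2=-1$ in $\mathbb R^4$ with the metric $-dx_0^2+\sum_{i=1}^3dx_i^2$. $\mathbb B^3(r)$ is the geodesic ball of radius $r$ centred at $(1,0,0,0)$. A free boundary minimal surface (FBMS) in $\mathbb B^3(r)$ is a compact immersed minimal surface with boundary in $\partial\mathbb B^3(r)$, meeting $\partial\mathbb B^3(r)$ orthogonally. Spherical catenoids. In $\mathbb S^3$, for a constant $-\frac12<a\leqslant0$, $\Phi_a:\mathbb R\times\mathbb S^1\to\mathbb S^3$, $$\Phi_a(s,\theta)=\left(\sqrt{\tfrac12-a\cos 2s}\,\cos\varphi(s),\ \sqrt{\tfrac12-a\cos2s}\,\sin\varphi(s),\ \sqrt{\tfrac12+a\cos2s}\,\cos\theta,\ \sqrt{\tfrac12+a\cos2s}\,\sin\theta\right),$$ $$\varphi(s)=\sqrt{\tfrac14-a^2}\int_0^s\frac{dt}{\left(\frac12-a\cos2t\right)\sqrt{\frac12+a\cos2t}}.$$ In $\mathbb H^3$, for a constant $a>\frac12$, $\Phi_a:\mathbb R\times\mathbb S^1\to\mathbb H^3$, $$\Phi_a(s,\theta)=\left(\sqrt{a\cosh2s+\tfrac12}\,\cosh\varphi(s),\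 \sqrt{a\cosh2s+\tfrac12}\,\sinh\varphi(s),\ \sqrt{a\cosh2s-\tfrac12}\,\cos\theta,\ \sqrt{a\cosh2s-\tfrac12}\,\sin\theta\right),$$ $$\varphi(s)=\sqrt{a^2-\tfrac14}\int_0^s\frac{dt}{\left(a\cosh2t+\frac12\right)\sqrt{a\cosh2t-\frac12}}.$$ A critical spherical catenoid in $\mathbb B^3(r)$ is a piece $\Phi_a:[-s_0,s_0]\times\mathbb S^1\to\mathbb B^3(r)$, $s_0>0$, of such a catenoid which is a free boundary minimal annulus in $\mathbb B^3(r)$. Index. The (Morse) index of such a two-sided FBMS $\Sigma$ is the maximal dimension of a subspace of $C^\infty(\Sigma)$ on which the quadratic form $S$ is negative definite, where (with $B$ the second fundamental form of $\Sigma$ in $\mathbb B^3(r)$ and $g$ the induced metric) $$S(u,u)=\int_\Sigma\left(|\nabla^gu|^2-(2+|B|^2)u^2\right)dA-\cot r\int_{\partial\Sigma}u^2dL\quad\text{for }\mathbb S^3_+,$$ $$S(u,u)=\int_\Sigma\left(|\nabla^gu|^2-(-2+|B|^2)u^2\right)dA-\coth r\int_{\partial\Sigma}u^2dL\quad\text{for }\mathbb H^3.$$ *)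

(* Defs.v *)
From Stdlib Require Import Reals.
From Coquelicot Require Import Coquelicot.
Open Scope R_scope.

Inductive space_form := Spherical | Hyperbolic.

Definition curv (M : space_form) : R :=
  match M with Spherical => 1 | Hyperbolic => -1 end.

Record vec4 := mkvec4 { x0 : R; x1 : R; x2 : R; x3 : R }.

Definition vzero : vec4 := mkvec4 0 0 0 0.
Definition vadd (x y : vec4) : vec4 :=
  mkvec4 (x0 x + x0 y) (x1 x + x1 y) (x2 x + x2 y) (x3 x + x3 y).
Definition vscal (c : R) (x : vec4) : vec4 :=
  mkvec4 (c * x0 x) (c * x1 x) (c * x2 x) (c * x3 x).
Definition vsub (x y : vec4) : vec4 := vadd x (vscal (-1) y).

(** Euclidean product for [Spherical], Minkowski product for [Hyperbolic]. *)
Definition ip (M : space_form) (x y : vec4) : R :=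
  curv M * x0 x * x0 y + x1 x * x1 y + x2 x * x2 y + x3 x * x3 y.

(** The open hemisphere [x0 > 0] of the unit 3-sphere, respectively the upper
    sheet of the hyperboloid. *)
Definition in_model (M : space_form) (x : vec4) : Prop :=
  ip M x x = curv M /\ 0 < x0 x.

Definition pole : vec4 := mkvec4 1 0 0 0.

Definition arcosh (y : R) : R := ln (y + sqrt (y ^ 2 - 1)).

Definition gdist (M : space_form) (x y : vec4) : R :=
  match M with
  | Spherical => acos (ip M x y)
  | Hyperbolic => arcosh (- ip M x y)
  end.

Definition in_ball (M : space_form) (r : R) (x : vec4) : Prop :=
  in_model M x /\ gdist M pole x <= r.
Definition in_ball_boundary (M : space_form) (r : R) (x : vec4) : Prop :=
  in_model M x /\ gdist M pole x = r.

Definition gcos (M : space_form) (r : R) : R :=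
  match M with Spherical => cos r | Hyperbolic => cosh r end.
Definition gsin (M : space_form) (r : R) : R :=
  match M with Spherical => sin r | Hyperbolic => sinh r end.
Definition gcot (M : space_form) (r : R) : R := gcos M r / gsin M r.

(** Outward unit normal at [x] of the geodesic sphere of radius [r] about [pole]:
    if [x = gcos r * pole + gsin r * w], with [w] a unit vector orthogonal to
    [pole], it is the derivative of [gcos r * pole + gsin r * w] in [r]. *)
Definition ball_normal (M : space_form) (r : R) (x : vec4) : vec4 :=
  vscal (/ gsin M r) (vsub (vscal (gcos M r) x) pole).

(** Functions and maps on [R x S^1] are functions of [(s, t)] that are
    [2 * PI]-periodic in [t]; [ex_diff_n f n] at every point means that [f] is of
    class C^n. *)

Definition smooth (f : R -> R -> R) : Prop :=
  forall (n : nat) (s t : R), ex_diff_n f n s t.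

Inductive dir := Ds | Dt.

Definition sum_dir (f : dir -> R) : R := f Ds + f Dt.
Definition vsum_dir (f : dir -> vec4) : vec4 := vadd (f Ds) (f Dt).

Definition pd (i : dir) (f : R -> R -> R) (s t : R) : R :=
  match i with
  | Ds => Derive (fun z => f z t) s
  | Dt => Derive (fun z => f s z) t
  end.

Definition vpd (i : dir) (X : R -> R -> vec4) (s t : R) : vec4 :=
  mkvec4 (pd i (fun p q => x0 (X p q)) s t) (pd i (fun p q => x1 (X p q)) s t)
         (pd i (fun p q => x2 (X p q)) s t) (pd i (fun p q => x3 (X p q)) s t).

Definition metric (M : space_form) (X : R -> R -> vec4) (i j : dir) (s t : R) : R :=
  ip M (vpd i X s t) (vpd j X s t).

Definition metric_det (M : space_form) (X : R -> R -> vec4) (s t : R) : R :=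
  metric M X Ds Ds s t * metric M X Dt Dt s t - metric M X Ds Dt s t ^ 2.

Definition metric_inv (M : space_form) (X : R -> R -> vec4) (i j : dir) (s t : R) : R :=
  match i, j with
  | Ds, Ds => metric M X Dt Dt s t / metric_det M X s t
  | Dt, Dt => metric M X Ds Ds s t / metric_det M X s t
  | _, _ => - metric M X Ds Dt s t / metric_det M X s t
  end.

Definition area_density (M : space_form) (X : R -> R -> vec4) (s t : R) : R :=
  sqrt (metric_det M X s t).

Definition length_density (M : space_form) (X : R -> R -> vec4) (s t : R) : R :=
  sqrt (metric M X Dt Dt s t).

(** Second fundamental form of the surface in the 3-dimensional space form, as a
    normal-vector valued form: the second derivative of [X] minus its component
    tangent to the surface and its component along the position vector, which is
    the normal of the space form in R^4. *)
Definition sff (M : space_form) (X : R -> R -> vec4) (i j : dir) (s t : R) : vec4 :=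
  let Xij := vpd i (vpd j X) s t in
  let tangential :=
    vsum_dir (fun k => vsum_dir (fun l =>
      vscal (metric_inv M X k l s t * ip M Xij (vpd k X s t)) (vpd l X s t))) in
  let radial := vscal (curv M * ip M Xij (X s t)) (X s t) in
  vsub (vsub Xij tangential) radial.

Definition sff_normsq (M : space_form) (X : R -> R -> vec4) (s t : R) : R :=
  sum_dir (fun i => sum_dir (fun j => sum_dir (fun k => sum_dir (fun l =>
    metric_inv M X i k s t * metric_inv M X j l s t *
    ip M (sff M X i j s t) (sff M X k l s t))))).

Definition mean_curvature_vector (M : space_form) (X : R -> R -> vec4) (s t : R) : vec4 :=
  vsum_dir (fun i => vsum_dir (fun j =>
    vscal (metric_inv M X i j s t) (sff M X i j s t))).

Definition grad_normsq (M : space_form) (X : R -> R -> vec4) (u : R -> R -> R)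
    (s t : R) : R :=
  sum_dir (fun i => sum_dir (fun j =>
    metric_inv M X i j s t * pd i u s t * pd j u s t)).

Definition smooth_map (X : R -> R -> vec4) : Prop :=
  smooth (fun s t => x0 (X s t)) /\ smooth (fun s t => x1 (X s t)) /\
  smooth (fun s t => x2 (X s t)) /\ smooth (fun s t => x3 (X s t)).

Definition in_tangent_plane (X : R -> R -> vec4) (s t : R) (v : vec4) : Prop :=
  exists p q : R, v = vadd (vscal p (vpd Ds X s t)) (vscal q (vpd Dt X s t)).

Definition immersed_at (X : R -> R -> vec4) (s t : R) : Prop :=
  forall p q : R,
    vadd (vscal p (vpd Ds X s t)) (vscal q (vpd Dt X s t)) = vzero ->
    p = 0 /\ q = 0.

(** In the last clause, the surface meets the geodesic sphere orthogonally: the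
    normal of the sphere is tangent to the surface. *)
Definition free_boundary_minimal_annulus (M : space_form) (r s0 : R)
    (X : R -> R -> vec4) : Prop :=
  smooth_map X /\
  (forall s t, X s (t + 2 * PI) = X s t) /\
  (forall s t, -s0 <= s <= s0 -> immersed_at X s t) /\
  (forall s t, -s0 <= s <= s0 -> in_ball M r (X s t)) /\
  (forall s t, -s0 <= s <= s0 -> mean_curvature_vector M X s t = vzero) /\
  (forall s t, s = -s0 \/ s = s0 ->
     in_ball_boundary M r (X s t) /\
     in_tangent_plane X s t (ball_normal M r (X s t))).

(** A smooth function on the compact annulus [[-s0, s0] x S^1] is the restriction
    of a smooth function on [R x S^1], by which it is represented below; two such
    functions represent the same element when they agree on the annulus. *)
Definition smooth_fun (u : R -> R -> R) : Prop :=
  smooth u /\ forall s t, u s (t + 2 * PI) = u s t.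

Definition vanishes_on_annulus (s0 : R) (u : R -> R -> R) : Prop :=
  forall s t, -s0 <= s <= s0 -> u s t = 0.

Definition index_form (M : space_form) (r s0 : R) (X : R -> R -> vec4)
    (u : R -> R -> R) : R :=
  RInt (fun s => RInt (fun t =>
      (grad_normsq M X u s t - (2 * curv M + sff_normsq M X s t) * u s t ^ 2)
      * area_density M X s t) 0 (2 * PI)) (-s0) s0
  - gcot M r *
    (RInt (fun t => u (-s0) t ^ 2 * length_density M X (-s0) t) 0 (2 * PI) +
     RInt (fun t => u s0 t ^ 2 * length_density M X s0 t) 0 (2 * PI)).

Definition subspace (V : (R -> R -> R) -> Prop) : Prop :=
  (forall u, V u -> smooth_fun u) /\
  V (fun _ _ => 0) /\
  (forall u v, V u -> V v -> V (fun s t => u s t + v s t)) /\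
  (forall c u, V u -> V (fun s t => c * u s t)).

(** Dimension is that of the space of restrictions to the annulus; [V] may be
    infinite-dimensional. *)
Definition dim_at_least (s0 : R) (V : (R -> R -> R) -> Prop) (k : nat) : Prop :=
  exists b : nat -> R -> R -> R,
    (forall i, (1 <= i <= k)%nat -> V (b i)) /\
    forall c : nat -> R,
      vanishes_on_annulus s0 (fun s t => sum_n_m (fun i => c i * b i s t) 1 k) ->
      forall i, (1 <= i <= k)%nat -> c i = 0.

Definition negative_definite_on (M : space_form) (r s0 : R) (X : R -> R -> vec4)
    (V : (R -> R -> R) -> Prop) : Prop :=
  forall u, V u -> ~ vanishes_on_annulus s0 u -> index_form M r s0 X u < 0.

Definition index_at_least (M : space_form) (r s0 : R) (X : R -> R -> vec4)
    (k : nat) : Prop :=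
  exists V, subspace V /\ negative_definite_on M r s0 X V /\ dim_at_least s0 V k.

Definition index_at_most (M : space_form) (r s0 : R) (X : R -> R -> vec4)
    (k : nat) : Prop :=
  forall V, subspace V -> negative_definite_on M r s0 X V ->
    ~ dim_at_least s0 V (S k).

Definition has_index (M : space_form) (r s0 : R) (X : R -> R -> vec4)
    (k : nat) : Prop :=
  index_at_least M r s0 X k /\ index_at_most M r s0 X k.

Definition catenoid_parameter (M : space_form) (a : R) : Prop :=
  match M with
  | Spherical => - (1 / 2) < a <= 0
  | Hyperbolic => 1 / 2 < a
  end.

Definition phi (M : space_form) (a s : R) : R :=
  match M with
  | Spherical =>
      sqrt (1 / 4 - a ^ 2) *
      RInt (fun t => 1 / ((1 / 2 - a * cos (2 * t)) *
                          sqrt (1 / 2 + a * cos (2 * t)))) 0 s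
  | Hyperbolic =>
      sqrt (a ^ 2 - 1 / 4) *
      RInt (fun t => 1 / ((a * cosh (2 * t) + 1 / 2) *
                          sqrt (a * cosh (2 * t) - 1 / 2))) 0 s
  end.

Definition catenoid (M : space_form) (a : R) (s t : R) : vec4 :=
  match M with
  | Spherical =>
      mkvec4 (sqrt (1 / 2 - a * cos (2 * s)) * cos (phi Spherical a s))
             (sqrt (1 / 2 - a * cos (2 * s)) * sin (phi Spherical a s))
             (sqrt (1 / 2 + a * cos (2 * s)) * cos t)
             (sqrt (1 / 2 + a * cos (2 * s)) * sin t)
  | Hyperbolic =>
      mkvec4 (sqrt (a * cosh (2 * s) + 1 / 2) * cosh (phi Hyperbolic a s))
             (sqrt (a * cosh (2 * s) + 1 / 2) * sinh (phi Hyperbolic a s))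
             (sqrt (a * cosh (2 * s) - 1 / 2) * cos t)
             (sqrt (a * cosh (2 * s) - 1 / 2) * sin t)
  end.

Definition critical_spherical_catenoid (M : space_form) (r a s0 : R) : Prop :=
  catenoid_parameter M a /\ 0 < s0 /\
  free_boundary_minimal_annulus M r s0 (catenoid M a).

(* Main.v *)
Require Import Defs.
From Stdlib Require Import Reals Lra Lia Psatz Classical FunctionalExtensionality.
From Coquelicot Require Import Coquelicot.
Open Scope R_scope.

(** In arclength [s] the catenoid is a rotation surface with metric [ds^2 + rad^2 dt^2] and
    [|B|^2 = 2 k^2], [k = flux / rad^2], and the boundary condition makes [rad] itself satisfy
    the Robin condition [f' = cot r f].

    Lower bound: the ambient coordinates satisfy [Delta x_i = - 2 curv x_i], so they are Jacobi
    functions up to the term [|B|^2 x_i]; [x_1, x_2, x_3] satisfy the Robin condition and [x_0]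
    fails it with the favourable sign. Hence the index form is negative on their span.

    Upper bound in the sphere: four linear conditions force nonnegativity, namely that the modes
    [cos t] and [sin t] vanish at [s = 0] and that the mean over the circle vanishes at
    [s = sigma] and [s = - sigma]. For the modes of order at least two, [rad] is a positive
    supersolution. For the modes of order one, the rotation about the pole gives an odd
    Jacobi function satisfying the Robin condition and positive for [s > 0]. For the mean, the
    variation of the parameter [a] gives an even Jacobi function, explicit up to one
    elliptic integral, whose only positive zero is taken as [sigma]. *)

(** Dividing by [rad], which itself satisfies the Robin condition, turns the Robin problem into a
    Neumann one: the boundary term disappears and the weight becomes [rad^3]. Picone's identity then
    replaces spectral theory: a Jacobi function of constant sign bounds the form on functions
    vanishing at an endpoint, and no eigenfunction has to exist. Fourier series are avoided too:
    only the integrals against 1, cos and sin are taken out, and a Wirtinger inequality handles the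
    rest at once.

    The delicate point is the mean beyond [sigma], where the comparison leaves a boundary term with
    the sign of [- wzeta s0]. This sign is not algebraic: the free boundary condition ties [a] to
    [s0] through the integral [phi], and [wzeta] contains another integral, [ell]. The condition
    enters as [nor0 s0 = 0], which gives [drho * tan (phi) <= c]; this confines [a] and [s0] enough
    for coarse decimal bounds to decide. If [zeta] is still nonnegative at [s0], then [sigma] is
    [s0] and the boundary term does not arise. *)

(** * Calculus on the line *)

Lemma is_derive_continuous (f : R -> R) (x l : R) : is_derive f x l -> continuous f x.
Proof. intros H. apply (ex_derive_continuous f). now exists l. Qed.

Lemma continuous_ex_RInt (f : R -> R) (a b : R) :
  (forall x, continuous f x) -> ex_RInt f a b.
Proof. intros H. apply (ex_RInt_continuous f). intros; apply H. Qed.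

Lemma is_derive_eq (f : R -> R) (x l l' : R) : is_derive f x l -> l = l' -> is_derive f x l'.
Proof. now intros H <-. Qed.

(** Lemmas on abstract normed modules leave equations typed in the carrier of a structure; the
    [change] restores the type [R] for [ring] and [field]. *)
Ltac ring_R := match goal with |- @eq _ ?a ?b => change (@eq R a b); ring end.

Ltac field_R := match goal with |- @eq _ ?a ?b => change (@eq R a b); field end.

Lemma derive_const (c x : R) : is_derive (fun _ => c) x 0.
Proof. apply (is_derive_const (V := R_NormedModule)). Qed.

Lemma derive_id (x : R) : is_derive (fun y : R => y) x 1.
Proof. apply (is_derive_id (K := R_AbsRing)). Qed.

Lemma derive_plus (f g : R -> R) (x a b : R) :
  is_derive f x a -> is_derive g x b -> is_derive (fun y => f y + g y) x (a + b).
Proof. apply (is_derive_plus f g). Qed.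

Lemma derive_minus (f g : R -> R) (x a b : R) :
  is_derive f x a -> is_derive g x b -> is_derive (fun y => f y - g y) x (a - b).
Proof. apply (is_derive_minus f g). Qed.

Lemma derive_opp (f : R -> R) (x a : R) :
  is_derive f x a -> is_derive (fun y => - f y) x (- a).
Proof. apply (is_derive_opp f). Qed.

Lemma derive_mult (f g : R -> R) (x a b : R) :
  is_derive f x a -> is_derive g x b ->
  is_derive (fun y => f y * g y) x (a * g x + f x * b).
Proof. intros Hf Hg. apply (is_derive_mult f g x a b Hf Hg Rmult_comm). Qed.

Lemma derive_div (f g : R -> R) (x a b : R) :
  is_derive f x a -> is_derive g x b -> g x <> 0 ->
  is_derive (fun y => f y / g y) x ((a * g x - f x * b) / g x ^ 2).
Proof. apply (is_derive_div f g). Qed.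

Lemma derive_comp (f g : R -> R) (x a b : R) :
  is_derive f (g x) a -> is_derive g x b -> is_derive (fun y => f (g y)) x (b * a).
Proof. apply (is_derive_comp f g). Qed.

Lemma derive_sqr (f : R -> R) (x a : R) :
  is_derive f x a -> is_derive (fun y => f y ^ 2) x (2 * f x * a).
Proof.
  intros H. change (is_derive (fun y => f y * (f y * 1)) x (2 * f x * a)).
  eapply is_derive_eq.
  - apply derive_mult; [exact H|]. apply derive_mult; [exact H|apply derive_const].
  - cbv beta. ring.
Qed.

(** The derivative is left as an existential variable and comes out in the shape dictated by the
    syntax; [is_derive_eq] then compares it with the intended value. Atoms are closed by hypotheses
    of the context, hence the [pose proof] before each call, and nonvanishing of denominators is
    left as a goal. *)
Ltac derive_R :=
  lazymatch goal with
  | |- is_derive (fun _ => ?c) _ _ => apply (derive_const c)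
  | |- is_derive (fun y => y) _ _ => apply derive_id
  | |- is_derive (fun y => @?f y + @?g y) _ _ => apply (derive_plus f g); derive_R
  | |- is_derive (fun y => @?f y - @?g y) _ _ => apply (derive_minus f g); derive_R
  | |- is_derive (fun y => - @?f y) _ _ => apply (derive_opp f); derive_R
  | |- is_derive (fun y => @?f y * @?g y) _ _ => apply (derive_mult f g); derive_R
  | |- is_derive (fun y => @?f y / @?g y) _ _ => apply (derive_div f g); [derive_R|derive_R|]
  | |- is_derive (fun y => @?f y ^ 2) _ _ => apply (derive_sqr f); derive_R
  | |- is_derive sin _ _ => apply is_derive_sin
  | |- is_derive (fun y => sin y) _ _ => apply is_derive_sin
  | |- is_derive cos _ _ => apply is_derive_cos
  | |- is_derive (fun y => cos y) _ _ => apply is_derive_cos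
  | |- is_derive (fun y => sin (@?g y)) _ _ =>
      apply (derive_comp sin g); [apply is_derive_sin|derive_R]
  | |- is_derive (fun y => cos (@?g y)) _ _ =>
      apply (derive_comp cos g); [apply is_derive_cos|derive_R]
  | |- _ => try match goal with
      | H : is_derive _ _ _ |- _ => simple apply H
      | H : forall _, is_derive _ _ _ |- _ => simple apply H
      end
  end.

Lemma continuous_Rmult (f g : R -> R) (x : R) :
  continuous f x -> continuous g x -> continuous (fun y => f y * g y) x.
Proof. apply (continuous_mult f g). Qed.

Lemma continuous_Rplus (f g : R -> R) (x : R) :
  continuous f x -> continuous g x -> continuous (fun y => f y + g y) x.
Proof. apply (continuous_plus f g). Qed.

Lemma continuous_Rminus (f g : R -> R) (x : R) :
  continuous f x -> continuous g x -> continuous (fun y => f y - g y) x.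
Proof. apply (continuous_minus f g). Qed.

Lemma continuous_Ropp (f : R -> R) (x : R) : continuous f x -> continuous (fun y => - f y) x.
Proof. apply (continuous_opp (V := R_NormedModule) f). Qed.

Lemma continuous_Rdiv (f g : R -> R) (x : R) :
  continuous f x -> continuous g x -> g x <> 0 -> continuous (fun y => f y / g y) x.
Proof.
  intros Hf Hg H0. apply continuous_Rmult; [exact Hf|].
  apply (continuous_comp g Rinv); [exact Hg|]. now apply continuous_Rinv.
Qed.

Lemma continuous_Rsqr (f : R -> R) (x : R) :
  continuous f x -> continuous (fun y => f y ^ 2) x.
Proof.
  intros H. change (continuous (fun y => f y * (f y * 1)) x).
  apply continuous_Rmult; [|apply continuous_Rmult]; try exact H. apply continuous_const.
Qed.

Lemma continuous_id_R (x : R) : continuous (fun y : R => y) x.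
Proof. apply continuous_id. Qed.

Lemma continuous_sin_R (x : R) : continuous sin x.
Proof. apply (is_derive_continuous _ _ (cos x)). apply is_derive_sin. Qed.

Lemma continuous_cos_R (x : R) : continuous cos x.
Proof. apply (is_derive_continuous _ _ (- sin x)). apply is_derive_cos. Qed.

Ltac continuity_R :=
  lazymatch goal with
  | |- continuous (fun _ => ?c) _ => apply (continuous_const c)
  | |- continuous (fun y => y) _ => apply continuous_id_R
  | |- continuous (fun y => @?f y + @?g y) _ => apply (continuous_Rplus f g); continuity_R
  | |- continuous (fun y => @?f y - @?g y) _ => apply (continuous_Rminus f g); continuity_R
  | |- continuous (fun y => - @?f y) _ => apply (continuous_Ropp f); continuity_R
  | |- continuous (fun y => @?f y * @?g y) _ => apply (continuous_Rmult f g); continuity_R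
  | |- continuous (fun y => @?f y / @?g y) _ =>
      apply (continuous_Rdiv f g); [continuity_R|continuity_R|]
  | |- continuous (fun y => @?f y ^ 2) _ => apply (continuous_Rsqr f); continuity_R
  | |- continuous sin _ => apply continuous_sin_R
  | |- continuous (fun y => sin y) _ => apply continuous_sin_R
  | |- continuous cos _ => apply continuous_cos_R
  | |- continuous (fun y => cos y) _ => apply continuous_cos_R
  | |- continuous (fun y => sin (@?g y)) _ =>
      apply (continuous_comp g sin); [continuity_R|apply continuous_sin_R]
  | |- continuous (fun y => cos (@?g y)) _ =>
      apply (continuous_comp g cos); [continuity_R|apply continuous_cos_R]
  | |- _ => try match goal with
      | H : continuous _ _ |- _ => simple apply H
      | H : forall _, continuous _ _ |- _ => simple apply H
      | H : forall _ _, continuous _ _ |- _ => simple apply H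
      end
  end.

Lemma RInt_ext_R (f g : R -> R) (a b : R) : (forall x, f x = g x) -> RInt f a b = RInt g a b.
Proof. intros H. apply RInt_ext. intros x _. apply H. Qed.

Lemma derive_nonneg_le (f df : R -> R) (a b : R) :
  a <= b ->
  (forall x, a <= x <= b -> is_derive f x (df x)) ->
  (forall x, a <= x <= b -> 0 <= df x) ->
  f a <= f b.
Proof.
  intros Hab Hd Hp.
  destruct (MVT_gen f a b df) as [c [Hc Heq]].
  - intros x Hx. rewrite Rmin_left, Rmax_right in Hx by lra. apply Hd; lra.
  - intros x Hx. rewrite Rmin_left, Rmax_right in Hx by lra.
    apply continuity_pt_filterlim. apply (is_derive_continuous _ _ (df x)). apply Hd; lra.
  - rewrite Rmin_left, Rmax_right in Hc by lra.
    assert (0 <= df c * (b - a)) by (apply Rmult_le_pos; [apply Hp|]; lra). lra.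
Qed.

Lemma derive_pos_lt (f df : R -> R) (a b : R) :
  a < b ->
  (forall x, a <= x <= b -> is_derive f x (df x)) ->
  (forall x, a < x < b -> 0 < df x) ->
  f a < f b.
Proof.
  intros Hab Hd Hp.
  destruct (MVT_cor2 f df a b Hab) as [c [Heq Hc]].
  - intros x Hx. apply is_derive_Reals. now apply Hd.
  - assert (0 < df c * (b - a)) by (apply Rmult_lt_0_compat; [now apply Hp|lra]). lra.
Qed.

Lemma RInt_of_derive (f df : R -> R) (a b : R) :
  (forall x, is_derive f x (df x)) -> (forall x, continuous df x) ->
  RInt df a b = f b - f a.
Proof.
  intros Hd Hc. apply is_RInt_unique.
  exact (is_RInt_derive f df a b (fun x _ => Hd x) (fun x _ => Hc x)).
Qed.

Lemma is_derive_primitive (f : R -> R) (a x : R) :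
  (forall y, continuous f y) -> is_derive (fun y => RInt f a y) x (f x).
Proof.
  intros Hc. apply (is_derive_RInt f (fun y => RInt f a y) a x).
  - apply filter_forall. intros y. apply (RInt_correct f a y). now apply continuous_ex_RInt.
  - apply Hc.
Qed.

Lemma RInt_reflect (f : R -> R) (a b : R) :
  (forall x, continuous f x) -> RInt (fun x => f (- x)) (- b) (- a) = RInt f a b.
Proof.
  intros Hc.
  rewrite (RInt_of_derive (fun x => - RInt f a (- x))).
  - pose proof (RInt_point (V := R_CompleteNormedModule) a f) as E.
    change (RInt f a a = 0) in E. cbv beta. rewrite !Ropp_involutive, E. lra.
  - intros x. eapply is_derive_eq.
    + apply derive_opp. apply (derive_comp (fun y => RInt f a y) (fun x => - x)).
      * now apply is_derive_primitive.
      * derive_R.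
    + ring.
  - intros x. apply (continuous_comp (fun x => - x) f); [|apply Hc].
    continuity_R.
Qed.

(** * Picone's comparison identity *)

Lemma filterlim_slope (f : R -> R) (a l : R) :
  is_derive f a l ->
  filterlim (fun x => (f x - f a) / (x - a)) (at_right a) (locally l).
Proof.
  intros Hd P [eps HP]. apply is_derive_Reals in Hd.
  destruct (Hd eps (cond_pos eps)) as [d H].
  exists d. intros x Hx Hax. apply HP.
  change (Rabs ((f x - f a) / (x - a) - l) < eps).
  replace (f x) with (f (a + (x - a))) by (f_equal; ring).
  apply H; [lra|exact Hx].
Qed.

Lemma filterlim_at_right (f : R -> R) (a : R) :
  continuous f a -> filterlim f (at_right a) (locally (f a)).
Proof. intros H. eapply filterlim_filter_le_1; [apply filter_le_within|exact H]. Qed.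

Lemma filterlim_Rmult {F : (R -> Prop) -> Prop} {FF : Filter F} (f g : R -> R) (u v : R) :
  filterlim f F (locally u) -> filterlim g F (locally v) ->
  filterlim (fun x => f x * g x) F (locally (u * v)).
Proof.
  intros Hf Hg. eapply filterlim_comp_2; [exact Hf|exact Hg|].
  apply (filterlim_mult (K := R_AbsRing)).
Qed.

(** This is the boundary term of Picone's identity at an endpoint where [y] vanishes. If [g]
    vanishes there too, its zero is simple, and [y^2 / g] is [y] times the ratio of the two
    difference quotients. *)
Lemma square_quotient_vanishes (y g : R -> R) (a dy dg : R) :
  is_derive y a dy -> is_derive g a dg -> y a = 0 -> g a <> 0 \/ dg <> 0 ->
  filterlim (fun x => y x ^ 2 / g x) (at_right a) (locally 0).
Proof.
  intros Hy Hg Ha Hn.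
  destruct (Req_dec (g a) 0) as [E|E].
  - destruct Hn as [Hn|Hn]; [easy|].
    apply filterlim_ext_loc with
      (fun x => y x * (((y x - y a) / (x - a)) * / ((g x - g a) / (x - a)))).
    + assert (Hloc : at_right a (fun x => (g x - g a) / (x - a) <> 0)).
      { apply (filterlim_slope g a dg Hg (fun z => z <> 0)). now apply open_neq. }
      assert (Hgt : at_right a (fun x => a < x)) by (exists (mkposreal 1 Rlt_0_1); easy).
      generalize (filter_and _ _ Hloc Hgt). apply filter_imp. intros x [H1 H2].
      rewrite Ha, E, !Rminus_0_r in *.
      assert (g x <> 0).
      { intros H0. apply H1. rewrite H0. unfold Rdiv; ring. }
      field; split; [easy|lra].
    + replace 0 with (y a * (dy * / dg)) by (rewrite Ha; ring).
      apply filterlim_Rmult.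
      * apply filterlim_at_right. now apply (is_derive_continuous _ _ dy).
      * apply filterlim_Rmult; [now apply filterlim_slope|].
        eapply filterlim_comp; [now apply filterlim_slope, Hg|].
        now apply continuous_Rinv.
  - replace 0 with (y a ^ 2 / g a) by (rewrite Ha; field; exact E).
    apply (filterlim_at_right (fun x => y x ^ 2 / g x)).
    apply continuous_Rdiv; [apply continuous_Rsqr|..]; try exact E.
    + now apply (is_derive_continuous _ _ dy).
    + now apply (is_derive_continuous _ _ dg).
Qed.

(* Picone's identity: [p y'^2 - q y^2 - (p g'/g y^2)' = p (y' - g'/g y)^2]. *)
Lemma picone_left (p q g dg y dy : R -> R) (a b : R) :
  a < b ->
  (forall x, continuous p x) -> (forall x, continuous q x) ->
  (forall x, is_derive g x (dg x)) ->
  (forall x, is_derive (fun t => p t * dg t) x (- q x * g x)) ->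
  (forall x, is_derive y x (dy x)) -> (forall x, continuous dy x) ->
  (forall x, 0 < p x) ->
  (forall x, a < x <= b -> 0 < g x) ->
  y a = 0 -> g a <> 0 \/ dg a <> 0 ->
  p b * dg b / g b * y b ^ 2 <= RInt (fun x => p x * dy x ^ 2 - q x * y x ^ 2) a b.
Proof.
  intros Hab Cp Cq Dg Dpg Dy Cdy Pp Pg Ya Hn.
  assert (Cy : forall x, continuous y x) by (intros x; now apply (is_derive_continuous _ _ (dy x))).
  set (J := fun x => p x * dy x ^ 2 - q x * y x ^ 2).
  assert (CJ : forall x, continuous J x) by (intros x; unfold J; continuity_R).
  (* The derivative of [Phi] is the square in Picone's identity. Since [g a] may be zero,
     monotonicity is proved on the half-open interval and the value at [a] is replaced by a
     limit. *)
  set (Phi := fun x => RInt J a x + - (p x * dg x) * (y x ^ 2 / g x)).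
  assert (Mono : forall s, a < s <= b -> Phi s <= Phi b).
  { intros s Hs.
    apply (derive_nonneg_le Phi (fun x => p x * (dy x - dg x / g x * y x) ^ 2)); [lra|..].
    - intros x Hx. assert (0 < g x) by (apply Pg; lra).
      pose proof (is_derive_primitive J a x CJ) as D0.
      eapply is_derive_eq.
      + unfold Phi. apply derive_plus; [exact D0|].
        apply (derive_mult (fun t => - (p t * dg t)) (fun t => y t ^ 2 / g t));
          [apply derive_opp, Dpg|].
        apply derive_div; [apply derive_sqr, Dy|apply Dg|lra].
      + unfold J. cbv beta. field. lra.
    - intros x _. apply Rmult_le_pos; [specialize (Pp x); lra|apply pow2_ge_0]. }
  assert (Lim : filterlim Phi (at_right a) (locally 0)).
  { replace 0 with (0 + - (p a * dg a) * 0) by ring.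
    unfold Phi. eapply filterlim_comp_2; [| |apply (filterlim_plus (V := R_NormedModule))].
    - pose proof (RInt_point (V := R_CompleteNormedModule) a J) as E.
      change (RInt J a a = 0) in E. rewrite <- E at 1.
      apply (filterlim_at_right (fun x => RInt J a x)).
      apply (is_derive_continuous _ _ (J a)). now apply is_derive_primitive.
    - apply filterlim_Rmult.
      + apply (filterlim_at_right (fun x => - (p x * dg x))). apply continuous_Ropp.
        apply (is_derive_continuous _ _ _ (Dpg a)).
      + now apply (square_quotient_vanishes y g a (dy a) (dg a)). }
  assert (Hle : Rbar_le 0 (Phi b)).
  { apply (filterlim_le (F := at_right a) Phi (fun _ => Phi b)).
    - exists (mkposreal (b - a) ltac:(lra)). intros x Hx Hax. apply Mono.
      change (Rabs (x - a) < b - a) in Hx. apply Rabs_def2 in Hx. lra.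
    - exact Lim.
    - apply filterlim_const. }
  simpl in Hle. unfold Phi in Hle. fold J.
  replace (p b * dg b / g b * y b ^ 2) with (p b * dg b * (y b ^ 2 / g b)); [lra|].
  field. specialize (Pg b). lra.
Qed.

(** Reflection of [picone_left] in the origin; the derivative of [g] changes sign, hence the minus
    in the boundary term. *)
Lemma picone_right (p q g dg y dy : R -> R) (a b : R) :
  a < b ->
  (forall x, continuous p x) -> (forall x, continuous q x) ->
  (forall x, is_derive g x (dg x)) ->
  (forall x, is_derive (fun t => p t * dg t) x (- q x * g x)) ->
  (forall x, is_derive y x (dy x)) -> (forall x, continuous dy x) ->
  (forall x, 0 < p x) ->
  (forall x, a <= x < b -> 0 < g x) ->
  y b = 0 -> g b <> 0 \/ dg b <> 0 ->
  - (p a * dg a / g a * y a ^ 2) <= RInt (fun x => p x * dy x ^ 2 - q x * y x ^ 2) a b.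
Proof.
  intros Hab Cp Cq Dg Dpg Dy Cdy Pp Pg Yb Hn.
  assert (Cy : forall x, continuous y x) by (intros x; now apply (is_derive_continuous _ _ (dy x))).
  assert (Dopp : forall x, is_derive (fun t => - t) x (-1)).
  { intros x. apply (derive_opp (fun t => t)), derive_id. }
  assert (Copp : forall (f : R -> R), (forall x, continuous f x) ->
            forall x, continuous (fun t => f (- t)) x).
  { intros f Cf x. apply (continuous_comp (fun t => - t) f); [|apply Cf].
    apply (is_derive_continuous _ _ _ (Dopp x)). }
  assert (DO : forall (f df : R -> R), (forall x, is_derive f x (df x)) ->
            forall x, is_derive (fun t => f (- t)) x (- df (- x))).
  { intros f df Df x. eapply is_derive_eq; [apply derive_comp; [apply Df|apply Dopp]|]. ring. }
  rewrite <- (RInt_reflect (fun x => p x * dy x ^ 2 - q x * y x ^ 2)).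
  2: { intros x. continuity_R. }
  pose proof (picone_left (fun x => p (- x)) (fun x => q (- x)) (fun x => g (- x))
    (fun x => - dg (- x)) (fun x => y (- x)) (fun x => - dy (- x)) (- b) (- a)) as H.
  cbv beta in H. rewrite !Ropp_involutive in H.
  replace (- (p a * dg a / g a * y a ^ 2)) with (p a * - dg a / g a * y a ^ 2)
    by (unfold Rdiv; ring).
  eapply Rle_trans; [apply H; clear H|]; auto.
  - intros x. eapply is_derive_eq.
    + apply (is_derive_ext (fun t => - (p (- t) * dg (- t)))); [intros t; change (- (p (- t) * dg (- t)) = p (- t) * - dg (- t)); ring|].
      apply derive_opp. apply (DO (fun t => p t * dg t) _ Dpg).
    + ring.
  - intros x. apply continuous_Ropp, Copp, Cdy.
  - intros x Hx. apply Pg. lra.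
  - destruct Hn; [left|right]; lra.
  - right. apply RInt_ext_R. intros x. ring.
Qed.

(** * Integrals of continuous functions *)

Lemma RInt_plus_R (f g : R -> R) (a b : R) :
  (forall x, continuous f x) -> (forall x, continuous g x) ->
  RInt (fun x => f x + g x) a b = RInt f a b + RInt g a b.
Proof. intros Hf Hg. apply (RInt_plus f g); now apply continuous_ex_RInt. Qed.

Lemma RInt_minus_R (f g : R -> R) (a b : R) :
  (forall x, continuous f x) -> (forall x, continuous g x) ->
  RInt (fun x => f x - g x) a b = RInt f a b - RInt g a b.
Proof. intros Hf Hg. apply (RInt_minus f g); now apply continuous_ex_RInt. Qed.

Lemma RInt_scal_R (c : R) (f : R -> R) (a b : R) :
  (forall x, continuous f x) -> RInt (fun x => c * f x) a b = c * RInt f a b.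
Proof. intros Hf. apply (RInt_scal f a b c). now apply continuous_ex_RInt. Qed.

Lemma RInt_const_R (c a b : R) : RInt (fun _ => c) a b = (b - a) * c.
Proof. apply (RInt_const a b c). Qed.

Lemma RInt_Chasles_R (f : R -> R) (a b c : R) :
  (forall x, continuous f x) -> RInt f a c = RInt f a b + RInt f b c.
Proof. intros Hf. symmetry. apply (RInt_Chasles f a b c); now apply continuous_ex_RInt. Qed.

Lemma RInt_le_R (f g : R -> R) (a b : R) :
  a <= b -> (forall x, continuous f x) -> (forall x, continuous g x) ->
  (forall x, a <= x <= b -> f x <= g x) -> RInt f a b <= RInt g a b.
Proof.
  intros Hab Hf Hg H. apply RInt_le; try now apply continuous_ex_RInt. exact Hab.
  intros x Hx. apply H. lra.
Qed.

Lemma RInt_nonneg (f : R -> R) (a b : R) :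
  a <= b -> (forall x, continuous f x) -> (forall x, a <= x <= b -> 0 <= f x) ->
  0 <= RInt f a b.
Proof.
  intros Hab Hf H. replace 0 with (RInt (fun _ : R => 0) a b).
  - apply RInt_le_R; auto. intros x. apply continuous_const.
  - rewrite RInt_const_R. ring_R.
Qed.

Lemma RInt_translate (f : R -> R) (v a b : R) :
  (forall x, continuous f x) -> RInt (fun x => f (x + v)) a b = RInt f (a + v) (b + v).
Proof.
  intros Hf.
  rewrite (RInt_of_derive (fun x => RInt f (a + v) (x + v))).
  - pose proof (RInt_point (V := R_CompleteNormedModule) (a + v) f) as E.
    change (RInt f (a + v) (a + v) = 0) in E. rewrite E. lra.
  - intros x. eapply is_derive_eq.
    + apply (derive_comp (fun y => RInt f (a + v) y) (fun x => x + v)).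
      * now apply is_derive_primitive.
      * derive_R.
    + ring.
  - intros x. apply (continuous_comp (fun x => x + v) f); [|apply Hf]. continuity_R.
Qed.

Lemma RInt_periodic (f : R -> R) (T a : R) :
  (forall x, continuous f x) -> (forall x, f (x + T) = f x) ->
  RInt f a (a + T) = RInt f 0 T.
Proof.
  intros Hf Hp.
  rewrite (RInt_Chasles_R f a 0 (a + T) Hf), (RInt_Chasles_R f 0 T (a + T) Hf).
  assert (E : RInt f T (a + T) = RInt f 0 a).
  { replace T with (0 + T) at 1 by ring. rewrite <- RInt_translate by exact Hf.
    apply RInt_ext_R. intros x. apply Hp. }
  rewrite E. pose proof (opp_RInt_swap f a 0) as S.
  assert (E2 : - RInt f a 0 = RInt f 0 a).
  { apply S. now apply continuous_ex_RInt. }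
  lra.
Qed.

(** * Wirtinger inequalities *)

Lemma RInt_sqr_le (f : R -> R) (a b : R) :
  a < b -> (forall x, continuous f x) ->
  RInt f a b ^ 2 / (b - a) <= RInt (fun x => f x ^ 2) a b.
Proof.
  intros Hab Hf. set (m := RInt f a b / (b - a)).
  assert (H : 0 <= RInt (fun x => f x ^ 2 - 2 * m * f x + m ^ 2) a b).
  { apply RInt_nonneg; [lra|intros x; continuity_R|].
    intros x _. replace (f x ^ 2 - 2 * m * f x + m ^ 2) with ((f x - m) ^ 2) by ring.
    apply pow2_ge_0. }
  rewrite RInt_plus_R, RInt_minus_R, RInt_scal_R, RInt_const_R in H
    by (intros x; continuity_R).
  unfold m in H.
  replace (RInt f a b ^ 2 / (b - a)) with
    (2 * (RInt f a b / (b - a)) * RInt f a b - (b - a) * (RInt f a b / (b - a)) ^ 2)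
    by (field; lra).
  lra.
Qed.

(* Picone's identity with [sin (2 (x - a))], whose logarithmic derivative vanishes at
   the other end of a quarter of its period. *)
Lemma wirtinger_quarter_left (y dy : R -> R) (a : R) :
  (forall x, is_derive y x (dy x)) -> (forall x, continuous dy x) -> y a = 0 ->
  0 <= RInt (fun x => dy x ^ 2 - 4 * y x ^ 2) a (a + PI / 4).
Proof.
  intros Dy Cdy Ya. pose proof PI_RGT_0.
  pose proof (picone_left (fun _ => 1) (fun _ => 4) (fun x => sin (2 * (x - a)))
    (fun x => 2 * cos (2 * (x - a))) y dy a (a + PI / 4)) as P.
  cbv beta in P.
  replace (2 * (a + PI / 4 - a)) with (PI / 2) in P by field.
  rewrite cos_PI2 in P.
  replace (RInt (fun x => dy x ^ 2 - 4 * y x ^ 2) a (a + PI / 4))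
    with (RInt (fun x => 1 * dy x ^ 2 - 4 * y x ^ 2) a (a + PI / 4))
    by (apply RInt_ext_R; intros; ring).
  eapply Rle_trans; [|apply P; clear P]; auto.
  - right. rewrite sin_PI2. field.
  - lra.
  - intros x. continuity_R.
  - intros x. continuity_R.
  - intros x. eapply is_derive_eq; [derive_R|cbv beta; ring].
  - intros x. eapply is_derive_eq; [derive_R|cbv beta; ring].
  - intros; lra.
  - intros x Hx. apply sin_gt_0; lra.
  - right. rewrite Rminus_diag, Rmult_0_r, cos_0. lra.
Qed.

Lemma wirtinger_quarter_right (y dy : R -> R) (b : R) :
  (forall x, is_derive y x (dy x)) -> (forall x, continuous dy x) -> y b = 0 ->
  0 <= RInt (fun x => dy x ^ 2 - 4 * y x ^ 2) (b - PI / 4) b.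
Proof.
  intros Dy Cdy Yb.
  assert (Cy : forall x, continuous y x) by (intros x; now apply (is_derive_continuous _ _ (dy x))).
  rewrite <- (RInt_reflect (fun x => dy x ^ 2 - 4 * y x ^ 2)) by (intros x; continuity_R).
  replace (- (b - PI / 4)) with (- b + PI / 4) by ring.
  pose proof (wirtinger_quarter_left (fun x => y (- x)) (fun x => - dy (- x)) (- b)) as W.
  eapply Rle_trans; [apply W; clear W|].
  - intros x. eapply is_derive_eq.
    + apply (derive_comp y (fun x => - x)); [apply Dy|derive_R].
    + ring.
  - intros x. apply continuous_Ropp.
    apply (continuous_comp (fun t => - t) dy); [continuity_R|apply Cdy].
  - now rewrite Ropp_involutive.
  - right. apply RInt_ext_R. intros x. ring.
Qed.

(** On the whole interval the comparison function would vanish at both ends, whereas [picone_left]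
    admits a zero at one end only; hence the cut at the midpoint. *)
Lemma wirtinger_half (y dy : R -> R) (a : R) :
  (forall x, is_derive y x (dy x)) -> (forall x, continuous dy x) ->
  y a = 0 -> y (a + PI / 2) = 0 ->
  0 <= RInt (fun x => dy x ^ 2 - 4 * y x ^ 2) a (a + PI / 2).
Proof.
  intros Dy Cdy Ya Yb.
  assert (Cy : forall x, continuous y x) by (intros x; now apply (is_derive_continuous _ _ (dy x))).
  rewrite (RInt_Chasles_R _ a (a + PI / 4)) by (intros x; continuity_R).
  pose proof (wirtinger_quarter_left y dy a Dy Cdy Ya).
  pose proof (wirtinger_quarter_right y dy _ Dy Cdy Yb) as W.
  replace (a + PI / 2 - PI / 4) with (a + PI / 4) in W by field. lra.
Qed.

(* A function of period [pi] takes the same value at two points half a period apart. *)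
Lemma wirtinger_pi (f df : R -> R) :
  (forall x, is_derive f x (df x)) -> (forall x, continuous df x) ->
  (forall x, f (x + PI) = f x) -> (forall x, df (x + PI) = df x) ->
  4 * RInt (fun x => f x ^ 2) 0 PI - 4 / PI * RInt f 0 PI ^ 2
    <= RInt (fun x => df x ^ 2) 0 PI.
Proof.
  intros Df Cdf Pf Pdf. pose proof PI_RGT_0 as HPI.
  assert (Cf : forall x, continuous f x) by (intros x; now apply (is_derive_continuous _ _ (df x))).
  assert (Hz : exists a, f (a + PI / 2) = f a).
  { destruct (IVT_gen (fun x => f (x + PI / 2) - f x) 0 (PI / 2) 0) as [a [_ Ha]].
    - intros x. apply continuity_pt_filterlim.
      apply (continuous_Rminus (fun x => f (x + PI / 2)) f); [|apply Cf].
      apply (continuous_comp (fun x => x + PI / 2) f); [continuity_R|apply Cf].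
    - replace (PI / 2 + PI / 2) with (0 + PI) by field. rewrite Pf, Rplus_0_l.
      unfold Rmin, Rmax. destruct (Rle_dec _ _); lra.
    - exists a. lra. }
  destruct Hz as [a Ha]. set (m := f a).
  assert (W : 0 <= RInt (fun x => df x ^ 2 - 4 * (f x - m) ^ 2) a (a + PI)).
  { rewrite (RInt_Chasles_R _ a (a + PI / 2)) by (intros x; continuity_R).
    assert (D : forall x, is_derive (fun x => f x - m) x (df x)).
    { intros x. eapply is_derive_eq; [derive_R|ring]. }
    pose proof (wirtinger_half (fun x => f x - m) df a D Cdf) as W1.
    pose proof (wirtinger_half (fun x => f x - m) df (a + PI / 2) D Cdf) as W2.
    cbv beta in W1, W2.
    replace (a + PI / 2 + PI / 2) with (a + PI) in W2 by field.
    rewrite Pf, Ha in W2. rewrite Ha in W1. unfold m in *.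
    specialize (W1 ltac:(ring) ltac:(ring)). specialize (W2 ltac:(ring) ltac:(ring)). lra. }
  rewrite (RInt_periodic (fun x => df x ^ 2 - 4 * (f x - m) ^ 2)) in W;
    [|intros x; continuity_R|intros x; now rewrite Pf, Pdf].
  replace (RInt (fun x => df x ^ 2 - 4 * (f x - m) ^ 2) 0 PI) with
    (RInt (fun x => df x ^ 2 - 4 * (f x ^ 2 - 2 * m * f x + m ^ 2)) 0 PI) in W
    by (apply RInt_ext_R; intros; ring).
  rewrite RInt_minus_R, RInt_scal_R, RInt_plus_R, RInt_minus_R, RInt_scal_R, RInt_const_R in W
    by (intros x; continuity_R).
  set (I1 := RInt f 0 PI) in *. set (I2 := RInt (fun x => f x ^ 2) 0 PI) in *.
  set (I3 := RInt (fun x => df x ^ 2) 0 PI) in *.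
  (* The constant [m] is a value of [f] and not its mean, but the mean minimises the integral of
     [(f - m)^2] over all constants, so it may take the place of [m]. *)
  assert (0 <= 4 / PI * (I1 - PI * m) ^ 2).
  { apply Rmult_le_pos; [|apply pow2_ge_0]. apply Rlt_le, Rdiv_lt_0_compat; lra. }
  replace (4 / PI * (I1 - PI * m) ^ 2) with (4 / PI * I1 ^ 2 - 8 * m * I1 + 4 * PI * m ^ 2)
    in * by (field; lra).
  lra.
Qed.

(** * Functions on circles and on the annulus *)

Lemma RInt_trig_sqr (m p q : R) :
  RInt (fun t => (m + p * cos t + q * sin t) ^ 2) 0 (2 * PI)
  = 2 * PI * m ^ 2 + PI * (p ^ 2 + q ^ 2).
Proof.
  rewrite (RInt_of_derive (fun t => m ^ 2 * t + p ^ 2 * ((t + sin t * cos t) / 2)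
       + q ^ 2 * ((t - sin t * cos t) / 2)
       + 2 * m * p * sin t - 2 * m * q * cos t + p * q * sin t ^ 2)).
  - rewrite sin_2PI, cos_2PI, sin_0, cos_0. field_R.
  - intros x. eapply is_derive_eq; [derive_R; lra|]. cbv beta.
    pose proof (sin2_cos2 x) as SC. unfold Rsqr in SC.
    transitivity (m ^ 2 + 2 * m * p * cos x + 2 * m * q * sin x + 2 * p * q * (sin x * cos x)
        + p ^ 2 * ((sin x * sin x + cos x * cos x) + cos x * cos x - sin x * sin x) / 2
        + q ^ 2 * ((sin x * sin x + cos x * cos x) - cos x * cos x + sin x * sin x) / 2).
    + rewrite SC. field.
    + field.
  - intros x. continuity_R.
Qed.

Lemma bessel_inequality (f : R -> R) :
  (forall x, continuous f x) ->
  RInt f 0 (2 * PI) ^ 2 / (2 * PI)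
  + (RInt (fun t => f t * cos t) 0 (2 * PI) ^ 2
     + RInt (fun t => f t * sin t) 0 (2 * PI) ^ 2) / PI
  <= RInt (fun t => f t ^ 2) 0 (2 * PI).
Proof.
  intros Cf. pose proof PI_RGT_0 as HPI.
  set (M := RInt f 0 (2 * PI)). set (A := RInt (fun t => f t * cos t) 0 (2 * PI)).
  set (B := RInt (fun t => f t * sin t) 0 (2 * PI)).
  set (m := M / (2 * PI)). set (p := A / PI). set (q := B / PI).
  assert (H : 0 <= RInt (fun t => (f t - (m + p * cos t + q * sin t)) ^ 2) 0 (2 * PI)).
  { apply RInt_nonneg; [lra|intros x; continuity_R|]. intros; apply pow2_ge_0. }
  rewrite (RInt_ext_R _ (fun t =>
    (f t ^ 2 - 2 * m * f t) - 2 * p * (f t * cos t) - 2 * q * (f t * sin t)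
    + (m + p * cos t + q * sin t) ^ 2)) in H by (intros; ring_R).
  rewrite RInt_plus_R, !RInt_minus_R, !RInt_scal_R in H by (intros x; continuity_R).
  fold M A B in H.
  rewrite RInt_trig_sqr in H. unfold m, p, q in H.
  replace (M ^ 2 / (2 * PI) + (A ^ 2 + B ^ 2) / PI) with
    (2 * (M / (2 * PI)) * M + 2 * (A / PI) * A + 2 * (B / PI) * B
     - (2 * PI * (M / (2 * PI)) ^ 2 + PI * ((A / PI) ^ 2 + (B / PI) ^ 2))) by (field; lra).
  lra.
Qed.

Lemma RInt_split_period (f : R -> R) :
  (forall x, continuous f x) ->
  RInt f 0 (2 * PI) = RInt (fun t => f t + f (t + PI)) 0 PI.
Proof.
  intros Cf.
  assert (Ct : forall x, continuous (fun t => f (t + PI)) x).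
  { intros x. apply (continuous_comp (fun t => t + PI) f); [continuity_R|apply Cf]. }
  rewrite (RInt_Chasles_R f 0 PI) by exact Cf.
  rewrite RInt_plus_R by assumption. rewrite RInt_translate by exact Cf.
  replace (0 + PI) with PI by ring. now replace (PI + PI) with (2 * PI) by ring.
Qed.

(* Split [f] into its [pi]-periodic part [e] and its [pi]-antiperiodic part [o]; then
   [o cos] and [o sin] are [pi]-periodic, with [(o cos)'^2 + (o sin)'^2 = o'^2 + o^2]. *)
Lemma wirtinger_three (f df : R -> R) :
  (forall x, is_derive f x (df x)) -> (forall x, continuous df x) ->
  (forall x, f (x + 2 * PI) = f x) -> (forall x, df (x + 2 * PI) = df x) ->
  3 * RInt (fun t => f t ^ 2) 0 (2 * PI) - 3 * RInt f 0 (2 * PI) ^ 2 / (2 * PI)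
  - 2 * (RInt (fun t => f t * cos t) 0 (2 * PI) ^ 2
         + RInt (fun t => f t * sin t) 0 (2 * PI) ^ 2) / PI
  <= RInt (fun t => df t ^ 2) 0 (2 * PI).
Proof.
  intros Df Cdf Pf Pdf. pose proof PI_RGT_0 as HPI.
  assert (Cf : forall x, continuous f x) by (intros x; now apply (is_derive_continuous _ _ (df x))).
  set (e := fun t => (f t + f (t + PI)) / 2). set (o := fun t => (f t - f (t + PI)) / 2).
  set (de := fun t => (df t + df (t + PI)) / 2). set (do := fun t => (df t - df (t + PI)) / 2).
  assert (PP : forall x, f (x + PI + PI) = f x).
  { intros x. rewrite <- (Pf x). f_equal. ring. }
  assert (PdP : forall x, df (x + PI + PI) = df x).
  { intros x. rewrite <- (Pdf x). f_equal. ring. }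
  assert (Ds : forall x, is_derive (fun t => f (t + PI)) x (df (x + PI))).
  { intros x. eapply is_derive_eq.
    - apply (derive_comp f (fun t => t + PI)); [apply Df|derive_R].
    - ring. }
  assert (Cds : forall x, continuous (fun t => df (t + PI)) x).
  { intros x. apply (continuous_comp (fun t => t + PI) df); [continuity_R|apply Cdf]. }
  assert (De : forall x, is_derive e x (de x)).
  { intros x. unfold e, de. eapply is_derive_eq; [derive_R; lra|field]. }
  assert (Do : forall x, is_derive o x (do x)).
  { intros x. unfold o, do. eapply is_derive_eq; [derive_R; lra|field]. }
  assert (Cde : forall x, continuous de x) by (intros x; unfold de; continuity_R; lra).
  assert (Cdo : forall x, continuous do x) by (intros x; unfold do; continuity_R; lra).
  assert (Ce : forall x, continuous e x) by (intros x; now apply (is_derive_continuous _ _ (de x))).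
  assert (Co : forall x, continuous o x) by (intros x; now apply (is_derive_continuous _ _ (do x))).
  set (M := RInt f 0 (2 * PI)). set (A := RInt (fun t => f t * cos t) 0 (2 * PI)).
  set (B := RInt (fun t => f t * sin t) 0 (2 * PI)).
  assert (EM : M = 2 * RInt e 0 PI).
  { unfold M. rewrite RInt_split_period by exact Cf. rewrite <- RInt_scal_R by exact Ce.
    apply RInt_ext_R. intros x. unfold e. field. }
  assert (EA : A = 2 * RInt (fun t => o t * cos t) 0 PI).
  { unfold A. rewrite RInt_split_period by (intros x; continuity_R).
    rewrite <- RInt_scal_R by (intros x; continuity_R).
    apply RInt_ext_R. intros x. rewrite neg_cos. unfold o. field. }
  assert (EB : B = 2 * RInt (fun t => o t * sin t) 0 PI).
  { unfold B. rewrite RInt_split_period by (intros x; continuity_R).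
    rewrite <- RInt_scal_R by (intros x; continuity_R).
    apply RInt_ext_R. intros x. rewrite neg_sin. unfold o. field. }
  assert (E2 : RInt (fun t => f t ^ 2) 0 (2 * PI)
    = 2 * RInt (fun t => e t ^ 2) 0 PI + 2 * RInt (fun t => o t ^ 2) 0 PI).
  { rewrite RInt_split_period by (intros x; continuity_R).
    rewrite <- !RInt_scal_R, <- RInt_plus_R by (intros x; continuity_R).
    apply RInt_ext_R. intros x. unfold e, o. field. }
  assert (Ed2 : RInt (fun t => df t ^ 2) 0 (2 * PI)
    = 2 * RInt (fun t => de t ^ 2) 0 PI + 2 * RInt (fun t => do t ^ 2) 0 PI).
  { rewrite RInt_split_period by (intros x; continuity_R).
    rewrite <- !RInt_scal_R, <- RInt_plus_R by (intros x; continuity_R).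
    apply RInt_ext_R. intros x. unfold de, do. field. }
  pose proof (wirtinger_pi e de De Cde) as We.
  specialize (We ltac:(intros x; unfold e; rewrite PP; field)
                 ltac:(intros x; unfold de; rewrite PdP; field)).
  (* The integrals of [o cos] and [o sin] over a half circle are half the first Fourier coefficients
     of [f]. Up to these, adding the inequalities for the two products gives [4 o^2 <= o'^2 + o^2]
     in the mean; this is the origin of the constant 3. *)
  pose proof (wirtinger_pi (fun t => o t * cos t) (fun t => do t * cos t - o t * sin t)) as Wc.
  specialize (Wc ltac:(intros x; eapply is_derive_eq; [derive_R|cbv beta; ring])
    ltac:(intros x; continuity_R)
    ltac:(intros x; cbv beta; rewrite neg_cos; unfold o; rewrite PP; field)
    ltac:(intros x; cbv beta; rewrite neg_cos, neg_sin; unfold o, do; rewrite PP, PdP; field)).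
  pose proof (wirtinger_pi (fun t => o t * sin t) (fun t => do t * sin t + o t * cos t)) as Ws.
  specialize (Ws ltac:(intros x; eapply is_derive_eq; [derive_R|cbv beta; ring])
    ltac:(intros x; continuity_R)
    ltac:(intros x; cbv beta; rewrite neg_sin; unfold o; rewrite PP; field)
    ltac:(intros x; cbv beta; rewrite neg_cos, neg_sin; unfold o, do; rewrite PP, PdP; field)).
  cbv beta in Wc, Ws.
  assert (SC : forall x, sin x * sin x = 1 - cos x * cos x).
  { intros x. pose proof (sin2_cos2 x) as SC. unfold Rsqr in SC. lra. }
  assert (S0 : RInt (fun x => (o x * cos x) ^ 2) 0 PI + RInt (fun x => (o x * sin x) ^ 2) 0 PI
     = RInt (fun t => o t ^ 2) 0 PI).
  { rewrite <- RInt_plus_R by (intros x; continuity_R). apply RInt_ext_R. intros x.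
    replace ((o x * cos x) ^ 2 + (o x * sin x) ^ 2)
      with (o x ^ 2 * (cos x * cos x + sin x * sin x)) by ring. rewrite SC. ring. }
  assert (S1 : RInt (fun x => (do x * cos x - o x * sin x) ^ 2) 0 PI
     + RInt (fun x => (do x * sin x + o x * cos x) ^ 2) 0 PI
     = RInt (fun t => do t ^ 2) 0 PI + RInt (fun t => o t ^ 2) 0 PI).
  { rewrite <- !RInt_plus_R by (intros x; continuity_R). apply RInt_ext_R. intros x.
    replace ((do x * cos x - o x * sin x) ^ 2 + (do x * sin x + o x * cos x) ^ 2)
      with ((do x ^ 2 + o x ^ 2) * (cos x * cos x + sin x * sin x)) by ring. rewrite SC. ring. }
  (* On [e] the constant is 4; the Cauchy-Schwarz inequality weakens it to the common value 3. *)
  pose proof (RInt_sqr_le e 0 PI HPI Ce) as CS. rewrite Rminus_0_r in CS.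
  rewrite E2, Ed2, EM, EA, EB.
  set (a1 := RInt e 0 PI) in *. set (a2 := RInt (fun t => o t * cos t) 0 PI) in *.
  set (a3 := RInt (fun t => o t * sin t) 0 PI) in *.
  replace (3 * (2 * a1) ^ 2 / (2 * PI)) with (6 * (a1 ^ 2 / PI)) by (field; lra).
  replace (2 * ((2 * a2) ^ 2 + (2 * a3) ^ 2) / PI)
    with (8 * (a2 ^ 2 / PI) + 8 * (a3 ^ 2 / PI)) by (field; lra).
  replace (4 / PI * a1 ^ 2) with (4 * (a1 ^ 2 / PI)) in We by (field; lra).
  replace (4 / PI * a2 ^ 2) with (4 * (a2 ^ 2 / PI)) in Wc by (field; lra).
  replace (4 / PI * a3 ^ 2) with (4 * (a3 ^ 2 / PI)) in Ws by (field; lra).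
  lra.
Qed.

Lemma continuity_2d_slice (f : R -> R -> R) (s t : R) :
  continuity_2d_pt f s t -> continuous (fun z => f s z) t.
Proof.
  intros H P [eps HP]. destruct (H eps) as [d Hd].
  exists d. intros y Hy. apply HP. change (Rabs (f s y - f s t) < eps).
  apply Hd; [|exact Hy]. rewrite Rminus_diag, Rabs_R0. apply cond_pos.
Qed.

Lemma is_derive_RInt_parameter (f df : R -> R -> R) (a b s : R) :
  (forall s t, is_derive (fun z => f z t) s (df s t)) ->
  (forall s t, continuity_2d_pt f s t) -> (forall s t, continuity_2d_pt df s t) ->
  is_derive (fun z => RInt (f z) a b) s (RInt (df s) a b).
Proof.
  intros Df Cf Cdf.
  assert (E : (fun u v => Derive (fun z => f z v) u) = df).
  { apply functional_extensionality; intros u. apply functional_extensionality; intros v.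
    apply is_derive_unique, Df. }
  replace (RInt (df s) a b) with (RInt (fun t => Derive (fun u => f u t) s) a b).
  - apply (is_derive_RInt_param f a b s).
    + apply filter_forall. intros x t _. exists (df x t). apply Df.
    + intros t _. rewrite E. apply Cdf.
    + apply filter_forall. intros y. apply continuous_ex_RInt.
      intros t. apply (continuity_2d_slice f), Cf.
  - apply RInt_ext_R. intros t. apply is_derive_unique, Df.
Qed.

Lemma smooth_ds (f : R -> R -> R) : smooth f -> smooth (pd Ds f).
Proof. intros H n s t. apply (ex_diff_n_deriv_aux1 f n s t), H. Qed.

Lemma smooth_dt (f : R -> R -> R) : smooth f -> smooth (pd Dt f).
Proof. intros H n s t. apply (ex_diff_n_deriv_aux2 f n s t), H. Qed.

Lemma smooth_continuity (f : R -> R -> R) (s t : R) : smooth f -> continuity_2d_pt f s t.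
Proof. intros H. apply (H 0%nat s t). Qed.

Lemma smooth_is_derive_s (f : R -> R -> R) (s t : R) :
  smooth f -> is_derive (fun z => f z t) s (pd Ds f s t).
Proof. intros H. apply Derive_correct. destruct (H 1%nat s t) as [_ [H1 _]]. exact H1. Qed.

Lemma smooth_is_derive_t (f : R -> R -> R) (s t : R) :
  smooth f -> is_derive (fun z => f s z) t (pd Dt f s t).
Proof. intros H. apply Derive_correct. destruct (H 1%nat s t) as [_ [_ [H1 _]]]. exact H1. Qed.

Lemma smooth_ext (f g : R -> R -> R) : (forall s t, f s t = g s t) -> smooth f -> smooth g.
Proof.
  intros E H n s t. apply (ex_diff_n_ext_loc f); [|apply H].
  exists (mkposreal 1 Rlt_0_1). intros; apply E.
Qed.

(** The induction on the order generalises over [f] and [g], because each partial derivative of a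
    combination is a combination of other smooth functions. *)
Lemma smooth_combination (a b : R) (f g : R -> R -> R) :
  smooth f -> smooth g -> smooth (fun s t => a * f s t + b * g s t).
Proof.
  intros Hf Hg n. revert f g Hf Hg. induction n as [|n IH]; intros f g Hf Hg s t.
  - split; [|exact I]. apply continuity_2d_pt_plus.
    + apply continuity_2d_pt_mult; [apply continuity_2d_pt_const|now apply smooth_continuity].
    + apply continuity_2d_pt_mult; [apply continuity_2d_pt_const|now apply smooth_continuity].
  - assert (Es : forall u v, is_derive (fun z => a * f z v + b * g z v) u
                   (a * pd Ds f u v + b * pd Ds g u v)).
    { intros u v. pose proof (smooth_is_derive_s f u v Hf). pose proof (smooth_is_derive_s g u v Hg).
      eapply is_derive_eq; [derive_R|ring]. }
    assert (Et : forall u v, is_derive (fun z => a * f u z + b * g u z) v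
                   (a * pd Dt f u v + b * pd Dt g u v)).
    { intros u v. pose proof (smooth_is_derive_t f u v Hf). pose proof (smooth_is_derive_t g u v Hg).
      eapply is_derive_eq; [derive_R|ring]. }
    split; [|split; [|split; [|split]]].
    + apply continuity_2d_pt_plus.
      * apply continuity_2d_pt_mult; [apply continuity_2d_pt_const|now apply smooth_continuity].
      * apply continuity_2d_pt_mult; [apply continuity_2d_pt_const|now apply smooth_continuity].
    + eexists; apply Es.
    + eexists; apply Et.
    + apply (ex_diff_n_ext_loc (fun u v => a * pd Ds f u v + b * pd Ds g u v)).
      * exists (mkposreal 1 Rlt_0_1). intros. symmetry. apply is_derive_unique, Es.
      * apply IH; now apply smooth_ds.
    + apply (ex_diff_n_ext_loc (fun u v => a * pd Dt f u v + b * pd Dt g u v)).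
      * exists (mkposreal 1 Rlt_0_1). intros. symmetry. apply is_derive_unique, Et.
      * apply IH; now apply smooth_dt.
Qed.

(** * Homogeneous linear systems *)

Lemma sum_n_m_Sm (F : nat -> R) (m : nat) :
  sum_n_m F 1 (S m) = sum_n_m F 1 m + F (S m).
Proof. apply (sum_n_Sm F 1 m). lia. Qed.

Lemma sum_n_m_0 (F : nat -> R) : sum_n_m F 1 0 = 0.
Proof. apply (sum_n_m_zero F 1 0). lia. Qed.

Lemma sum_n_m_ext_R (F G : nat -> R) (m : nat) :
  (forall i, (1 <= i <= m)%nat -> F i = G i) -> sum_n_m F 1 m = sum_n_m G 1 m.
Proof. intros H. now apply sum_n_m_ext_loc. Qed.

Lemma sum_n_m_scal_plus (a b : R) (F G : nat -> R) (m : nat) :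
  sum_n_m (fun i => a * F i + b * G i) 1 m = a * sum_n_m F 1 m + b * sum_n_m G 1 m.
Proof.
  induction m as [|m IH]; [rewrite !sum_n_m_0; ring_R|].
  rewrite !sum_n_m_Sm, IH. ring_R.
Qed.

(** The increasing enumeration of the indices other than [i0]. *)
Definition skip (i0 i : nat) : nat := if Nat.ltb i i0 then i else S i.

Lemma sum_n_m_skip (F : nat -> R) (m i0 : nat) :
  (1 <= i0 <= S m)%nat ->
  sum_n_m F 1 (S m) = F i0 + sum_n_m (fun i => F (skip i0 i)) 1 m.
Proof.
  induction m as [|m IH]; intros Hi.
  - replace i0 with 1%nat by lia. rewrite sum_n_m_Sm, !sum_n_m_0. ring_R.
  - rewrite sum_n_m_Sm. destruct (Nat.eq_dec i0 (S (S m))) as [->|Hne].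
    + rewrite Rplus_comm. f_equal. apply sum_n_m_ext_R. intros i Hi'. unfold skip.
      destruct (Nat.ltb_spec i (S (S m))); [easy|lia].
    + rewrite IH by lia. rewrite sum_n_m_Sm. unfold skip at 3.
      destruct (Nat.ltb_spec (S m) i0); [lia|]. ring_R.
Qed.

(** Gaussian elimination: an unknown [i0] with nonzero coefficient in the last equation is
    eliminated from all the others. Indices start at 1 as in [dim_at_least]. *)
Lemma homogeneous_system_solution (n : nat) : forall l : nat -> nat -> R,
  exists c : nat -> R,
    (exists i, (1 <= i <= S n)%nat /\ c i <> 0) /\
    forall j, (1 <= j <= n)%nat -> sum_n_m (fun i => c i * l j i) 1 (S n) = 0.
Proof.
  induction n as [|n IH]; intros l.
  - exists (fun _ => 1). split; [exists 1%nat; split; [lia|lra]|lia].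
  - destruct (classic (exists i, (1 <= i <= S (S n))%nat /\ l (S n) i <> 0))
      as [[i0 [Hi0 Hp]]|Hz].
    + destruct (IH (fun j i => l j (skip i0 i) - l j i0 * l (S n) (skip i0 i) / l (S n) i0))
        as [c [[i1 [Hi1 Hc1]] Hc]].
      (* The value of the unknown [i0] that solves the last equation. *)
      set (v := - sum_n_m (fun i => c i * l (S n) (skip i0 i)) 1 (S n) / l (S n) i0).
      set (c' := fun i => if Nat.eqb i i0 then v
                          else if Nat.ltb i i0 then c i else c (pred i)).
      assert (Ec : forall i, c' (skip i0 i) = c i).
      { intros i. unfold c', skip. destruct (Nat.ltb_spec i i0).
        - destruct (Nat.eqb_spec i i0); [lia|]. destruct (Nat.ltb_spec i i0); [easy|lia].
        - destruct (Nat.eqb_spec (S i) i0); [lia|].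
          destruct (Nat.ltb_spec (S i) i0); [lia|easy]. }
      assert (Ev : c' i0 = v) by (unfold c'; now rewrite Nat.eqb_refl).
      exists c'. split.
      * exists (skip i0 i1). rewrite Ec. split; [|exact Hc1].
        unfold skip. destruct (Nat.ltb_spec i1 i0); lia.
      * assert (Hs : forall j, sum_n_m (fun i => c' i * l j i) 1 (S (S n))
           = v * l j i0 + sum_n_m (fun i => c i * l j (skip i0 i)) 1 (S n)).
        { intros j. rewrite (sum_n_m_skip _ _ i0) by lia. rewrite Ev. f_equal.
          apply sum_n_m_ext_R. intros i _. now rewrite Ec. }
        intros j Hj. rewrite Hs.
        destruct (Nat.eq_dec j (S n)) as [->|Hne]; [unfold v; field_R; exact Hp|].
        specialize (Hc j ltac:(lia)).
        rewrite (sum_n_m_ext_R _ (fun i => 1 * (c i * l j (skip i0 i))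
            + (- l j i0 / l (S n) i0) * (c i * l (S n) (skip i0 i)))) in Hc
          by (intros; field_R; exact Hp).
        rewrite sum_n_m_scal_plus in Hc. rewrite <- Hc. unfold v. field_R. exact Hp.
    (* The last equation is identically zero: the other equations are solved in the first [S n]
       unknowns and the last unknown is set to zero. *)
    + destruct (IH l) as [c [[i1 [Hi1 Hc1]] Hc]].
      exists (fun i => if Nat.leb i (S n) then c i else 0). split.
      * exists i1. split; [lia|]. destruct (Nat.leb_spec i1 (S n)); [exact Hc1|lia].
      * intros j Hj. rewrite sum_n_m_Sm. destruct (Nat.leb_spec (S (S n)) (S n)); [lia|].
        rewrite (sum_n_m_ext_R _ (fun i => c i * l j i)).
        2: { intros i Hi. destruct (Nat.leb_spec i (S n)); [easy|lia]. }
        destruct (Nat.eq_dec j (S n)) as [->|Hne].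
        { rewrite (sum_n_m_ext_R _ (fun i => 0 * 0 + 0 * 0)).
          - rewrite (sum_n_m_scal_plus 0 0 (fun _ => 0) (fun _ => 0)). ring_R.
          - intros i Hi. destruct (Req_dec (l (S n) i) 0) as [->|Hl]; [ring_R|].
            exfalso. apply Hz. exists i. split; [lia|exact Hl]. }
        rewrite Hc by lia. ring_R.
Qed.

(** * The profile curve and its frame *)

Lemma curv_sqr (M : space_form) : curv M * curv M = 1.
Proof. destruct M; simpl; ring. Qed.

Lemma gcos_gsin_sqr (M : space_form) (x : R) : gcos M x ^ 2 + curv M * gsin M x ^ 2 = 1.
Proof.
  destruct M; simpl.
  - pose proof (sin2_cos2 x) as H. unfold Rsqr in H. lra.
  - unfold cosh, sinh. pose proof (exp_plus x (- x)) as H.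
    rewrite Rplus_opp_r, exp_0 in H. nra.
Qed.

Lemma derive_gcos (M : space_form) (x : R) : is_derive (gcos M) x (- curv M * gsin M x).
Proof.
  destruct M; simpl.
  - eapply is_derive_eq; [apply is_derive_cos|ring].
  - eapply is_derive_eq; [apply is_derive_Reals, derivable_pt_lim_cosh|ring].
Qed.

Lemma derive_gsin (M : space_form) (x : R) : is_derive (gsin M) x (gcos M x).
Proof.
  destruct M; simpl.
  - apply is_derive_sin.
  - apply is_derive_Reals, derivable_pt_lim_sinh.
Qed.

Lemma gcos_opp (M : space_form) (x : R) : gcos M (- x) = gcos M x.
Proof. destruct M; simpl; [apply cos_neg|]. unfold cosh. rewrite Ropp_involutive. lra. Qed.

Lemma gsin_opp (M : space_form) (x : R) : gsin M (- x) = - gsin M x.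
Proof. destruct M; simpl; [apply sin_neg|]. unfold sinh. rewrite Ropp_involutive. lra. Qed.

Lemma gsin_0 (M : space_form) : gsin M 0 = 0.
Proof. destruct M; [apply sin_0|apply sinh_0]. Qed.

Lemma cosh_ge_1 (x : R) : 1 <= cosh x.
Proof.
  pose proof (gcos_gsin_sqr Hyperbolic x) as H. simpl in H.
  assert (0 < cosh x).
  { unfold cosh. pose proof (exp_pos x). pose proof (exp_pos (- x)). lra. }
  nra.
Qed.

(** [rad^2 = x2^2 + x3^2], and [axr^2] is [x0^2 + x1^2] or [x0^2 - x1^2]; the principal
    curvatures are [flux / rad^2] and its opposite. *)
Definition rad (M : space_form) (a s : R) : R := sqrt (curv M / 2 + a * gcos M (2 * s)).
Definition axr (M : space_form) (a s : R) : R := sqrt (1 / 2 - curv M * a * gcos M (2 * s)).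
Definition drad (M : space_form) (a s : R) : R := - curv M * a * gsin M (2 * s) / rad M a s.
Definition flux (M : space_form) (a : R) : R := sqrt (curv M * (1 / 4 - a ^ 2)).

Lemma catenoid_coordinates (M : space_form) (a s t : R) :
  catenoid M a s t =
  mkvec4 (axr M a s * gcos M (phi M a s)) (axr M a s * gsin M (phi M a s))
         (rad M a s * cos t) (rad M a s * sin t).
Proof.
  unfold axr, rad. destruct M; simpl curv; unfold catenoid.
  - replace (1 / 2 - 1 * a * gcos Spherical (2 * s)) with (1 / 2 - a * cos (2 * s)) by (simpl; ring).
    reflexivity.
  - replace (1 / 2 - -1 * a * gcos Hyperbolic (2 * s)) with (a * cosh (2 * s) + 1 / 2)
      by (simpl; ring).
    replace (-1 / 2 + a * gcos Hyperbolic (2 * s)) with (a * cosh (2 * s) - 1 / 2)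
      by (simpl; field).
    reflexivity.
Qed.

Section Profile.

Context (M : space_form) (a : R) (Ha : catenoid_parameter M a).

Lemma rad_arg_pos (s : R) : 0 < curv M / 2 + a * gcos M (2 * s).
Proof.
  destruct M; simpl in *.
  - pose proof (COS_bound (2 * s)). nra.
  - pose proof (cosh_ge_1 (2 * s)). nra.
Qed.

Lemma axr_arg_pos (s : R) : 0 < 1 / 2 - curv M * a * gcos M (2 * s).
Proof.
  destruct M; simpl in *.
  - pose proof (COS_bound (2 * s)). nra.
  - pose proof (cosh_ge_1 (2 * s)). nra.
Qed.

Lemma flux_arg_pos : 0 < curv M * (1 / 4 - a ^ 2).
Proof. destruct M; simpl in *; nra. Qed.

Lemma rad_pos (s : R) : 0 < rad M a s.
Proof. apply sqrt_lt_R0, rad_arg_pos. Qed.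

Lemma axr_pos (s : R) : 0 < axr M a s.
Proof. apply sqrt_lt_R0, axr_arg_pos. Qed.

Lemma flux_pos : 0 < flux M a.
Proof. apply sqrt_lt_R0, flux_arg_pos. Qed.

Lemma rad_sqr (s : R) : rad M a s ^ 2 = curv M / 2 + a * gcos M (2 * s).
Proof. apply pow2_sqrt, Rlt_le, rad_arg_pos. Qed.

Lemma axr_sqr (s : R) : axr M a s ^ 2 = 1 - curv M * rad M a s ^ 2.
Proof.
  rewrite rad_sqr. unfold axr. rewrite pow2_sqrt by apply Rlt_le, axr_arg_pos.
  pose proof (curv_sqr M). nra.
Qed.

Lemma flux_sqr : flux M a ^ 2 = curv M * (1 / 4 - a ^ 2).
Proof. apply pow2_sqrt, Rlt_le, flux_arg_pos. Qed.

(** The conservation law of the minimal surface equation for rotation surfaces,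
    [rad^2 (1 - curv rad^2 - rad'^2) = flux^2]. It is the only relation between [rad] and [drad]
    that the frame identities use. *)
Lemma profile_first_integral (s : R) :
  rad M a s ^ 2 * drad M a s ^ 2 + flux M a ^ 2 = axr M a s ^ 2 * rad M a s ^ 2.
Proof.
  pose proof (rad_pos s). rewrite axr_sqr, flux_sqr.
  replace (rad M a s ^ 2 * drad M a s ^ 2) with (curv M * curv M * a ^ 2 * gsin M (2 * s) ^ 2)
    by (unfold drad; field; lra).
  rewrite !rad_sqr. pose proof (gcos_gsin_sqr M (2 * s)) as CS.
  destruct M; simpl curv in *; nra.
Qed.

Lemma derive_gcos_double (s : R) :
  is_derive (fun x => gcos M (2 * x)) s (- 2 * curv M * gsin M (2 * s)).
Proof.
  eapply is_derive_eq; [apply (derive_comp (gcos M) (fun x => 2 * x));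
    [apply derive_gcos|derive_R]|cbv beta; ring].
Qed.

Lemma derive_gsin_double (s : R) :
  is_derive (fun x => gsin M (2 * x)) s (2 * gcos M (2 * s)).
Proof.
  eapply is_derive_eq; [apply (derive_comp (gsin M) (fun x => 2 * x));
    [apply derive_gsin|derive_R]|cbv beta; ring].
Qed.

Lemma derive_sqrt (f : R -> R) (x l : R) :
  is_derive f x l -> 0 < f x -> is_derive (fun y => sqrt (f y)) x (l / (2 * sqrt (f x))).
Proof. apply (is_derive_sqrt f). Qed.

Lemma derive_rad (s : R) : is_derive (rad M a) s (drad M a s).
Proof.
  pose proof (derive_gcos_double s). pose proof (rad_pos s) as Hr.
  eapply is_derive_eq; [apply derive_sqrt; [derive_R|apply rad_arg_pos]|].
  cbv beta. fold (rad M a s). unfold drad. field. lra.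
Qed.

Lemma derive_axr (s : R) :
  is_derive (axr M a) s (- curv M * rad M a s * drad M a s / axr M a s).
Proof.
  pose proof (derive_gcos_double s). pose proof (rad_pos s). pose proof (axr_pos s).
  eapply is_derive_eq; [apply derive_sqrt; [derive_R|apply axr_arg_pos]|].
  cbv beta. fold (axr M a s). unfold drad. field. lra.
Qed.

Lemma derive_drad (s : R) :
  is_derive (drad M a) s (flux M a ^ 2 / rad M a s ^ 3 - curv M * rad M a s).
Proof.
  pose proof (derive_gsin_double s). pose proof (derive_rad s). pose proof (rad_pos s) as Hr.
  eapply is_derive_eq; [unfold drad; derive_R; lra|].
  pose proof (profile_first_integral s) as E. pose proof (rad_sqr s) as Er.
  rewrite axr_sqr in E.
  cbv beta.
  (* Eliminating [flux^2] by the first integral and the trigonometric terms by [rad^2] and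
     [rad * drad] leaves an identity in [rad], [drad] and [curv] alone. *)
  assert (Ef : flux M a ^ 2 = (1 - curv M * rad M a s ^ 2) * rad M a s ^ 2
    - rad M a s ^ 2 * drad M a s ^ 2) by lra.
  rewrite Ef.
  assert (Eg : a * gcos M (2 * s) = rad M a s ^ 2 - curv M / 2) by lra.
  assert (Es : - curv M * a * gsin M (2 * s) = rad M a s * drad M a s)
    by (unfold drad; field; lra).
  rewrite Es.
  transitivity ((- 2 * curv M * (a * gcos M (2 * s)) - drad M a s ^ 2) / rad M a s).
  - field. lra.
  - rewrite Eg. pose proof (curv_sqr M) as K.
    transitivity ((- 2 * curv M * rad M a s ^ 2 + curv M * curv M - drad M a s ^ 2) / rad M a s).
    + field. lra.
    + rewrite K. field. lra.
Qed.

Lemma continuous_rad (s : R) : continuous (rad M a) s.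
Proof. apply (is_derive_continuous _ _ _ (derive_rad s)). Qed.

Lemma continuous_axr (s : R) : continuous (axr M a) s.
Proof. apply (is_derive_continuous _ _ _ (derive_axr s)). Qed.

Lemma continuous_drad (s : R) : continuous (drad M a) s.
Proof. apply (is_derive_continuous _ _ _ (derive_drad s)). Qed.

Lemma phi_integral (s : R) :
  phi M a s = flux M a * RInt (fun t => 1 / (axr M a t ^ 2 * rad M a t)) 0 s.
Proof.
  assert (E : forall t, axr M a t ^ 2 = 1 / 2 - curv M * a * gcos M (2 * t)).
  { intros t. unfold axr. rewrite pow2_sqrt; [ring|]. apply Rlt_le, axr_arg_pos. }
  unfold phi, flux. destruct M; simpl curv in *.
  - f_equal; [f_equal; ring|]. apply RInt_ext_R. intros t. rewrite E. unfold rad. simpl.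
    f_equal. f_equal; f_equal; lra.
  - f_equal; [f_equal; ring|]. apply RInt_ext_R. intros t. rewrite E. unfold rad. simpl.
    f_equal. f_equal; [|f_equal]; lra.
Qed.

Lemma derive_phi (s : R) :
  is_derive (phi M a) s (flux M a / (axr M a s ^ 2 * rad M a s)).
Proof.
  apply is_derive_ext with
    (fun s => flux M a * RInt (fun t => 1 / (axr M a t ^ 2 * rad M a t)) 0 s).
  { intros t. symmetry. apply phi_integral. }
  assert (C : forall x, continuous (fun t => 1 / (axr M a t ^ 2 * rad M a t)) x).
  { intros x. pose proof (continuous_rad x). pose proof (continuous_axr x).
    pose proof (rad_pos x). pose proof (axr_pos x).
    continuity_R. apply Rgt_not_eq. apply Rmult_lt_0_compat; [apply pow_lt|]; lra. }
  pose proof (is_derive_primitive _ 0 s C) as D.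
  pose proof (rad_pos s). pose proof (axr_pos s).
  eapply is_derive_eq; [derive_R|]. cbv beta. field. lra.
Qed.

Lemma phi_0 : phi M a 0 = 0.
Proof.
  rewrite phi_integral.
  pose proof (RInt_point (V := R_CompleteNormedModule) 0 (fun t => 1 / (axr M a t ^ 2 * rad M a t))) as E.
  change (RInt (fun t => 1 / (axr M a t ^ 2 * rad M a t)) 0 0 = 0) in E.
  rewrite E. ring.
Qed.

Lemma rad_opp (s : R) : rad M a (- s) = rad M a s.
Proof. unfold rad. replace (2 * - s) with (- (2 * s)) by ring. now rewrite gcos_opp. Qed.

Lemma axr_opp (s : R) : axr M a (- s) = axr M a s.
Proof. unfold axr. replace (2 * - s) with (- (2 * s)) by ring. now rewrite gcos_opp. Qed.

Lemma drad_opp (s : R) : drad M a (- s) = - drad M a s.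
Proof.
  unfold drad. rewrite rad_opp. replace (2 * - s) with (- (2 * s)) by ring. rewrite gsin_opp.
  unfold Rdiv. ring.
Qed.

Lemma phi_opp (s : R) : phi M a (- s) = - phi M a s.
Proof.
  rewrite !phi_integral.
  set (f := fun t => 1 / (axr M a t ^ 2 * rad M a t)).
  assert (C : forall x, continuous f x).
  { intros x. unfold f. pose proof (continuous_rad x). pose proof (continuous_axr x).
    pose proof (rad_pos x). pose proof (axr_pos x).
    continuity_R. apply Rgt_not_eq. apply Rmult_lt_0_compat; [apply pow_lt|]; lra. }
  assert (E : RInt f 0 (- s) = - RInt f 0 s).
  { rewrite <- (RInt_reflect f 0 s C), Ropp_0.
    assert (Ce : forall x, continuous (fun x => f (- x)) x).
    { intros x. apply (continuous_comp (fun t => - t) f); [continuity_R|apply C]. }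
    pose proof (opp_RInt_swap (fun x => f (- x)) (- s) 0) as S.
    specialize (S (continuous_ex_RInt _ _ _ Ce)).
    change (- RInt (fun x => f (- x)) (- s) 0 = RInt (fun x => f (- x)) 0 (- s)) in S.
    rewrite S. apply RInt_ext_R. intros x. unfold f. now rewrite axr_opp, rad_opp. }
  rewrite E. ring.
Qed.

End Profile.

(** The components along [x0] and [x1] of the position, the unit tangent of the profile and the unit
    normal of the surface. Their remaining components are [rad], [drad] and [flux / rad] times
    [(cos t, sin t)], and [pcurv] is the curvature in the Frenet equations proved below. *)
Definition prof0 (M : space_form) (a s : R) : R := axr M a s * gcos M (phi M a s).
Definition prof1 (M : space_form) (a s : R) : R := axr M a s * gsin M (phi M a s).
Definition tan0 (M : space_form) (a s : R) : R :=
  - curv M * (rad M a s * drad M a s * gcos M (phi M a s) + flux M a * gsin M (phi M a s) / rad M a s)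
  / axr M a s.
Definition tan1 (M : space_form) (a s : R) : R :=
  (- curv M * rad M a s * drad M a s * gsin M (phi M a s) + flux M a * gcos M (phi M a s) / rad M a s)
  / axr M a s.
Definition nor0 (M : space_form) (a s : R) : R :=
  curv M * (drad M a s * gsin M (phi M a s) - flux M a * gcos M (phi M a s)) / axr M a s.
Definition nor1 (M : space_form) (a s : R) : R :=
  - (curv M * flux M a * gsin M (phi M a s) + drad M a s * gcos M (phi M a s)) / axr M a s.
Definition pcurv (M : space_form) (a s : R) : R := flux M a / rad M a s ^ 2.

Section Frame.

Context (M : space_form) (a : R) (Ha : catenoid_parameter M a).

Lemma derive_gcos_phi (s : R) :
  is_derive (fun x => gcos M (phi M a x)) s
    (- curv M * gsin M (phi M a s) * (flux M a / (axr M a s ^ 2 * rad M a s))).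
Proof.
  eapply is_derive_eq; [apply (derive_comp (gcos M) (phi M a));
    [apply derive_gcos|now apply derive_phi]|cbv beta; ring].
Qed.

Lemma derive_gsin_phi (s : R) :
  is_derive (fun x => gsin M (phi M a x)) s
    (gcos M (phi M a s) * (flux M a / (axr M a s ^ 2 * rad M a s))).
Proof.
  eapply is_derive_eq; [apply (derive_comp (gsin M) (phi M a));
    [apply derive_gsin|now apply derive_phi]|cbv beta; ring].
Qed.

Ltac profile_facts s :=
  pose proof (derive_rad M a Ha s); pose proof (derive_axr M a Ha s);
  pose proof (derive_drad M a Ha s);
  pose proof (derive_gcos_phi s); pose proof (derive_gsin_phi s);
  pose proof (rad_pos M a Ha s); pose proof (axr_pos M a Ha s).

Lemma derive_prof0 (s : R) : is_derive (prof0 M a) s (tan0 M a s).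
Proof.
  profile_facts s. eapply is_derive_eq; [unfold prof0; derive_R|].
  unfold tan0. cbv beta. field. lra.
Qed.

Lemma derive_prof1 (s : R) : is_derive (prof1 M a) s (tan1 M a s).
Proof.
  profile_facts s. eapply is_derive_eq; [unfold prof1; derive_R|].
  unfold tan1. cbv beta. field. lra.
Qed.

(** Every frame identity holds modulo four relations: the first integral, [curv^2 = 1], the
    Pythagorean relation for [phi], and [axr^2 = 1 - curv rad^2]. Each is solved for a square so
    that [ring] can use it as a rewriting rule. *)
Ltac profile_algebra s :=
  pose proof (profile_first_integral M a Ha s) as Ec; pose proof (axr_sqr M a Ha s) as ER;
  pose proof (curv_sqr M) as Ek; pose proof (gcos_gsin_sqr M (phi M a s)) as EC;
  set (r := rad M a s) in *; set (R := axr M a s) in *; set (r1 := drad M a s) in *;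
  set (c := flux M a) in *; set (C := gcos M (phi M a s)) in *;
  set (S := gsin M (phi M a s)) in *; set (k := curv M) in *;
  assert (Ec' : c ^ 2 = R ^ 2 * r ^ 2 - r ^ 2 * r1 ^ 2) by lra;
  assert (Ek' : k ^ 2 = 1) by (simpl; lra);
  assert (EC' : C ^ 2 = 1 - k * S ^ 2) by lra;
  field_simplify_eq; [ring [Ec' Ek' EC' ER]|lra..].

Lemma derive_tan0 (s : R) :
  is_derive (tan0 M a) s (pcurv M a s * nor0 M a s - curv M * prof0 M a s).
Proof.
  profile_facts s. eapply is_derive_eq; [unfold tan0; derive_R; lra|].
  unfold nor0, prof0, pcurv. cbv beta. profile_algebra s.
Qed.

Lemma derive_tan1 (s : R) :
  is_derive (tan1 M a) s (pcurv M a s * nor1 M a s - curv M * prof1 M a s).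
Proof.
  profile_facts s. eapply is_derive_eq; [unfold tan1; derive_R; lra|].
  unfold nor1, prof1, pcurv. cbv beta. profile_algebra s.
Qed.

Lemma derive_nor0 (s : R) : is_derive (nor0 M a) s (- pcurv M a s * tan0 M a s).
Proof.
  profile_facts s. eapply is_derive_eq; [unfold nor0; derive_R; lra|].
  unfold tan0, pcurv. cbv beta. profile_algebra s.
Qed.

Lemma derive_nor1 (s : R) : is_derive (nor1 M a) s (- pcurv M a s * tan1 M a s).
Proof.
  profile_facts s. eapply is_derive_eq; [unfold nor1; derive_R; lra|].
  unfold tan1, pcurv. cbv beta. profile_algebra s.
Qed.

Lemma derive_pcurv (s : R) :
  is_derive (pcurv M a) s (- 2 * pcurv M a s * drad M a s / rad M a s).
Proof.
  profile_facts s. eapply is_derive_eq; [unfold pcurv; derive_R|].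
  - apply pow_nonzero. lra.
  - unfold pcurv. cbv beta. field. lra.
Qed.

Lemma frame_prof_prof (s : R) :
  curv M * prof0 M a s ^ 2 + prof1 M a s ^ 2 + rad M a s ^ 2 = curv M.
Proof. profile_facts s. unfold prof0, prof1. profile_algebra s. Qed.

Lemma frame_tan_tan (s : R) :
  curv M * tan0 M a s ^ 2 + tan1 M a s ^ 2 + drad M a s ^ 2 = 1.
Proof. profile_facts s. unfold tan0, tan1. profile_algebra s. Qed.

Lemma frame_nor_nor (s : R) :
  curv M * nor0 M a s ^ 2 + nor1 M a s ^ 2 + (flux M a / rad M a s) ^ 2 = 1.
Proof. profile_facts s. unfold nor0, nor1. profile_algebra s. Qed.

Lemma frame_prof_tan (s : R) :
  curv M * prof0 M a s * tan0 M a s + prof1 M a s * tan1 M a s + rad M a s * drad M a s = 0.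
Proof. profile_facts s. unfold prof0, prof1, tan0, tan1. profile_algebra s. Qed.

Lemma frame_prof_nor (s : R) :
  curv M * prof0 M a s * nor0 M a s + prof1 M a s * nor1 M a s
  + rad M a s * (flux M a / rad M a s) = 0.
Proof. profile_facts s. unfold prof0, prof1, nor0, nor1. profile_algebra s. Qed.

Lemma frame_tan_nor (s : R) :
  curv M * tan0 M a s * nor0 M a s + tan1 M a s * nor1 M a s
  + drad M a s * (flux M a / rad M a s) = 0.
Proof. profile_facts s. unfold tan0, tan1, nor0, nor1. profile_algebra s. Qed.

(* The components along [x0] and [x1] of the vector [(0, 0, cos t, sin t)], expanded in the
   orthogonal frame formed by the position, the unit tangent and the unit normal. *)
Lemma frame_expansion0 (s : R) :
  curv M * rad M a s * prof0 M a s + drad M a s * tan0 M a s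
  + flux M a / rad M a s * nor0 M a s = 0.
Proof. profile_facts s. unfold prof0, tan0, nor0. profile_algebra s. Qed.

Lemma frame_expansion1 (s : R) :
  curv M * rad M a s * prof1 M a s + drad M a s * tan1 M a s
  + flux M a / rad M a s * nor1 M a s = 0.
Proof. profile_facts s. unfold prof1, tan1, nor1. profile_algebra s. Qed.

(** The component of the same expansion along the vector [(0, 0, cos t, sin t)] itself; it is the
    first integral divided by [rad^2]. *)
Lemma frame_expansion2 (s : R) :
  curv M * rad M a s ^ 2 + drad M a s ^ 2 + (flux M a / rad M a s) ^ 2 = 1.
Proof. profile_facts s. profile_algebra s. Qed.

(** The angular momentum [axr^2 * phi'] in the plane of [x0] and [x1]; its sign makes
    [prof1 / prof0] increase. *)
Lemma profile_wronskian (s : R) :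
  prof0 M a s * tan1 M a s - prof1 M a s * tan0 M a s = flux M a / rad M a s.
Proof. profile_facts s. unfold prof0, prof1, tan0, tan1. profile_algebra s. Qed.

End Frame.

(** * Geometry of the catenoids *)

Lemma vec4_ext (x y : vec4) :
  x0 x = x0 y -> x1 x = x1 y -> x2 x = x2 y -> x3 x = x3 y -> x = y.
Proof. destruct x, y; simpl; now intros -> -> -> ->. Qed.

Definition normal_field (M : space_form) (a s t : R) : vec4 :=
  mkvec4 (nor0 M a s) (nor1 M a s) (flux M a / rad M a s * cos t) (flux M a / rad M a s * sin t).

Section Geometry.

Context (M : space_form) (a : R) (Ha : catenoid_parameter M a).

(** An equality of functions and not of values, so that it can be rewritten under the derivatives
    [vpd]. *)
Lemma catenoid_profile :
  catenoid M a = fun s t =>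
    mkvec4 (prof0 M a s) (prof1 M a s) (rad M a s * cos t) (rad M a s * sin t).
Proof.
  apply functional_extensionality; intros s. apply functional_extensionality; intros t.
  apply catenoid_coordinates.
Qed.

Ltac derive_facts s :=
  pose proof (derive_rad M a Ha s); pose proof (derive_drad M a Ha s);
  pose proof (derive_prof0 M a Ha s); pose proof (derive_prof1 M a Ha s);
  pose proof (derive_tan0 M a Ha s); pose proof (derive_tan1 M a Ha s).

Ltac vpd_tac :=
  apply functional_extensionality; intros s; apply functional_extensionality; intros t;
  derive_facts s; apply vec4_ext; cbn;
  apply is_derive_unique; (eapply is_derive_eq; [derive_R|cbv beta; ring]).

Lemma vpd_s_catenoid :
  vpd Ds (catenoid M a) = fun s t =>
    mkvec4 (tan0 M a s) (tan1 M a s) (drad M a s * cos t) (drad M a s * sin t).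
Proof. rewrite catenoid_profile. vpd_tac. Qed.

Lemma vpd_t_catenoid :
  vpd Dt (catenoid M a) = fun s t =>
    mkvec4 0 0 (- rad M a s * sin t) (rad M a s * cos t).
Proof. rewrite catenoid_profile. vpd_tac. Qed.

Lemma vpd_ss_catenoid (s t : R) :
  vpd Ds (vpd Ds (catenoid M a)) s t =
  vsub (vscal (pcurv M a s) (normal_field M a s t)) (vscal (curv M) (catenoid M a s t)).
Proof.
  rewrite vpd_s_catenoid, catenoid_profile. derive_facts s. pose proof (rad_pos M a Ha s).
  apply vec4_ext; cbn; apply is_derive_unique;
    (eapply is_derive_eq; [derive_R|cbv beta; unfold pcurv; field; lra]).
Qed.

Lemma vpd_st_catenoid (s t : R) :
  vpd Ds (vpd Dt (catenoid M a)) s t = vscal (drad M a s / rad M a s) (vpd Dt (catenoid M a) s t).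
Proof.
  rewrite vpd_t_catenoid. derive_facts s. pose proof (rad_pos M a Ha s).
  apply vec4_ext; cbn; apply is_derive_unique;
    (eapply is_derive_eq; [derive_R|cbv beta; field; lra]).
Qed.

Lemma vpd_ts_catenoid (s t : R) :
  vpd Dt (vpd Ds (catenoid M a)) s t = vscal (drad M a s / rad M a s) (vpd Dt (catenoid M a) s t).
Proof.
  rewrite vpd_s_catenoid, vpd_t_catenoid. pose proof (rad_pos M a Ha s).
  apply vec4_ext; cbn; apply is_derive_unique;
    (eapply is_derive_eq; [derive_R|cbv beta; field; lra]).
Qed.

(** The second derivative is [- rad * (0, 0, cos t, sin t)]; the frame expansion separates its parts
    along position, tangent and normal. *)
Lemma vpd_tt_catenoid (s t : R) :
  vpd Dt (vpd Dt (catenoid M a)) s t =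
  vscal (- rad M a s)
    (vadd (vadd (vscal (curv M * rad M a s) (catenoid M a s t))
                (vscal (drad M a s) (vpd Ds (catenoid M a) s t)))
          (vscal (flux M a / rad M a s) (normal_field M a s t))).
Proof.
  rewrite vpd_s_catenoid, vpd_t_catenoid, catenoid_profile. pose proof (rad_pos M a Ha s).
  pose proof (frame_expansion0 M a Ha s) as E0. pose proof (frame_expansion1 M a Ha s) as E1.
  pose proof (frame_expansion2 M a Ha s) as E2.
  apply vec4_ext; cbn; apply is_derive_unique;
    (eapply is_derive_eq; [derive_R|cbv beta]).
  - rewrite E0. ring.
  - rewrite E1. ring.
  - transitivity (- rad M a s * cos t
      * (curv M * rad M a s ^ 2 + drad M a s ^ 2 + (flux M a / rad M a s) ^ 2)); [rewrite E2|]; ring.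
  - transitivity (- rad M a s * sin t
      * (curv M * rad M a s ^ 2 + drad M a s ^ 2 + (flux M a / rad M a s) ^ 2)); [rewrite E2|]; ring.
Qed.

Lemma ip_add_l (x y z : vec4) : ip M (vadd x y) z = ip M x z + ip M y z.
Proof. unfold ip, vadd; simpl. ring. Qed.

Lemma ip_scal_l (c : R) (x z : vec4) : ip M (vscal c x) z = c * ip M x z.
Proof. unfold ip, vscal; simpl. ring. Qed.

Lemma ip_sub_l (x y z : vec4) : ip M (vsub x y) z = ip M x z - ip M y z.
Proof. unfold vsub. rewrite ip_add_l, ip_scal_l. ring. Qed.

Lemma ip_comm (x y : vec4) : ip M x y = ip M y x.
Proof. unfold ip. ring. Qed.

Ltac ip_by H :=
  rewrite ?vpd_s_catenoid, ?vpd_t_catenoid, ?catenoid_profile; unfold ip, normal_field; cbn;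
  etransitivity; [|exact H];
  let K := fresh in
  match goal with |- context [cos ?t] =>
    pose proof (sin2_cos2 t) as K; unfold Rsqr in K;
    assert (cos t ^ 2 = 1 - sin t ^ 2) by (cbn; lra) end;
  match goal with K' : cos _ ^ 2 = _ |- _ => ring [K'] end.

Lemma ip_X_X (s t : R) : ip M (catenoid M a s t) (catenoid M a s t) = curv M.
Proof. ip_by (frame_prof_prof M a Ha s). Qed.

Lemma ip_S_S (s t : R) : ip M (vpd Ds (catenoid M a) s t) (vpd Ds (catenoid M a) s t) = 1.
Proof. ip_by (frame_tan_tan M a Ha s). Qed.

Lemma ip_T_T (s t : R) :
  ip M (vpd Dt (catenoid M a) s t) (vpd Dt (catenoid M a) s t) = rad M a s ^ 2.
Proof.
  rewrite vpd_t_catenoid. unfold ip; cbn. pose proof (sin2_cos2 t) as K. unfold Rsqr in K.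
  transitivity (rad M a s ^ 2 * (sin t * sin t + cos t * cos t)); [|rewrite K]; ring.
Qed.

Lemma ip_S_T (s t : R) : ip M (vpd Ds (catenoid M a) s t) (vpd Dt (catenoid M a) s t) = 0.
Proof. rewrite vpd_s_catenoid, vpd_t_catenoid. unfold ip; cbn. ring. Qed.

Lemma ip_X_S (s t : R) : ip M (catenoid M a s t) (vpd Ds (catenoid M a) s t) = 0.
Proof. ip_by (frame_prof_tan M a Ha s). Qed.

Lemma ip_X_T (s t : R) : ip M (catenoid M a s t) (vpd Dt (catenoid M a) s t) = 0.
Proof. rewrite vpd_t_catenoid, catenoid_profile. unfold ip; cbn. ring. Qed.

Lemma ip_N_N (s t : R) : ip M (normal_field M a s t) (normal_field M a s t) = 1.
Proof. ip_by (frame_nor_nor M a Ha s). Qed.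

Lemma ip_N_X (s t : R) : ip M (normal_field M a s t) (catenoid M a s t) = 0.
Proof. ip_by (frame_prof_nor M a Ha s). Qed.

Lemma ip_N_S (s t : R) : ip M (normal_field M a s t) (vpd Ds (catenoid M a) s t) = 0.
Proof. ip_by (frame_tan_nor M a Ha s). Qed.

Lemma ip_N_T (s t : R) : ip M (normal_field M a s t) (vpd Dt (catenoid M a) s t) = 0.
Proof. rewrite vpd_t_catenoid. unfold ip; cbn. ring. Qed.

Lemma metric_ss (s t : R) : metric M (catenoid M a) Ds Ds s t = 1.
Proof. apply ip_S_S. Qed.
Lemma metric_st (s t : R) : metric M (catenoid M a) Ds Dt s t = 0.
Proof. apply ip_S_T. Qed.
Lemma metric_tt (s t : R) : metric M (catenoid M a) Dt Dt s t = rad M a s ^ 2.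
Proof. apply ip_T_T. Qed.

Lemma metric_det_catenoid (s t : R) : metric_det M (catenoid M a) s t = rad M a s ^ 2.
Proof. unfold metric_det. rewrite metric_ss, metric_st, metric_tt. ring. Qed.

Lemma metric_inv_catenoid (i j : dir) (s t : R) :
  metric_inv M (catenoid M a) i j s t =
  match i, j with Ds, Ds => 1 | Dt, Dt => / rad M a s ^ 2 | _, _ => 0 end.
Proof.
  pose proof (rad_pos M a Ha s).
  destruct i, j; unfold metric_inv; rewrite metric_det_catenoid, ?metric_ss, ?metric_st, ?metric_tt;
    field; lra.
Qed.

Lemma area_density_catenoid (s t : R) : area_density M (catenoid M a) s t = rad M a s.
Proof.
  unfold area_density. rewrite metric_det_catenoid. apply sqrt_pow2, Rlt_le, rad_pos, Ha.
Qed.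

Lemma length_density_catenoid (s t : R) : length_density M (catenoid M a) s t = rad M a s.
Proof.
  unfold length_density. rewrite metric_tt. apply sqrt_pow2, Rlt_le, rad_pos, Ha.
Qed.

Lemma sff_catenoid (i j : dir) (s t : R) :
  sff M (catenoid M a) i j s t =
  vscal (match i, j with
         | Ds, Ds => pcurv M a s
         | Dt, Dt => - flux M a
         | _, _ => 0 end) (normal_field M a s t).
Proof.
  pose proof (rad_pos M a Ha s) as Hr. pose proof (curv_sqr M) as K.
  destruct i, j; unfold sff, vsum_dir; rewrite !metric_inv_catenoid;
    rewrite ?vpd_ss_catenoid, ?vpd_st_catenoid, ?vpd_ts_catenoid, ?vpd_tt_catenoid;
    rewrite ?ip_sub_l, ?ip_scal_l, ?ip_add_l, ?ip_scal_l;
    rewrite ?(ip_comm (vpd _ (catenoid M a) s t) (catenoid M a s t)),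
      ?(ip_comm (vpd Dt (catenoid M a) s t) (vpd Ds (catenoid M a) s t)),
      ?ip_X_X, ?ip_X_S, ?ip_X_T, ?ip_S_S, ?ip_S_T, ?ip_T_T, ?ip_N_X, ?ip_N_S, ?ip_N_T;
    set (X := catenoid M a s t); set (U := vpd Ds (catenoid M a) s t);
    set (V := vpd Dt (catenoid M a) s t); set (N := normal_field M a s t);
    clearbody X U V N;
    assert (K' : curv M ^ 2 = 1) by (cbn; lra);
    apply vec4_ext; cbn; field_simplify_eq; try lra; ring [K'].
Qed.

Lemma sff_normsq_catenoid (s t : R) :
  sff_normsq M (catenoid M a) s t = 2 * pcurv M a s ^ 2.
Proof.
  pose proof (rad_pos M a Ha s) as Hr.
  unfold sff_normsq, sum_dir. rewrite !metric_inv_catenoid, !sff_catenoid, !ip_scal_l.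
  rewrite !(ip_comm (normal_field M a s t)), !ip_scal_l, ip_N_N. unfold pcurv. field. lra.
Qed.

Lemma grad_normsq_catenoid (u : R -> R -> R) (s t : R) :
  grad_normsq M (catenoid M a) u s t = pd Ds u s t ^ 2 + pd Dt u s t ^ 2 / rad M a s ^ 2.
Proof.
  pose proof (rad_pos M a Ha s) as Hr.
  unfold grad_normsq, sum_dir. rewrite !metric_inv_catenoid. field. lra.
Qed.

Lemma index_form_catenoid (r s0 : R) (u : R -> R -> R) :
  smooth u ->
  index_form M r s0 (catenoid M a) u =
  RInt (fun s =>
      rad M a s * RInt (fun t => pd Ds u s t ^ 2) 0 (2 * PI)
      + RInt (fun t => pd Dt u s t ^ 2) 0 (2 * PI) / rad M a s
      - (2 * curv M + 2 * pcurv M a s ^ 2) * rad M a s * RInt (fun t => u s t ^ 2) 0 (2 * PI))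
    (- s0) s0
  - gcot M r * rad M a s0 *
    (RInt (fun t => u (- s0) t ^ 2) 0 (2 * PI) + RInt (fun t => u s0 t ^ 2) 0 (2 * PI)).
Proof.
  intros Hu.
  assert (Cu : forall s t, continuous (u s) t).
  { intros s t. now apply (continuity_2d_slice u), smooth_continuity. }
  assert (Cs : forall s t, continuous (pd Ds u s) t).
  { intros s t. now apply (continuity_2d_slice (pd Ds u)), smooth_continuity, smooth_ds. }
  assert (Ct : forall s t, continuous (pd Dt u s) t).
  { intros s t. now apply (continuity_2d_slice (pd Dt u)), smooth_continuity, smooth_dt. }
  assert (Cu2 : forall s t, continuous (fun t => u s t ^ 2) t).
  { intros s t. apply continuous_Rsqr, Cu. }
  assert (Cs2 : forall s t, continuous (fun t => pd Ds u s t ^ 2) t).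
  { intros s t. apply continuous_Rsqr, Cs. }
  assert (Ct2 : forall s t, continuous (fun t => pd Dt u s t ^ 2) t).
  { intros s t. apply continuous_Rsqr, Ct. }
  unfold index_form. f_equal.
  - apply RInt_ext_R. intros s. pose proof (rad_pos M a Ha s) as Hr.
    rewrite (RInt_ext_R _ (fun t => rad M a s * pd Ds u s t ^ 2 + / rad M a s * pd Dt u s t ^ 2
      - (2 * curv M + 2 * pcurv M a s ^ 2) * rad M a s * u s t ^ 2)).
    2: { intros t. rewrite grad_normsq_catenoid, sff_normsq_catenoid, area_density_catenoid.
         field. lra. }
    rewrite RInt_minus_R, RInt_plus_R, !RInt_scal_R by (intros t; continuity_R).
    unfold Rdiv. ring.
  - rewrite Rmult_assoc. f_equal. rewrite Rmult_plus_distr_l. rewrite <- !RInt_scal_R by apply Cu2.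
    f_equal; apply RInt_ext_R; intros t; rewrite length_density_catenoid, ?rad_opp; ring.
Qed.

End Geometry.

(** * The free boundary condition *)

Lemma gcos_gdist (M : space_form) (x : vec4) (r : R) :
  in_model M x -> gdist M pole x = r -> x0 x = gcos M r.
Proof.
  unfold in_model, gdist, ip. destruct x as [y0 y1 y2 y3]; simpl.
  destruct M; simpl; intros [H1 H2] H3.
  - replace (1 * 1 * y0 + 0 * y1 + 0 * y2 + 0 * y3) with y0 in H3 by ring.
    rewrite <- H3, cos_acos; [easy|]. nra.
  - replace (- (-1 * 1 * y0 + 0 * y1 + 0 * y2 + 0 * y3)) with y0 in H3 by ring.
    unfold arcosh in H3.
    assert (Hs : 0 <= y0 ^ 2 - 1) by nra.
    pose proof (sqrt_pos (y0 ^ 2 - 1)) as Hp. pose proof (pow2_sqrt _ Hs) as Hq.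
    set (w := sqrt (y0 ^ 2 - 1)) in *.
    unfold cosh. rewrite exp_Ropp, <- H3, exp_ln by lra. field_simplify_eq; [|lra]. nra.
Qed.

Section FreeBoundary.

Context (M : space_form) (r a s0 : R).
Context (Ha : catenoid_parameter M a) (Hs0 : 0 < s0) (Hsin : 0 < gsin M r).
Context (Hf : free_boundary_minimal_annulus M r s0 (catenoid M a)).

Lemma prof0_pos (s : R) : - s0 <= s <= s0 -> 0 < prof0 M a s.
Proof.
  intros Hs. destruct Hf as [_ [_ [_ [Hb _]]]].
  destruct (Hb s 0 Hs) as [[_ H] _]. rewrite catenoid_profile in H. exact H.
Qed.

Lemma drad_0 : drad M a 0 = 0.
Proof. unfold drad. rewrite Rmult_0_r, gsin_0. unfold Rdiv. ring. Qed.

Lemma prof1_0 : prof1 M a 0 = 0.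
Proof. unfold prof1. rewrite phi_0, gsin_0 by exact Ha. ring. Qed.

Lemma tan0_0 : tan0 M a 0 = 0.
Proof. unfold tan0. rewrite phi_0, gsin_0, drad_0 by exact Ha. unfold Rdiv. ring. Qed.

(* The position is an eigenvector of the Laplacian: [Delta X = -2 curv X]. *)
Lemma derive_rad_tan0 (s : R) :
  is_derive (fun x => rad M a x * tan0 M a x) s (- 2 * curv M * rad M a s * prof0 M a s).
Proof.
  pose proof (derive_rad M a Ha s). pose proof (derive_tan0 M a Ha s). pose proof (rad_pos M a Ha s).
  pose proof (frame_expansion0 M a Ha s) as E.
  eapply is_derive_eq; [derive_R|]. unfold pcurv. cbv beta.
  replace (drad M a s * tan0 M a s)
    with (- curv M * rad M a s * prof0 M a s - flux M a / rad M a s * nor0 M a s) by lra.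
  field. lra.
Qed.

Lemma derive_rad_tan1 (s : R) :
  is_derive (fun x => rad M a x * tan1 M a x) s (- 2 * curv M * rad M a s * prof1 M a s).
Proof.
  pose proof (derive_rad M a Ha s). pose proof (derive_tan1 M a Ha s). pose proof (rad_pos M a Ha s).
  pose proof (frame_expansion1 M a Ha s) as E.
  eapply is_derive_eq; [derive_R|]. unfold pcurv. cbv beta.
  replace (drad M a s * tan1 M a s)
    with (- curv M * rad M a s * prof1 M a s - flux M a / rad M a s * nor1 M a s) by lra.
  field. lra.
Qed.

(** The distance to the pole grows along the profile: [curv * rad * tan0] vanishes at 0 by symmetry
    and decreases because [x0] is positive in the ball. *)
Lemma tan0_sign (s : R) : 0 < s <= s0 -> curv M * tan0 M a s < 0.
Proof.
  intros Hs. pose proof (rad_pos M a Ha s) as Hr. pose proof (curv_sqr M) as K.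
  assert (H : - (curv M * (rad M a 0 * tan0 M a 0)) < - (curv M * (rad M a s * tan0 M a s))).
  { apply (derive_pos_lt (fun x => - (curv M * (rad M a x * tan0 M a x)))
      (fun x => 2 * (rad M a x * prof0 M a x))); [lra|..].
    - intros x _. pose proof (derive_rad_tan0 x) as D.
      eapply is_derive_eq; [apply derive_opp, (derive_mult (fun _ => curv M)); [derive_R|exact D]|].
      cbv beta. transitivity (2 * (curv M * curv M) * (rad M a x * prof0 M a x)); [|rewrite K]; ring.
    - intros x Hx. pose proof (rad_pos M a Ha x). pose proof (prof0_pos x ltac:(lra)).
      pose proof (Rmult_lt_0_compat _ _ H H0). lra. }
  rewrite tan0_0 in H.
  assert (rad M a s * (curv M * tan0 M a s) < 0) by lra. nra.
Qed.

Lemma prof0_boundary : prof0 M a s0 = gcos M r.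
Proof.
  destruct Hf as [_ [_ [_ [_ [_ Hb]]]]].
  destruct (Hb s0 0 (or_intror eq_refl)) as [[Hm Hd] _].
  rewrite <- (gcos_gdist M _ r Hm Hd). now rewrite catenoid_profile.
Qed.

(* The outward conormal is [+X_s]: its square norm is one, and its sign is that of
   [curv * tan0], which is known. *)
Lemma conormal_boundary :
  gcot M r * prof0 M a s0 - / gsin M r = tan0 M a s0 /\
  gcot M r * prof1 M a s0 = tan1 M a s0 /\
  gcot M r * rad M a s0 = drad M a s0.
Proof.
  pose proof prof0_boundary as Hp.
  pose proof (tan0_sign s0 ltac:(lra)) as Hsg.
  pose proof (frame_tan_tan M a Ha s0) as ET. pose proof (frame_prof_prof M a Ha s0) as EX.
  pose proof (gcos_gsin_sqr M r) as ER. pose proof (curv_sqr M) as K.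
  destruct Hf as [_ [_ [_ [_ [_ Hb]]]]].
  (* At [t = 0] the vector [X_t] points along [x3], so [q] drops out of the first three
     coordinates. *)
  destruct (Hb s0 0 (or_intror eq_refl)) as [_ [p [q E]]].
  rewrite vpd_s_catenoid, vpd_t_catenoid, catenoid_profile in E by exact Ha.
  unfold ball_normal, vsub, vadd, vscal, pole in E. simpl in E.
  injection E as E0 E1 E2 _. rewrite sin_0, cos_0 in *.
  unfold gcot. set (C := gcos M r) in *. set (S := gsin M r) in *.
  set (x := prof0 M a s0) in *. set (y := prof1 M a s0) in *. set (z := rad M a s0) in *.
  set (dx := tan0 M a s0) in *. set (dy := tan1 M a s0) in *. set (dz := drad M a s0) in *.
  set (k := curv M) in *.
  assert (F0 : C / S * x - / S = p * dx) 
    by (transitivity (p * dx + q * 0); [rewrite <- E0; field; lra|ring]).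
  assert (F1 : C / S * y = p * dy) 
    by (transitivity (p * dy + q * 0); [rewrite <- E1; field; lra|ring]).
  assert (F2 : C / S * z = p * dz).
  { transitivity (p * (dz * 1) + q * (- z * 0)); [rewrite <- E2; field; lra|ring]. }
  assert (Hdx : p * dx = - k * S).
  { rewrite <- F0, Hp. replace (C / S * C - / S) with ((C ^ 2 - 1) / S) by (field; lra).
    replace (C ^ 2 - 1) with (- k * S ^ 2) by lra. field. lra. }
  assert (Hp0 : 0 < p).
  { assert (Q : p * (k * dx) = - S) by (transitivity (k * (p * dx)); [ring|rewrite Hdx];
      transitivity (- (k * k) * S); [ring|rewrite K; ring]).
    destruct (Rlt_or_le 0 p) as [|Hn]; [easy|]. nra. }
  assert (Hp2 : p ^ 2 = 1).
  { transitivity (k * (p * dx) ^ 2 + (p * dy) ^ 2 + (p * dz) ^ 2).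
    - transitivity (p ^ 2 * (k * dx ^ 2 + dy ^ 2 + dz ^ 2)); [rewrite ET|]; ring.
    - rewrite Hdx, <- F1, <- F2.
      transitivity (k * k * k * S ^ 2 + C ^ 2 / S ^ 2 * (y ^ 2 + z ^ 2)); [field; lra|].
      replace (y ^ 2 + z ^ 2) with (k * (1 - C ^ 2)) by (rewrite <- Hp; lra).
      replace (1 - C ^ 2) with (k * S ^ 2) by lra.
      transitivity (k * k * (k * S ^ 2) + k * k * C ^ 2); [field; lra|]. rewrite K. lra. }
  assert (p = 1) by nra. subst p. repeat split; lra.
Qed.

(** At the boundary [X_s = gcot r * X - pole / gsin r]. The normal is orthogonal to [X] and [X_s],
    hence to the pole. *)
Lemma nor0_boundary : nor0 M a s0 = 0.
Proof.
  destruct conormal_boundary as [E0 [E1 E2]].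
  pose proof (frame_tan_nor M a Ha s0) as F1. pose proof (frame_prof_nor M a Ha s0) as F2.
  rewrite <- E0, <- E1, <- E2 in F1.
  assert (F : curv M * / gsin M r * nor0 M a s0 = 0).
  { transitivity (gcot M r * (curv M * prof0 M a s0 * nor0 M a s0 + prof1 M a s0 * nor1 M a s0
      + rad M a s0 * (flux M a / rad M a s0))
      - (curv M * (gcot M r * prof0 M a s0 - / gsin M r) * nor0 M a s0
         + gcot M r * prof1 M a s0 * nor1 M a s0
         + gcot M r * rad M a s0 * (flux M a / rad M a s0))); [ring|]. rewrite F1, F2. ring. }
  pose proof (curv_sqr M) as K. pose proof (Rinv_0_lt_compat _ Hsin).
  apply Rmult_integral in F. destruct F as [F|F]; [|exact F].
  apply Rmult_integral in F. destruct F as [F|F]; [rewrite F in K|]; lra.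
Qed.

Lemma tan0_opp (s : R) : tan0 M a (- s) = - tan0 M a s.
Proof.
  unfold tan0. rewrite rad_opp, axr_opp, drad_opp, phi_opp, gsin_opp, gcos_opp by exact Ha.
  unfold Rdiv. ring.
Qed.

Lemma tan1_opp (s : R) : tan1 M a (- s) = tan1 M a s.
Proof.
  unfold tan1. rewrite rad_opp, axr_opp, drad_opp, phi_opp, gsin_opp, gcos_opp by exact Ha.
  f_equal. ring.
Qed.

Lemma prof0_opp (s : R) : prof0 M a (- s) = prof0 M a s.
Proof. unfold prof0. now rewrite axr_opp, phi_opp, gcos_opp by exact Ha. Qed.

Lemma prof1_opp (s : R) : prof1 M a (- s) = - prof1 M a s.
Proof. unfold prof1. rewrite axr_opp, phi_opp, gsin_opp by exact Ha. ring. Qed.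

(** The quotient [prof1 / prof0] vanishes at 0 and increases by the Wronskian identity. *)
Lemma prof1_pos (s : R) : 0 < s <= s0 -> 0 < prof1 M a s.
Proof.
  intros Hs. pose proof (prof0_pos s ltac:(lra)) as Hp.
  assert (H : prof1 M a 0 / prof0 M a 0 < prof1 M a s / prof0 M a s).
  { apply (derive_pos_lt (fun x => prof1 M a x / prof0 M a x)
      (fun x => flux M a / rad M a x / prof0 M a x ^ 2)); [lra|..].
    - intros x Hx. pose proof (prof0_pos x ltac:(lra)).
      pose proof (derive_prof0 M a Ha x). pose proof (derive_prof1 M a Ha x).
      eapply is_derive_eq; [derive_R; lra|]. cbv beta.
      rewrite <- (profile_wronskian M a Ha x). f_equal. ring.
    - intros x Hx. pose proof (prof0_pos x ltac:(lra)).
      apply Rdiv_lt_0_compat; [|now apply pow_lt].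
      apply Rdiv_lt_0_compat; [now apply flux_pos|now apply rad_pos]. }
  rewrite prof1_0 in H.
  replace (prof1 M a s) with (prof1 M a s / prof0 M a s * prof0 M a s) by (field; lra).
  apply Rmult_lt_0_compat; [|exact Hp]. unfold Rdiv in H at 1. lra.
Qed.

(** * Lower bound: the ambient coordinates *)

(** The restriction to the catenoid of a linear function on the ambient space. *)
Definition height (c0 c1 c2 c3 : R) (s t : R) : R :=
  c0 * prof0 M a s + c1 * prof1 M a s + rad M a s * (c2 * cos t + c3 * sin t).

(** The factors [1] give the right-hand side the shape required by [smooth_combination]. *)
Lemma height_coordinates (c0 c1 c2 c3 s t : R) :
  height c0 c1 c2 c3 s t =
  1 * (c0 * x0 (catenoid M a s t) + c1 * x1 (catenoid M a s t))
  + 1 * (c2 * x2 (catenoid M a s t) + c3 * x3 (catenoid M a s t)).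
Proof. rewrite catenoid_profile. unfold height. simpl. ring. Qed.

Lemma height_smooth_fun (c0 c1 c2 c3 : R) : smooth_fun (height c0 c1 c2 c3).
Proof.
  destruct Hf as [[S0 [S1 [S2 S3]]] _]. split.
  - apply (smooth_ext _ _ (fun s t => eq_sym (height_coordinates c0 c1 c2 c3 s t))).
    apply smooth_combination; now apply smooth_combination.
  - intros s t. unfold height. now rewrite cos_plus, sin_plus, cos_2PI, sin_2PI, Rmult_1_r, Rmult_0_r,
      Rmult_1_r, Rmult_0_r, Rminus_0_r, Rplus_0_r.
Qed.

Let alpha (c0 c1 s : R) : R := c0 * prof0 M a s + c1 * prof1 M a s.
Let dalpha (c0 c1 s : R) : R := c0 * tan0 M a s + c1 * tan1 M a s.

(* The heights satisfy the Jacobi equation up to the factor [|B|^2] and, except for [x0],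
   the Robin boundary condition. *)
Lemma index_form_height (c0 c1 c2 c3 : R) :
  index_form M r s0 (catenoid M a) (height c0 c1 c2 c3) =
  - 4 * PI * gcot M r * rad M a s0 * c0 ^ 2
  - RInt (fun s => 2 * pcurv M a s ^ 2 * rad M a s *
      (2 * PI * (c0 * prof0 M a s + c1 * prof1 M a s) ^ 2
       + PI * rad M a s ^ 2 * (c2 ^ 2 + c3 ^ 2))) (- s0) s0.
Proof.
  rewrite index_form_catenoid by (exact Ha || apply height_smooth_fun).
  assert (Ds' : forall s t, pd Ds (height c0 c1 c2 c3) s t
     = dalpha c0 c1 s + drad M a s * c2 * cos t + drad M a s * c3 * sin t).
  { intros s t. pose proof (derive_prof0 M a Ha s). pose proof (derive_prof1 M a Ha s).
    pose proof (derive_rad M a Ha s). apply is_derive_unique. unfold height.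
    eapply is_derive_eq; [derive_R|]. unfold dalpha. cbv beta. ring. }
  assert (Dt' : forall s t, pd Dt (height c0 c1 c2 c3) s t
     = 0 + rad M a s * c3 * cos t + - (rad M a s * c2) * sin t).
  { intros s t. apply is_derive_unique. unfold height.
    eapply is_derive_eq; [derive_R|]. cbv beta. ring. }
  assert (Iu : forall s, RInt (fun t => height c0 c1 c2 c3 s t ^ 2) 0 (2 * PI)
     = 2 * PI * alpha c0 c1 s ^ 2 + PI * rad M a s ^ 2 * (c2 ^ 2 + c3 ^ 2)).
  { intros s. rewrite (RInt_ext_R _ (fun t =>
      (alpha c0 c1 s + rad M a s * c2 * cos t + rad M a s * c3 * sin t) ^ 2)).
    - rewrite RInt_trig_sqr. ring_R.
    - intros t. unfold height, alpha. ring. }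
  set (d := c2 ^ 2 + c3 ^ 2) in *.
  (* Green's formula on the annulus: [G] is the integral of [rad * u * u_s] over a circle, and the
     integrand of the form is [dG - K], where [K] collects the terms with [|B|^2]. *)
  set (G := fun s => rad M a s * (2 * PI * alpha c0 c1 s * dalpha c0 c1 s)
                     + PI * d * (rad M a s ^ 2 * drad M a s)).
  set (K := fun s => 2 * pcurv M a s ^ 2 * rad M a s *
      (2 * PI * alpha c0 c1 s ^ 2 + PI * rad M a s ^ 2 * d)).
  set (dG := fun s => 2 * PI * (rad M a s * dalpha c0 c1 s ^ 2
       - 2 * curv M * rad M a s * alpha c0 c1 s ^ 2)
     + PI * d * (rad M a s * drad M a s ^ 2 + rad M a s - 2 * curv M * rad M a s ^ 3)).
  assert (DG : forall s, is_derive G s (dG s)).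
  { intros s. pose proof (derive_prof0 M a Ha s). pose proof (derive_prof1 M a Ha s).
    pose proof (derive_rad_tan0 s) as R0. pose proof (derive_rad_tan1 s) as R1.
    pose proof (derive_rad M a Ha s). pose proof (derive_drad M a Ha s).
    pose proof (frame_expansion2 M a Ha s) as E2. pose proof (rad_pos M a Ha s) as Hr.
    (* Regrouped so that [rad * tan0] and [rad * tan1] become atoms whose derivatives are already
       known. *)
    apply is_derive_ext with (fun s => 2 * PI * ((c0 * prof0 M a s + c1 * prof1 M a s) *
       (c0 * (rad M a s * tan0 M a s) + c1 * (rad M a s * tan1 M a s)))
       + PI * d * (rad M a s ^ 2 * drad M a s)).
    { intros t. unfold G, alpha, dalpha. ring_R. }
    set (w0 := fun x => rad M a x * tan0 M a x) in *.
    set (w1 := fun x => rad M a x * tan1 M a x) in *.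
    apply is_derive_ext with (fun s => 2 * PI * ((c0 * prof0 M a s + c1 * prof1 M a s) *
       (c0 * w0 s + c1 * w1 s)) + PI * d * (rad M a s ^ 2 * drad M a s)); [reflexivity|].
    eapply is_derive_eq; [derive_R|]. unfold w0, w1, dG, alpha, dalpha. cbv beta.
    replace (PI * d * (rad M a s * drad M a s ^ 2 + rad M a s - 2 * curv M * rad M a s ^ 3))
      with (PI * d * (rad M a s * drad M a s ^ 2 + rad M a s * (curv M * rad M a s ^ 2
        + drad M a s ^ 2 + (flux M a / rad M a s) ^ 2) - 2 * curv M * rad M a s ^ 3))
      by (rewrite E2; ring).
    field. lra. }
  assert (C0 : forall s, continuous (prof0 M a) s).
  { intros s. apply (is_derive_continuous _ _ _ (derive_prof0 M a Ha s)). }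
  assert (C1 : forall s, continuous (prof1 M a) s).
  { intros s. apply (is_derive_continuous _ _ _ (derive_prof1 M a Ha s)). }
  assert (CT0 : forall s, continuous (tan0 M a) s).
  { intros s. apply (is_derive_continuous _ _ _ (derive_tan0 M a Ha s)). }
  assert (CT1 : forall s, continuous (tan1 M a) s).
  { intros s. apply (is_derive_continuous _ _ _ (derive_tan1 M a Ha s)). }
  assert (Cr : forall s, continuous (rad M a) s) by (intros; now apply continuous_rad).
  assert (Cdr : forall s, continuous (drad M a) s) by (intros; now apply continuous_drad).
  assert (Ck : forall s, continuous (pcurv M a) s).
  { intros s. apply (is_derive_continuous _ _ _ (derive_pcurv M a Ha s)). }
  assert (CdG : forall s, continuous dG s).
  { intros s. unfold dG, alpha, dalpha.
    apply continuous_ext with (fun s => 2 * PI * (rad M a s * (c0 * tan0 M a s + c1 * tan1 M a s) ^ 2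
       - 2 * curv M * rad M a s * (c0 * prof0 M a s + c1 * prof1 M a s) ^ 2)
     + PI * d * (rad M a s * drad M a s ^ 2 + rad M a s - 2 * curv M * (rad M a s * rad M a s ^ 2))).
    { intros t. ring_R. }
    continuity_R. }
  assert (CK : forall s, continuous K s).
  { intros s. unfold K, alpha. continuity_R. }
  rewrite (RInt_ext_R _ (fun s => dG s - K s)).
  2: { intros s. pose proof (rad_pos M a Ha s) as Hr.
    rewrite (RInt_ext_R (fun t => pd Ds _ s t ^ 2) (fun t =>
      (dalpha c0 c1 s + drad M a s * c2 * cos t + drad M a s * c3 * sin t) ^ 2))
      by (intros t; now rewrite Ds').
    rewrite (RInt_ext_R (fun t => pd Dt _ s t ^ 2) (fun t =>
      (0 + rad M a s * c3 * cos t + - (rad M a s * c2) * sin t) ^ 2))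
      by (intros t; now rewrite Dt').
    rewrite !RInt_trig_sqr, Iu. unfold dG, K, d. field. lra. }
  rewrite RInt_minus_R by assumption.
  rewrite (RInt_of_derive G dG) by assumption.
  rewrite !Iu. unfold K, G, alpha, dalpha.
  rewrite !rad_opp, !drad_opp, !prof0_opp, !prof1_opp, !tan0_opp, !tan1_opp.
  destruct conormal_boundary as [E0 [E1 E2]]. rewrite <- E0, <- E1, <- E2, prof0_boundary.
  unfold gcot. field. lra.
Qed.

Lemma coordinates_index (Hcos : 0 < gcos M r) : index_at_least M r s0 (catenoid M a) 4.
Proof.
  pose proof PI_RGT_0 as HPI.
  exists (fun u => exists c0 c1 c2 c3, forall s t, u s t = height c0 c1 c2 c3 s t).
  split; [|split].
  - split; [|split; [|split]].
    + intros u [c0 [c1 [c2 [c3 E]]]]. destruct (height_smooth_fun c0 c1 c2 c3) as [S P]. split.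
      * apply (smooth_ext (height c0 c1 c2 c3)); [intros; now rewrite E|exact S].
      * intros s t. now rewrite !E.
    + exists 0, 0, 0, 0. intros s t. unfold height. ring.
    + intros u v [c0 [c1 [c2 [c3 E]]]] [d0 [d1 [d2 [d3 F]]]].
      exists (c0 + d0), (c1 + d1), (c2 + d2), (c3 + d3). intros s t. rewrite E, F.
      unfold height. ring.
    + intros c u [c0 [c1 [c2 [c3 E]]]]. exists (c * c0), (c * c1), (c * c2), (c * c3).
      intros s t. rewrite E. unfold height. ring.
  - intros u [c0 [c1 [c2 [c3 E]]]] Hu.
    assert (u = height c0 c1 c2 c3) as ->.
    { apply functional_extensionality; intros s. apply functional_extensionality; intros t.
      apply E. }
    rewrite index_form_height.
    set (K := fun s => 2 * pcurv M a s ^ 2 * rad M a s *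
      (2 * PI * (c0 * prof0 M a s + c1 * prof1 M a s) ^ 2
       + PI * rad M a s ^ 2 * (c2 ^ 2 + c3 ^ 2))).
    assert (CK : forall s, continuous K s).
    { intros s. pose proof (is_derive_continuous _ _ _ (derive_prof0 M a Ha s)).
      pose proof (is_derive_continuous _ _ _ (derive_prof1 M a Ha s)).
      pose proof (continuous_rad M a Ha s).
      pose proof (is_derive_continuous _ _ _ (derive_pcurv M a Ha s)).
      unfold K. continuity_R. }
    assert (Kk : forall s, 0 < 2 * pcurv M a s ^ 2 * rad M a s).
    { intros s. pose proof (rad_pos M a Ha s). pose proof (flux_pos M a Ha).
      apply Rmult_lt_0_compat; [|easy]. apply Rmult_lt_0_compat; [lra|]. apply pow_lt.
      apply Rdiv_lt_0_compat; [easy|]. apply pow_lt. easy. }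
    assert (K0 : forall s, 0 <= K s).
    { intros s. unfold K. apply Rmult_le_pos; [now apply Rlt_le|].
      apply Rplus_le_le_0_compat; apply Rmult_le_pos.
      - lra.
      - apply pow2_ge_0.
      - apply Rmult_le_pos; [lra|apply pow2_ge_0].
      - apply Rplus_le_le_0_compat; apply pow2_ge_0. }
    assert (IK : 0 <= RInt K (- s0) s0) by (apply RInt_nonneg; [lra|auto|auto]).
    assert (Hcot : 0 < gcot M r * rad M a s0).
    { apply Rmult_lt_0_compat; [now apply Rdiv_lt_0_compat|now apply rad_pos]. }
    (* If [c0] is nonzero the boundary term is strictly negative. Otherwise strictness comes from
       [K], positive for [s > 0] because [prof1] is. *)
    destruct (Req_dec c0 0) as [Z0|N0].
    + assert (Hd : c1 <> 0 \/ c2 <> 0 \/ c3 <> 0).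
      { destruct (Req_dec c1 0) as [Z1|]; [|tauto]. destruct (Req_dec c2 0) as [Z2|]; [|tauto].
        destruct (Req_dec c3 0) as [Z3|]; [|tauto]. exfalso. apply Hu. intros s t _.
        unfold height. rewrite Z0, Z1, Z2, Z3. ring. }
      assert (Kp : forall s, prof1 M a s <> 0 -> 0 < K s).
      { intros s Hp. unfold K. apply Rmult_lt_0_compat; [apply Kk|].
        rewrite Z0, Rmult_0_l, Rplus_0_l.
        pose proof (pow_lt _ 2 (rad_pos M a Ha s)) as Hr2.
        assert (0 < PI * rad M a s ^ 2) as Hq by now apply Rmult_lt_0_compat.
        pose proof (pow2_ge_0 (c1 * prof1 M a s)). pose proof (pow2_ge_0 c2).
        pose proof (pow2_ge_0 c3).
        destruct Hd as [Hd|Hd].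
        - assert (0 < (c1 * prof1 M a s) ^ 2).
          { rewrite <- Rsqr_pow2. apply Rsqr_pos_lt. now apply Rmult_integral_contrapositive. }
          assert (0 < 2 * PI * (c1 * prof1 M a s) ^ 2) by (apply Rmult_lt_0_compat; lra).
          assert (0 <= PI * rad M a s ^ 2 * (c2 ^ 2 + c3 ^ 2)) by (apply Rmult_le_pos; lra). lra.
        - assert (0 < c2 ^ 2 + c3 ^ 2).
          { destruct Hd as [Hd|Hd]; apply Rsqr_pos_lt in Hd; rewrite Rsqr_pow2 in Hd; lra. }
          assert (0 <= 2 * PI * (c1 * prof1 M a s) ^ 2) by (apply Rmult_le_pos; lra).
          assert (0 < PI * rad M a s ^ 2 * (c2 ^ 2 + c3 ^ 2)) by (apply Rmult_lt_0_compat; lra). lra. }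
      assert (0 < RInt K 0 s0).
      { apply RInt_gt_0; [lra| |auto]. intros s Hs. apply Kp.
        pose proof (prof1_pos s ltac:(lra)). lra. }
      assert (0 <= RInt K (- s0) 0) by (apply RInt_nonneg; [lra|auto|auto]).
      rewrite Z0.
      change (- 4 * PI * gcot M r * rad M a s0 * 0 ^ 2 - RInt K (- s0) s0 < 0).
      rewrite (RInt_Chasles_R K (- s0) 0 s0 CK). lra.
    + assert (0 < c0 ^ 2) by (rewrite <- Rsqr_pow2; now apply Rsqr_pos_lt).
      assert (0 < PI * (gcot M r * rad M a s0) * c0 ^ 2)
        by (apply Rmult_lt_0_compat; [now apply Rmult_lt_0_compat|easy]).
      change (- 4 * PI * gcot M r * rad M a s0 * c0 ^ 2 - RInt K (- s0) s0 < 0). lra.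
  - exists (fun i => match i with
      | 1%nat => height 1 0 0 0 | 2%nat => height 0 1 0 0
      | 3%nat => height 0 0 1 0 | _ => height 0 0 0 1 end).
    split.
    + intros i _. destruct i as [|[|[|[|i]]]]; do 4 eexists; reflexivity.
    + intros c Hv.
      assert (E : forall s t, - s0 <= s <= s0 -> height (c 1%nat) (c 2%nat) (c 3%nat) (c 4%nat) s t = 0).
      { intros s t Hs. rewrite <- (Hv s t Hs). rewrite !sum_n_m_Sm, sum_n_m_0.
        unfold height. ring_R. }
      pose proof (rad_pos M a Ha 0) as Hr. pose proof (prof0_pos 0 ltac:(lra)) as H0.
      pose proof (prof1_pos s0 ltac:(lra)) as H1.
      (* On the waist [prof1] vanishes, so three points there isolate the coefficients of [x0], [x2]
         and [x3]; a boundary point then gives that of [x1]. *)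
      pose proof (E 0 0 ltac:(lra)) as E1. pose proof (E 0 PI ltac:(lra)) as E2.
      pose proof (E 0 (PI / 2) ltac:(lra)) as E3.
      pose proof (E s0 0 ltac:(lra)) as E4.
      unfold height in E1, E2, E3, E4. rewrite prof1_0 in E1, E2, E3.
      rewrite ?cos_0, ?sin_0, ?cos_PI, ?sin_PI, ?cos_PI2, ?sin_PI2 in *.
      assert (Z1 : c 1%nat * prof0 M a 0 = 0) by lra.
      apply Rmult_integral in Z1. destruct Z1 as [Z1|]; [|lra].
      assert (Z3 : rad M a 0 * c 3%nat = 0) by lra.
      apply Rmult_integral in Z3. destruct Z3 as [|Z3]; [lra|].
      rewrite Z1, Z3 in *.
      assert (Z4 : rad M a 0 * c 4%nat = 0) by lra.
      apply Rmult_integral in Z4. destruct Z4 as [|Z4]; [lra|].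
      assert (Z2 : c 2%nat * prof1 M a s0 = 0) by (rewrite Z4 in E4; lra).
      apply Rmult_integral in Z2. destruct Z2 as [Z2|]; [|lra].
      intros i Hi. destruct i as [|[|[|[|[|i]]]]]; [lia|assumption..|lia].
Qed.

End FreeBoundary.

(** * Reduction to Fourier modes *)

Section Reduction.

Context (a : R) (Ha : catenoid_parameter Spherical a).

Notation rho := (rad Spherical a).
Notation drho := (drad Spherical a).
Notation c := (flux Spherical a).
Notation X := (catenoid Spherical a).

Let Hrho : forall s, 0 < rho s := rad_pos Spherical a Ha.

(** The least value of [rho^2] is [1/2 + a], at the waist, and [c^2 = (1/2 - a) (1/2 + a)] with
    [1/2 - a < 1]. This provides the sign for the modes of order at least two. *)
Lemma flux_le_rad (s : R) : c ^ 2 <= rho s ^ 2.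
Proof.
  rewrite flux_sqr, rad_sqr by exact Ha. simpl in *. pose proof (COS_bound (2 * s)). nra.
Qed.

Lemma spherical_profile (s : R) : rho s ^ 2 + drho s ^ 2 + c ^ 2 / rho s ^ 2 = 1.
Proof.
  rewrite <- (frame_expansion2 Spherical a Ha s). simpl curv. pose proof (Hrho s). field. lra.
Qed.

Lemma spherical_drad_sqr (s : R) : drho s ^ 2 = 1 - rho s ^ 2 - c ^ 2 / rho s ^ 2.
Proof. pose proof (spherical_profile s). lra. Qed.

(** The index form of one Fourier mode in the variable [y = u / rho], its boundary term absorbed.
    There [q] is [rho^2] times the Jacobi operator of that mode applied to [rho]:
    [rho + 2 c^2 / rho] for order zero and [2 c^2 / rho] for order one. *)
Definition fourier_form (q : R -> R) (s0 : R) (y : R -> R) : R :=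
  RInt (fun s => rho s ^ 3 * Derive y s ^ 2 - q s * y s ^ 2) (- s0) s0.

Lemma continuous_smooth_product (u : R -> R -> R) (w : R -> R) (s t : R) :
  smooth u -> (forall t, ex_derive w t) -> continuity_2d_pt (fun s t => u s t * w t) s t.
Proof.
  intros Hu Hw. apply continuity_2d_pt_mult; [now apply smooth_continuity|].
  apply (continuity_1d_2d_pt_comp w (fun _ t => t)).
  - apply continuity_pt_filterlim. apply (ex_derive_continuous w), Hw.
  - apply continuity_2d_pt_id2.
Qed.

(** Fourier coefficients without normalisation, whence the factors [/ (2 * PI)] and [/ PI] below. *)
Definition mode (w : R -> R) (u : R -> R -> R) (s : R) : R :=
  RInt (fun t => u s t * w t) 0 (2 * PI).

Lemma derive_mode (w : R -> R) (u : R -> R -> R) (s : R) :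
  smooth u -> (forall t, ex_derive w t) ->
  is_derive (mode w u) s (mode w (pd Ds u) s).
Proof.
  intros Hu Hw. apply (is_derive_RInt_parameter (fun s t => u s t * w t)
    (fun s t => pd Ds u s t * w t)).
  - intros x t. pose proof (smooth_is_derive_s u x t Hu).
    eapply is_derive_eq; [derive_R|cbv beta; ring].
  - intros. now apply continuous_smooth_product.
  - intros. apply continuous_smooth_product; [now apply smooth_ds|easy].
Qed.

Lemma derive_mode_quotient (w : R -> R) (u : R -> R -> R) (s : R) :
  smooth u -> (forall t, ex_derive w t) ->
  is_derive (fun s => mode w u s / rho s) s
    ((mode w (pd Ds u) s - drho s / rho s * mode w u s) / rho s).
Proof.
  intros Hu Hw. pose proof (derive_mode w u s Hu Hw). pose proof (derive_rad Spherical a Ha s).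
  pose proof (Hrho s). eapply is_derive_eq; [derive_R; lra|cbv beta; field; lra].
Qed.

(* Modes of order at least two are controlled by the supersolution [rho] of the equation of
   the second mode: completing the square with [rho] leaves a nonnegative multiple of the
   square norm on each circle, from which only the modes of order zero and one are subtracted. *)
Lemma circle_integrand_lower_bound (u : R -> R -> R) (s : R) :
  smooth_fun u ->
  (c ^ 2 / rho s ^ 3 - rho s) * RInt (fun t => u s t ^ 2) 0 (2 * PI)
  + drho s * RInt (fun t => 2 * u s t * pd Ds u s t) 0 (2 * PI)
  + / (2 * PI) * (rho s ^ 3 * Derive (fun s => mode (fun _ => 1) u s / rho s) s ^ 2
       - (rho s + 2 * c ^ 2 / rho s) * (mode (fun _ => 1) u s / rho s) ^ 2)
  + / PI * (rho s ^ 3 * Derive (fun s => mode cos u s / rho s) s ^ 2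
       - 2 * c ^ 2 / rho s * (mode cos u s / rho s) ^ 2)
  + / PI * (rho s ^ 3 * Derive (fun s => mode sin u s / rho s) s ^ 2
       - 2 * c ^ 2 / rho s * (mode sin u s / rho s) ^ 2)
  <= rho s * RInt (fun t => pd Ds u s t ^ 2) 0 (2 * PI)
      + RInt (fun t => pd Dt u s t ^ 2) 0 (2 * PI) / rho s
      - (2 * curv Spherical + 2 * pcurv Spherical a s ^ 2) * rho s
        * RInt (fun t => u s t ^ 2) 0 (2 * PI).
Proof.
  intros [Hu Pu]. pose proof (Hrho s) as Hr. pose proof PI_RGT_0 as HPI.
  assert (E1 : forall t, ex_derive (fun _ : R => 1) t) by (intros; apply ex_derive_const).
  assert (Ec : forall t, ex_derive cos t) by (intros t; eexists; apply is_derive_cos).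
  assert (Es : forall t, ex_derive sin t) by (intros t; eexists; apply is_derive_sin).
  assert (DQ : forall w, (forall t, ex_derive w t) -> Derive (fun s => mode w u s / rho s) s
    = (mode w (pd Ds u) s - drho s / rho s * mode w u s) / rho s).
  { intros w Hw. apply is_derive_unique. now apply derive_mode_quotient. }
  rewrite (DQ _ E1), (DQ _ Ec), (DQ _ Es). clear DQ.
  assert (Cu : forall t, continuous (u s) t).
  { intros t. now apply (continuity_2d_slice u), smooth_continuity. }
  assert (Cs : forall t, continuous (pd Ds u s) t).
  { intros t. now apply (continuity_2d_slice (pd Ds u)), smooth_continuity, smooth_ds. }
  assert (Ct : forall t, continuous (pd Dt u s) t).
  { intros t. now apply (continuity_2d_slice (pd Dt u)), smooth_continuity, smooth_dt. }
  assert (Pdt : forall t, pd Dt u s (t + 2 * PI) = pd Dt u s t).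
  { intros t. pose proof (smooth_is_derive_t u s t Hu) as D1.
    pose proof (smooth_is_derive_t u s (t + 2 * PI) Hu) as D2.
    assert (D3 : is_derive (fun z => u s z) t (pd Dt u s (t + 2 * PI))).
    { apply is_derive_ext with (fun z => u s (z + 2 * PI)); [intros; apply Pu|].
      eapply is_derive_eq; [apply (derive_comp (u s) (fun z => z + 2 * PI)); [exact D2|derive_R]|].
      ring. }
    rewrite <- (is_derive_unique _ _ _ D1). symmetry. now apply is_derive_unique. }
  pose proof (wirtinger_three (u s) (pd Dt u s)
    (fun t => smooth_is_derive_t u s t Hu) Ct (Pu s) Pdt) as W.
  (* With this factor [u_s - lam u] is [rho] times the derivative of [u / rho]. Bessel's inequality
     is applied both to it and to [u]. *)
  set (lam := drho s / rho s).
  pose proof (bessel_inequality (u s) Cu) as BP.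
  pose proof (bessel_inequality (fun t => pd Ds u s t - lam * u s t)) as BV.
  specialize (BV ltac:(intros; continuity_R)). cbv beta in BV.
  assert (Em : forall w, (forall t, continuous w t) ->
     RInt (fun t => (pd Ds u s t - lam * u s t) * w t) 0 (2 * PI)
     = mode w (pd Ds u) s - lam * mode w u s).
  { intros w Cw. unfold mode. rewrite <- RInt_scal_R by (intros; continuity_R).
    rewrite <- RInt_minus_R by (intros; continuity_R). apply RInt_ext_R. intros; ring. }
  rewrite (Em cos continuous_cos_R), (Em sin continuous_sin_R) in BV.
  rewrite (RInt_ext_R (fun t => pd Ds u s t - lam * u s t)
    (fun t => (pd Ds u s t - lam * u s t) * 1)) in BV by (intros; ring).
  pose proof (Em (fun _ => 1) (fun t => continuous_const 1 t)) as Em1.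
  change (RInt (fun t : R => (pd Ds u s t - lam * u s t) * 1) 0 (2 * PI)
    = mode (fun _ : R => 1) (pd Ds u) s - lam * mode (fun _ : R => 1) u s) in Em1.
  rewrite Em1 in BV.
  rewrite (RInt_ext_R (u s) (fun t => u s t * 1)) in BP, W by (intros; ring).
  fold (mode (fun _ => 1) u s) in BP, W. fold (mode cos u s) in BP, W.
  fold (mode sin u s) in BP, W.
  rewrite (RInt_ext_R _ (fun t => pd Ds u s t ^ 2 - lam * (2 * u s t * pd Ds u s t)
     + lam ^ 2 * u s t ^ 2)) in BV by (intros; ring).
  rewrite RInt_plus_R, RInt_minus_R, !RInt_scal_R in BV by (intros; continuity_R).
  set (P := RInt (fun t => u s t ^ 2) 0 (2 * PI)) in *.
  set (Q := RInt (fun t => 2 * u s t * pd Ds u s t) 0 (2 * PI)) in *.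
  set (I1 := RInt (fun t => pd Ds u s t ^ 2) 0 (2 * PI)) in *.
  set (I2 := RInt (fun t => pd Dt u s t ^ 2) 0 (2 * PI)) in *.
  set (m := mode (fun _ => 1) u s) in *. set (p := mode cos u s) in *.
  set (q := mode sin u s) in *.
  set (vm := mode (fun _ => 1) (pd Ds u) s - lam * m) in *.
  set (vp := mode cos (pd Ds u) s - lam * p) in *.
  set (vq := mode sin (pd Ds u) s - lam * q) in *.
  pose proof (flux_le_rad s) as Hcr. pose proof (spherical_drad_sqr s) as Hd.
  assert (HV : 0 <= rho s * (I1 - lam * Q + lam ^ 2 * P - (vm ^ 2 / (2 * PI) + (vp ^ 2 + vq ^ 2) / PI))).
  { apply Rmult_le_pos; lra. }
  assert (HW : 0 <= (I2 - (3 * P - 3 * m ^ 2 / (2 * PI) - 2 * (p ^ 2 + q ^ 2) / PI)) / rho s).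
  { apply Rdiv_le_0_compat; lra. }
  assert (HP : 0 <= 2 * (rho s ^ 2 - c ^ 2) / rho s ^ 3
    * (P - (m ^ 2 / (2 * PI) + (p ^ 2 + q ^ 2) / PI))).
  { apply Rmult_le_pos; [|lra]. apply Rdiv_le_0_compat; [lra|]. now apply pow_lt. }
  (* The difference of the two sides is exactly the sum of three nonnegative quantities: the Bessel
     defect of [u_s - lam u], the Wirtinger defect of [u], and the Bessel defect of [u] with the
     coefficient left over by [rho]. *)
  match goal with |- ?L <= ?Rr =>
    assert (Heq : Rr - L =
      rho s * (I1 - lam * Q + lam ^ 2 * P - (vm ^ 2 / (2 * PI) + (vp ^ 2 + vq ^ 2) / PI))
      + (I2 - (3 * P - 3 * m ^ 2 / (2 * PI) - 2 * (p ^ 2 + q ^ 2) / PI)) / rho s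
      + 2 * (rho s ^ 2 - c ^ 2) / rho s ^ 3 * (P - (m ^ 2 / (2 * PI) + (p ^ 2 + q ^ 2) / PI))) end.
  { assert (Hl : lam ^ 2 = (1 - rho s ^ 2 - c ^ 2 / rho s ^ 2) / rho s ^ 2).
    { unfold lam. rewrite <- Hd. field. lra. }
    rewrite Hl. replace (drho s) with (lam * rho s) by (unfold lam; field; lra).
    unfold pcurv. simpl curv. clearbody vm vp vq lam. field. lra. }
  lra.
Qed.

Lemma index_form_reduction (r s0 : R) (u : R -> R -> R) :
  0 < s0 -> gcot Spherical r * rho s0 = drho s0 -> smooth_fun u ->
  / (2 * PI) * fourier_form (fun s => rho s + 2 * c ^ 2 / rho s) s0
     (fun s => mode (fun _ => 1) u s / rho s)
  + / PI * fourier_form (fun s => 2 * c ^ 2 / rho s) s0 (fun s => mode cos u s / rho s)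
  + / PI * fourier_form (fun s => 2 * c ^ 2 / rho s) s0 (fun s => mode sin u s / rho s)
  <= index_form Spherical r s0 X u.
Proof.
  intros Hs0 Hcot Hsu. destruct (Hsu) as [Hu Pu].
  rewrite index_form_catenoid by assumption. rewrite Hcot.
  assert (E1 : forall t, ex_derive (fun _ : R => 1) t) by (intros; apply ex_derive_const).
  assert (Ec : forall t, ex_derive cos t) by (intros t; eexists; apply is_derive_cos).
  assert (Es : forall t, ex_derive sin t) by (intros t; eexists; apply is_derive_sin).
  set (P := fun s => RInt (fun t => u s t ^ 2) 0 (2 * PI)).
  set (Q := fun s => RInt (fun t => 2 * u s t * pd Ds u s t) 0 (2 * PI)).
  assert (Sq : forall f s t, smooth f -> continuity_2d_pt (fun s t => f s t ^ 2) s t).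
  { intros f s t Hf. apply (continuity_2d_pt_ext (fun s t => f s t * f s t)); [intros; ring|].
    apply continuity_2d_pt_mult; now apply smooth_continuity. }
  assert (Sm : forall f g s t, smooth f -> smooth g ->
    continuity_2d_pt (fun s t => 2 * f s t * g s t) s t).
  { intros f g s t Hf Hg. apply continuity_2d_pt_mult; [|now apply smooth_continuity].
    apply continuity_2d_pt_mult; [apply continuity_2d_pt_const|now apply smooth_continuity]. }
  assert (DSq : forall f s, smooth f -> is_derive (fun s => RInt (fun t => f s t ^ 2) 0 (2 * PI)) s
     (RInt (fun t => 2 * f s t * pd Ds f s t) 0 (2 * PI))).
  { intros f s Hf. apply (is_derive_RInt_parameter (fun s t => f s t ^ 2)
      (fun s t => 2 * f s t * pd Ds f s t)).
    - intros x t. apply (derive_sqr (fun z => f z t) x). now apply smooth_is_derive_s.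
    - intros; now apply Sq.
    - intros; apply Sm; [easy|now apply smooth_ds]. }
  assert (CQ : forall s, continuous Q s).
  { intros s. unfold Q.
    eapply is_derive_continuous. apply (is_derive_RInt_parameter
      (fun s t => 2 * u s t * pd Ds u s t)
      (fun s t => 2 * pd Ds u s t * pd Ds u s t + 2 * u s t * pd Ds (pd Ds u) s t)).
    - intros x t. pose proof (smooth_is_derive_s u x t Hu).
      pose proof (smooth_is_derive_s (pd Ds u) x t (smooth_ds u Hu)).
      eapply is_derive_eq; [derive_R|cbv beta; ring].
    - intros; apply Sm; [easy|now apply smooth_ds].
    - intros x t. pose proof (smooth_ds u Hu). apply continuity_2d_pt_plus; apply Sm; auto.
      now apply smooth_ds. }
  assert (CSq : forall f s, smooth f -> continuous (fun s => RInt (fun t => f s t ^ 2) 0 (2 * PI)) s).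
  { intros f s Hf. eapply is_derive_continuous. now apply DSq. }
  assert (CP : forall s, continuous P s) by (intros s; now apply CSq).
  pose proof (fun s => CSq (pd Ds u) s (smooth_ds u Hu)) as C1.
  pose proof (fun s => CSq (pd Dt u) s (smooth_dt u Hu)) as C2.
  pose proof (continuous_rad Spherical a Ha) as Cr.
  pose proof (continuous_drad Spherical a Ha) as Cdr.
  assert (Ck : forall s, continuous (pcurv Spherical a) s).
  { intros s. apply (is_derive_continuous _ _ _ (derive_pcurv Spherical a Ha s)). }
  (* The derivative of [drho * P]. Its integral is exactly the boundary term of the index form,
     since [gcot r * rho s0 = drho s0]. *)
  set (dG := fun s => (c ^ 2 / rho s ^ 3 - rho s) * P s + drho s * Q s).
  assert (Hr3 : forall s, rho s ^ 3 <> 0) by (intros s; apply pow_nonzero; specialize (Hrho s); lra).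
  assert (Hr1 : forall s, rho s <> 0) by (intros s; specialize (Hrho s); lra).
  assert (C3 : forall s, continuous (fun s => rho s ^ 3) s).
  { intros s. change (continuous (fun s => rho s * rho s ^ 2) s). continuity_R. }
  assert (CdG : forall s, continuous dG s) by (intros s; unfold dG; continuity_R; auto).
  assert (IG : RInt dG (- s0) s0 = drho s0 * (P (- s0) + P s0)).
  { rewrite (RInt_of_derive (fun s => drho s * P s)); [|intros s|exact CdG].
    - rewrite drad_opp. ring_R.
    - pose proof (derive_drad Spherical a Ha s). pose proof (DSq u s Hu : is_derive P s (Q s)).
      eapply is_derive_eq; [derive_R|unfold dG; simpl curv; cbv beta; ring]. }
  assert (Cm : forall w, (forall t, ex_derive w t) -> forall s,
     continuous (fun s => mode w u s / rho s) s).
  { intros w Hw s. apply (is_derive_continuous _ _ _ (derive_mode_quotient w u s Hu Hw)). }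
  assert (CDm : forall w, (forall t, ex_derive w t) -> forall s,
     continuous (Derive (fun s => mode w u s / rho s)) s).
  { intros w Hw s.
    apply continuous_ext with
      (fun s => (mode w (pd Ds u) s - drho s / rho s * mode w u s) / rho s).
    { intros t. symmetry. apply is_derive_unique. now apply derive_mode_quotient. }
    pose proof (is_derive_continuous _ _ _ (derive_mode w u s Hu Hw)).
    pose proof (is_derive_continuous _ _ _ (derive_mode w (pd Ds u) s (smooth_ds u Hu) Hw)).
    continuity_R; auto. }
  unfold fourier_form.
  set (m1 := fun s => mode (fun _ => 1) u s / rho s). set (mc := fun s => mode cos u s / rho s).
  set (ms := fun s => mode sin u s / rho s).
  pose proof (Cm _ E1 : forall s, continuous m1 s) as K1.
  pose proof (Cm _ Ec : forall s, continuous mc s) as K2.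
  pose proof (Cm _ Es : forall s, continuous ms s) as K3.
  pose proof (CDm _ E1 : forall s, continuous (Derive m1) s) as K4.
  pose proof (CDm _ Ec : forall s, continuous (Derive mc) s) as K5.
  pose proof (CDm _ Es : forall s, continuous (Derive ms) s) as K6.
  set (F1 := fun s => rho s ^ 3 * Derive m1 s ^ 2 - (rho s + 2 * c ^ 2 / rho s) * m1 s ^ 2).
  set (F2 := fun s => rho s ^ 3 * Derive mc s ^ 2 - 2 * c ^ 2 / rho s * mc s ^ 2).
  set (F3 := fun s => rho s ^ 3 * Derive ms s ^ 2 - 2 * c ^ 2 / rho s * ms s ^ 2).
  assert (CF1 : forall s, continuous F1 s).
  { intros s. unfold F1. apply continuous_Rminus; [apply (continuous_Rmult (fun s => rho s ^ 3))|];
      continuity_R; auto. }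
  assert (CF2 : forall s, continuous F2 s).
  { intros s. unfold F2. apply continuous_Rminus; [apply (continuous_Rmult (fun s => rho s ^ 3))|];
      continuity_R; auto. }
  assert (CF3 : forall s, continuous F3 s).
  { intros s. unfold F3. apply continuous_Rminus; [apply (continuous_Rmult (fun s => rho s ^ 3))|];
      continuity_R; auto. }
  pose (F := fun s => dG s + / (2 * PI) * F1 s + / PI * F2 s + / PI * F3 s).
  assert (IF : RInt F (- s0) s0 = drho s0 * (P (- s0) + P s0) + / (2 * PI) * RInt F1 (- s0) s0
    + / PI * RInt F2 (- s0) s0 + / PI * RInt F3 (- s0) s0).
  { unfold F. rewrite !RInt_plus_R, !RInt_scal_R, IG by (intros s; continuity_R). reflexivity. }
  match goal with |- _ <= RInt ?I _ _ - _ => assert (HI : RInt F (- s0) s0 <= RInt I (- s0) s0) end.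
  { apply RInt_le_R; [lra|intros s; unfold F; continuity_R|intros s; continuity_R; auto|].
    intros s _. apply (circle_integrand_lower_bound u s Hsu). }
  rewrite IF in HI.
  match goal with |- _ <= ?B =>
    assert (Fin : / (2 * PI) * RInt F1 (- s0) s0 + / PI * RInt F2 (- s0) s0
      + / PI * RInt F3 (- s0) s0 <= B) end.
  { match type of HI with _ <= ?B => apply Rle_trans with (B - drho s0 * (P (- s0) + P s0)) end;
      [lra|apply Rle_refl]. }
  exact Fin.
Qed.

End Reduction.

(** * Spherical catenoids: the modes of order zero and one *)

Lemma x_cos_le_sin (x : R) : 0 <= x <= PI -> x * cos x <= sin x.
Proof.
  intros Hx.
  assert (H : sin 0 - 0 * cos 0 <= sin x - x * cos x).
  { apply (derive_nonneg_le (fun t => sin t - t * cos t) (fun t => t * sin t)); [lra|..].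
    - intros t _. eapply is_derive_eq; [derive_R|cbv beta; ring].
    - intros t Ht. apply Rmult_le_pos; [lra|]. apply sin_ge_0; lra. }
  rewrite sin_0 in H. lra.
Qed.

(** The bound [x cot x <= 1 - x^2 / 3] from the first two terms of the expansion of the cotangent;
    it extends continuously to the endpoints in this form without quotients. *)
Lemma pade_cotangent (x : R) : 0 <= x <= PI -> 3 * x * cos x <= (3 - x ^ 2) * sin x.
Proof.
  intros Hx.
  assert (H : (3 - 0 ^ 2) * sin 0 - 3 * 0 * cos 0 <= (3 - x ^ 2) * sin x - 3 * x * cos x).
  { apply (derive_nonneg_le (fun t => (3 - t ^ 2) * sin t - 3 * t * cos t)
      (fun t => t * (sin t - t * cos t))); [lra|..].
    - intros t _. eapply is_derive_eq; [derive_R|cbv beta; ring].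
    - intros t Ht. pose proof (x_cos_le_sin t ltac:(lra)). apply Rmult_le_pos; lra. }
  rewrite sin_0 in H. lra.
Qed.

(** The Taylor polynomial of degree six, a lower bound for the cosine, is positive at 1.56. *)
Lemma PI_lower_bound : 3.12 < PI.
Proof.
  destruct (Rlt_or_le 3.12 PI) as [|H]; [easy|exfalso].
  pose proof PI2_3_2 as HP.
  destruct (pre_cos_bound 1.56 1) as [Hc _]; [lra|lra|].
  unfold cos_approx, cos_term in Hc. simpl in Hc.
  assert (cos 1.56 <= 0) by (apply cos_le_0; lra).
  lra.
Qed.

Lemma inv_sqrt2_bounds : 0.7071 <= 1 / sqrt 2 <= 0.7072.
Proof.
  pose proof (sqrt_lt_R0 2 ltac:(lra)) as H. pose proof (pow2_sqrt 2 ltac:(lra)) as E.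
  assert (1.4141 <= sqrt 2 <= 1.41422) by nra.
  split; apply (Rmult_le_reg_r (sqrt 2)); try easy; field_simplify; lra.
Qed.

Section Spherical.

Context (a s0 r : R) (Ha : catenoid_parameter Spherical a) (Hs0 : 0 < s0).
Context (Hsin : 0 < gsin Spherical r) (Hcos : 0 < gcos Spherical r).
Context (Hf : free_boundary_minimal_annulus Spherical r s0 (catenoid Spherical a)).

Notation rho := (rad Spherical a).
Notation drho := (drad Spherical a).
Notation c := (flux Spherical a).
Notation X0 := (prof0 Spherical a).
Notation X1 := (prof1 Spherical a).
Notation T0 := (tan0 Spherical a).
Notation T1 := (tan1 Spherical a).
Notation k := (pcurv Spherical a).
Notation ph := (phi Spherical a).

Let Hrho : forall s, 0 < rho s := rad_pos Spherical a Ha.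
Let Haxr : forall s, 0 < axr Spherical a s := axr_pos Spherical a Ha.
Let Hc : 0 < c.
Proof. apply flux_pos, Ha. Qed.
Let Drho : forall s, is_derive rho s (drho s) := derive_rad Spherical a Ha.
Let Ddrho : forall s, is_derive drho s (c ^ 2 / rho s ^ 3 - rho s).
Proof. intros s. eapply is_derive_eq; [apply derive_drad, Ha|simpl curv; ring]. Qed.

Lemma rho_sqr (s : R) : rho s ^ 2 = 1 / 2 + a * cos (2 * s).
Proof. apply (rad_sqr Spherical a Ha s). Qed.

Lemma rho_drho (s : R) : rho s * drho s = - a * sin (2 * s).
Proof. unfold drad. simpl curv. simpl gsin. pose proof (Hrho s). field. lra. Qed.

Lemma c_sqr : c ^ 2 = 1 / 4 - a ^ 2.
Proof. rewrite (flux_sqr Spherical a Ha). simpl curv. ring. Qed.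

(** For [a = 0] the surface lies on the Clifford torus and [rho] is constant, contradicting
    [drho s0 = gcot r * rho s0 > 0]. *)
Lemma a_neg : a < 0.
Proof.
  destruct (conormal_boundary Spherical r a s0 Ha Hs0 Hsin Hf) as [_ [_ E]].
  assert (P : 0 < gcot Spherical r * rho s0).
  { apply Rmult_lt_0_compat; [now apply Rdiv_lt_0_compat|apply Hrho]. }
  rewrite E in P. simpl in Ha. destruct (Req_dec a 0) as [Z|]; [|lra].
  pose proof (rho_drho s0) as Q. pose proof (Hrho s0).
  assert (- a * sin (2 * s0) = 0) by (rewrite Z; ring).
  assert (0 < rho s0 * drho s0) by now apply Rmult_lt_0_compat. lra.
Qed.

(* Sturm comparison of [X0], which stays positive, with [cos]. *)
Lemma s0_lt_half_pi : s0 < PI / 2.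
Proof.
  destruct (Rlt_or_le s0 (PI / 2)) as [|Hge]; [easy|exfalso]. pose proof PI_RGT_0.
  assert (H1 : - (rho 0 * T0 0 * cos 0 + rho 0 * X0 0 * sin 0)
             < - (rho (PI / 2) * T0 (PI / 2) * cos (PI / 2) + rho (PI / 2) * X0 (PI / 2) * sin (PI / 2))).
  { apply (derive_pos_lt (fun s => - (rho s * T0 s * cos s + rho s * X0 s * sin s))
      (fun s => X0 s * (cos s * (1 / 2 + a)) / rho s)); [lra|..].
    - intros s _. pose proof (derive_rad_tan0 Spherical a Ha s) as D1.
      pose proof (derive_prof0 Spherical a Ha s) as D2. pose proof (Hrho s).
      eapply is_derive_eq.
      + apply derive_opp, derive_plus; [apply derive_mult; [exact D1|apply is_derive_cos]|derive_R].
      + cbv beta. simpl curv.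
        assert (E : cos s * (1 / 2 + a) = rho s ^ 2 * cos s - rho s * drho s * sin s).
        { rewrite rho_sqr, rho_drho, cos_2a_cos, sin_2a.
          pose proof (sin2_cos2 s) as SC. unfold Rsqr in SC.
          transitivity (cos s * (1 / 2 + 2 * a * (sin s * sin s + cos s * cos s) - a));
            [rewrite SC|]; ring. }
        rewrite E. field. lra.
    - intros s Hs. pose proof (prof0_pos Spherical r a s0 Hf s ltac:(lra)).
      pose proof (cos_gt_0 s ltac:(lra) ltac:(lra)). simpl in Ha.
      apply Rdiv_lt_0_compat; [|apply Hrho].
      apply Rmult_lt_0_compat; [easy|]. apply Rmult_lt_0_compat; lra. }
  rewrite cos_PI2, sin_PI2, sin_0, tan0_0 in H1 by exact Ha.
  pose proof (prof0_pos Spherical r a s0 Hf (PI / 2) ltac:(lra)) as H2.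
  pose proof (Rmult_lt_0_compat _ _ (Hrho (PI / 2)) H2). lra.
Qed.

Lemma drho_pos (s : R) : 0 < s <= s0 -> 0 < drho s.
Proof.
  intros Hs. pose proof s0_lt_half_pi. pose proof a_neg. pose proof (Hrho s).
  assert (0 < rho s * drho s).
  { rewrite rho_drho. apply Rmult_lt_0_compat; [lra|]. apply sin_gt_0; lra. }
  apply (Rmult_lt_reg_l (rho s)); lra.
Qed.

Lemma drho_0 : drho 0 = 0.
Proof. apply drad_0. Qed.

(** * First modes *)

Definition mode1 (s : R) : R := k s * X1 s - nor1 Spherical a s.
Definition dmode1 (s : R) : R := 2 * k s * (T1 s - drho s / rho s * X1 s).

(* [mode1 * rho] is the normal component of a rotation about the pole. *)
Lemma derive_mode1 (s : R) : is_derive mode1 s (dmode1 s).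
Proof.
  pose proof (derive_pcurv Spherical a Ha s). pose proof (derive_prof1 Spherical a Ha s).
  pose proof (derive_nor1 Spherical a Ha s). pose proof (Hrho s).
  eapply is_derive_eq; [unfold mode1; derive_R|]. unfold dmode1. cbv beta. field. lra.
Qed.

Lemma mode1_equation (s : R) :
  is_derive (fun s => rho s ^ 3 * dmode1 s) s (- (2 * c ^ 2 / rho s) * mode1 s).
Proof.
  pose proof (derive_rad_tan1 Spherical a Ha s) as D1. pose proof (derive_prof1 Spherical a Ha s).
  pose proof (Ddrho s). pose proof (Hrho s).
  set (w := fun s => rho s * T1 s) in D1.
  apply is_derive_ext with (fun s => 2 * c * (w s - drho s * X1 s)).
  { intros t. unfold dmode1, pcurv, w. pose proof (Hrho t). field_R. lra. }
  eapply is_derive_eq; [derive_R|]. cbv beta. unfold mode1, pcurv. simpl curv.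
  pose proof (frame_expansion1 Spherical a Ha s) as E. simpl curv in E.
  replace (drho s * T1 s) with (- rho s * X1 s - c / rho s * nor1 Spherical a s) by lra.
  field. lra.
Qed.

Lemma ph_0 : ph 0 = 0.
Proof. apply phi_0, Ha. Qed.

Lemma mode1_pos (s : R) : 0 < s <= s0 -> 0 < mode1 s.
Proof.
  intros Hs. pose proof (drho_pos s Hs). pose proof (prof1_pos Spherical r a s0 Ha Hs0 Hf s Hs) as H1.
  pose proof (prof0_pos Spherical r a s0 Hf s ltac:(lra)) as H0.
  unfold mode1, nor1, pcurv. unfold prof0, prof1 in *.
  pose proof (Haxr s) as HR. pose proof (Hrho s) as Hr.
  assert (0 < gcos Spherical (ph s)) by (apply (Rmult_lt_reg_l (axr Spherical a s)); lra).
  assert (0 < gsin Spherical (ph s)) by (apply (Rmult_lt_reg_l (axr Spherical a s)); lra).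
  assert (0 < c / rho s ^ 2 * (axr Spherical a s * gsin Spherical (ph s))).
  { apply Rmult_lt_0_compat; [|easy]. apply Rdiv_lt_0_compat; [easy|now apply pow_lt]. }
  assert (0 < (curv Spherical * c * gsin Spherical (ph s) + drho s * gcos Spherical (ph s)) / axr Spherical a s).
  { apply Rdiv_lt_0_compat; [|easy]. simpl curv. rewrite Rmult_1_l.
    apply Rplus_lt_0_compat; now apply Rmult_lt_0_compat. }
  unfold Rdiv in *. lra.
Qed.

Lemma continuous_rho_cube (s : R) : continuous (fun s => rho s ^ 3) s.
Proof.
  change (continuous (fun s => rho s * rho s ^ 2) s).
  pose proof (is_derive_continuous _ _ _ (Drho s)). continuity_R.
Qed.

Lemma first_mode_half (y dy : R -> R) :
  (forall s, is_derive y s (dy s)) -> (forall s, continuous dy s) -> y 0 = 0 ->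
  0 <= RInt (fun s => rho s ^ 3 * dy s ^ 2 - 2 * c ^ 2 / rho s * y s ^ 2) 0 s0.
Proof.
  intros Dy Cdy Y0.
  destruct (conormal_boundary Spherical r a s0 Ha Hs0 Hsin Hf) as [_ [E1 E2]].
  (* The Neumann condition: [x1] and [rad] satisfy the Robin condition with the same factor
     [gcot r], so the two terms of [dmode1] cancel. *)
  assert (Z : dmode1 s0 = 0).
  { unfold dmode1. rewrite <- E1, <- E2. pose proof (Hrho s0). field. lra. }
  pose proof (picone_left (fun s => rho s ^ 3) (fun s => 2 * c ^ 2 / rho s) mode1 dmode1 y dy 0 s0)
    as P. cbv beta in P. rewrite Z in P.
  eapply Rle_trans; [|apply P; clear P; auto].
  - right. unfold Rdiv. ring.
  - apply continuous_rho_cube.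
  - intros s. pose proof (is_derive_continuous _ _ _ (Drho s)). pose proof (Hrho s).
    continuity_R. lra.
  - apply derive_mode1.
  - apply mode1_equation.
  - intros s. now apply pow_lt.
  - apply mode1_pos.
  - right. unfold dmode1, tan1, pcurv. rewrite drho_0, prof1_0, ph_0 by exact Ha.
    simpl gcos. simpl gsin. rewrite cos_0, sin_0. pose proof (Hrho 0). pose proof (Haxr 0).
    match goal with |- ?e <> 0 => replace e with (2 * c ^ 2 / (rho 0 ^ 3 * axr Spherical a 0))
      by (field; lra) end.
    apply Rgt_not_eq. apply Rdiv_lt_0_compat.
    + apply Rmult_lt_0_compat; [lra|now apply pow_lt].
    + apply Rmult_lt_0_compat; [now apply pow_lt|easy].
Qed.

(** * Rotationally invariant mode *)

Definition ell (s : R) : R := RInt (fun t => cos (2 * t) / rho t) 0 s.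

Lemma derive_ell (s : R) : is_derive ell s (cos (2 * s) / rho s).
Proof.
  apply (is_derive_primitive (fun t => cos (2 * t) / rho t)). intros t.
  pose proof (is_derive_continuous _ _ _ (Drho t)). pose proof (Hrho t). continuity_R. lra.
Qed.

Lemma ell_0 : ell 0 = 0.
Proof. apply (RInt_point (V := R_CompleteNormedModule)). Qed.

(* The even rotationally invariant Jacobi function [cos 2s - rho' ell], which up to a factor
   is the variation of the parameter [a]; [zeta] is its quotient by [rho]. *)
Definition zeta (s : R) : R := (cos (2 * s) - drho s * ell s) / rho s.
Definition wzeta (s : R) : R := - sin (2 * s) + ell s * (rho s - 2 * c ^ 2 / rho s).

Lemma derive_cos_double (s : R) : is_derive (fun s => cos (2 * s)) s (- 2 * sin (2 * s)).
Proof. eapply is_derive_eq; [derive_R|cbv beta; ring]. Qed.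

Lemma derive_sin_double (s : R) : is_derive (fun s => sin (2 * s)) s (2 * cos (2 * s)).
Proof. eapply is_derive_eq; [derive_R|cbv beta; ring]. Qed.

Lemma derive_zeta (s : R) : is_derive zeta s (wzeta s / rho s ^ 3).
Proof.
  pose proof (derive_ell s). pose proof (Ddrho s). pose proof (Drho s). pose proof (Hrho s).
  (* Naming [cos (2 * s)] makes [derive_R] treat it as an atom with the derivative given by [D]. *)
  pose proof (derive_cos_double s) as D. set (C2 := fun s => cos (2 * s)) in D.
  apply is_derive_ext with (fun s => (C2 s - drho s * ell s) / rho s); [reflexivity|].
  eapply is_derive_eq; [derive_R; lra|]. unfold wzeta, C2. cbv beta.
  assert (E3 : - 2 * sin (2 * s) * rho s ^ 2 - 2 * (rho s * drho s) * cos (2 * s) = - sin (2 * s)).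
  { rewrite rho_sqr, rho_drho. field. }
  rewrite <- E3. pose proof (spherical_drad_sqr a Ha s) as Ed.
  assert (Ed' : rho s ^ 2 * drho s ^ 2 = rho s ^ 2 - rho s ^ 4 - c ^ 2).
  { rewrite Ed. field. lra. }
  field_simplify_eq; [|lra].
  ring [Ed'].
Qed.

Lemma derive_wzeta (s : R) : is_derive wzeta s (- (rho s + 2 * c ^ 2 / rho s) * zeta s).
Proof.
  pose proof (derive_ell s). pose proof (Drho s). pose proof (Hrho s).
  pose proof (derive_sin_double s) as D. set (S2 := fun s => sin (2 * s)) in D.
  apply is_derive_ext with (fun s => - S2 s + ell s * (rho s - 2 * c ^ 2 / rho s)); [reflexivity|].
  eapply is_derive_eq; [derive_R; lra|]. unfold zeta. cbv beta. field. lra.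
Qed.

(** This is the quotient of [rho * zeta] by [drho], which is also a rotationally invariant Jacobi
    function, coming from rotations in the plane of [x0] and [x1]. Their weighted Wronskian is
    constant, so the quotient has derivative [2 a / (drho^2 rho) < 0]; hence [zeta] changes sign at
    most once. *)
Lemma zeta_ratio_decreasing (x y : R) : 0 < x < y -> y <= s0 ->
  cos (2 * y) / drho y - ell y < cos (2 * x) / drho x - ell x.
Proof.
  intros Hx Hy. pose proof a_neg.
  assert (H1 : - (cos (2 * x) / drho x - ell x) < - (cos (2 * y) / drho y - ell y)).
  { apply (derive_pos_lt (fun s => - (cos (2 * s) / drho s - ell s))
      (fun s => - 2 * a / (drho s ^ 2 * rho s))); [lra|..].
    - intros s Hs. pose proof (drho_pos s ltac:(lra)) as Hd. pose proof (Hrho s).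
      pose proof (derive_ell s). pose proof (Ddrho s).
      pose proof (derive_cos_double s) as D. set (C2 := fun s => cos (2 * s)) in D.
      apply is_derive_ext with (fun s => - (C2 s / drho s - ell s)); [reflexivity|].
      eapply is_derive_eq; [derive_R; lra|]. unfold C2. cbv beta.
      pose proof (sin2_cos2 (2 * s)) as SC. unfold Rsqr in SC.
      assert (E : - 2 * a = 2 * sin (2 * s) * (rho s * drho s)
         + cos (2 * s) * (1 - 2 * rho s ^ 2)).
      { rewrite rho_sqr, rho_drho.
        transitivity (- 2 * a * (sin (2 * s) * sin (2 * s) + cos (2 * s) * cos (2 * s)));
          [rewrite SC|]; field. }
      rewrite E. pose proof (spherical_drad_sqr a Ha s) as Ed.
      assert (Ec : c ^ 2 = rho s ^ 2 - rho s ^ 4 - rho s ^ 2 * drho s ^ 2).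
      { rewrite Ed. field. lra. }
      rewrite Ec. field. lra.
    - intros s Hs. pose proof (drho_pos s ltac:(lra)). pose proof (Hrho s).
      apply Rdiv_lt_0_compat; [lra|]. apply Rmult_lt_0_compat; [now apply pow_lt|easy]. }
  lra.
Qed.

Lemma zeta_ratio (s : R) : 0 < s <= s0 ->
  zeta s = drho s / rho s * (cos (2 * s) / drho s - ell s).
Proof.
  intros Hs. pose proof (drho_pos s Hs). pose proof (Hrho s). unfold zeta. field. lra.
Qed.

Lemma zeta_sign_pos (x y : R) : 0 <= x < y -> y <= s0 -> 0 <= zeta y -> 0 < zeta x.
Proof.
  intros Hx Hy Hz. destruct (Req_dec x 0) as [->|Hx0].
  - unfold zeta. rewrite drho_0, Rmult_0_r, cos_0. pose proof (Hrho 0).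
    replace ((1 - 0 * ell 0) / rho 0) with (/ rho 0) by (field; lra). now apply Rinv_0_lt_compat.
  - rewrite zeta_ratio in Hz by lra. rewrite zeta_ratio by lra.
    pose proof (zeta_ratio_decreasing x y ltac:(lra) Hy).
    pose proof (Rdiv_lt_0_compat _ _ (drho_pos x ltac:(lra)) (Hrho x)).
    pose proof (Rdiv_lt_0_compat _ _ (drho_pos y ltac:(lra)) (Hrho y)).
    apply Rmult_lt_0_compat; [easy|].
    assert (0 <= cos (2 * y) / drho y - ell y) by (apply (Rmult_le_reg_l (drho y / rho y)); lra).
    lra.
Qed.

Lemma zeta_sign_neg (x y : R) : 0 < x < y -> y <= s0 -> zeta x = 0 -> zeta y < 0.
Proof.
  intros Hx Hy Hz. destruct (Rlt_or_le (zeta y) 0) as [|Hn]; [easy|].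
  pose proof (zeta_sign_pos x y ltac:(lra) Hy Hn). lra.
Qed.

(** Picone's identity admits only a simple zero at its endpoint. A double zero would annihilate the
    Wronskian of [zeta] with [drho / rho], a nonzero multiple of [a]. *)
Lemma wzeta_zero_of_zeta (s : R) : 0 < s <= s0 -> zeta s = 0 -> wzeta s / rho s ^ 3 <> 0.
Proof.
  intros Hs Hz Hw. pose proof (Hrho s) as Hr. pose proof (drho_pos s Hs) as Hd. pose proof a_neg.
  assert (W0 : wzeta s = 0).
  { replace (wzeta s) with (wzeta s / rho s ^ 3 * rho s ^ 3) by (field; lra). rewrite Hw. ring. }
  assert (Z0 : cos (2 * s) = drho s * ell s).
  { replace (cos (2 * s)) with (zeta s * rho s + drho s * ell s) by (unfold zeta; field; lra).
    rewrite Hz. ring. }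
  unfold wzeta in W0. pose proof (spherical_drad_sqr a Ha s) as Ed.
  pose proof (sin2_cos2 (2 * s)) as SC. unfold Rsqr in SC.
  pose proof (rho_sqr s) as E1. pose proof (rho_drho s) as E2. pose proof c_sqr as E3.
  (* [drho * sin 2s = cos 2s * (rho - 2 c^2 / rho)], i.e. [-2a = 0] after clearing denominators *)
  assert (Q : drho s * sin (2 * s) = cos (2 * s) * (rho s - 2 * c ^ 2 / rho s)).
  { rewrite Z0. transitivity (drho s * (ell s * (rho s - 2 * c ^ 2 / rho s))); [|ring]. f_equal. lra. }
  assert (Q2 : (rho s * drho s) * sin (2 * s) = cos (2 * s) * (rho s ^ 2 - 2 * c ^ 2)).
  { transitivity (rho s * (drho s * sin (2 * s))); [ring|]. rewrite Q. field. lra. }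
  rewrite E1, E2, E3 in Q2. simpl in Ha.
  pose proof (COS_bound (2 * s)). nra.
Qed.

(** * Estimates from the free boundary condition *)

(** The derivative [- k * T0] is nonnegative and [nor0] vanishes at [s0]. All bounds on [drho] below
    rest on this. *)
Lemma nor0_nonpos (s : R) : 0 <= s <= s0 -> nor0 Spherical a s <= 0.
Proof.
  intros Hs. rewrite <- (nor0_boundary Spherical r a s0 Ha Hs0 Hsin Hf).
  apply (derive_nonneg_le (nor0 Spherical a) (fun s => - k s * T0 s)); [lra|..].
  - intros x _. now apply derive_nor0.
  - intros x Hx.
    assert (0 <= k x) by (apply Rdiv_le_0_compat; [lra|now apply pow_lt]).
    assert (T0 x <= 0).
    { destruct (Req_dec x 0) as [->|]; [rewrite tan0_0 by exact Ha; lra|].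
      pose proof (tan0_sign Spherical r a s0 Ha Hs0 Hf x ltac:(lra)) as HT. simpl curv in HT. lra. }
    replace (- k x * T0 x) with (k x * - T0 x) by ring. apply Rmult_le_pos; lra.
Qed.

(** In [ph' = c / (axr^2 rho)] the denominator is [(1 - q^2) q] with [q = rho], at most
    [2 / (3 sqrt 3) < 0.386]; and 2.59 is just below [1 / 0.386]. *)
Lemma ph_lower_bound (s : R) : 0 <= s -> 2.59 * c * s <= ph s.
Proof.
  intros Hs.
  assert (H : ph 0 - 2.59 * c * 0 <= ph s - 2.59 * c * s).
  { apply (derive_nonneg_le (fun s => ph s - 2.59 * c * s)
      (fun s => c / (axr Spherical a s ^ 2 * rho s) - 2.59 * c)); [lra|..].
    - intros x _. pose proof (derive_phi Spherical a Ha x).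
      eapply is_derive_eq; [derive_R|cbv beta; ring].
    - intros x _. pose proof (Hrho x) as Hr. pose proof (pow_lt _ 2 (Haxr x)) as HR.
      assert (Hprod : 0 < axr Spherical a x ^ 2 * rho x) by now apply Rmult_lt_0_compat.
      assert (Hle : axr Spherical a x ^ 2 * rho x <= 0.386).
      { pose proof (axr_sqr Spherical a Ha x) as E. simpl curv in E. rewrite E in HR. rewrite E.
        set (q := rho x) in *. assert (q <= 1) by nra.
        (* The cubic with a double root near the maximiser [1 / sqrt 3] of [q - q^3]. *)
        assert (0 <= (q - 0.577) ^ 2 * (q + 1.154)).
        { apply Rmult_le_pos; [apply pow2_ge_0|lra]. }
        lra. }
      replace (c / (axr Spherical a x ^ 2 * rho x) - 2.59 * c)
        with (c * (1 - 2.59 * (axr Spherical a x ^ 2 * rho x)) / (axr Spherical a x ^ 2 * rho x))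
        by (pose proof (Haxr x); field; lra).
      apply Rdiv_le_0_compat; [|easy]. apply Rmult_le_pos; lra. }
  rewrite ph_0 in H. lra.
Qed.

Lemma ell_le_ph (s : R) : 0 <= s -> c * ell s <= ph s.
Proof.
  intros Hs.
  assert (H : ph 0 - c * ell 0 <= ph s - c * ell s).
  { apply (derive_nonneg_le (fun s => ph s - c * ell s)
      (fun s => c * (1 - axr Spherical a s ^ 2 * cos (2 * s)) / (axr Spherical a s ^ 2 * rho s)));
      [lra|..].
    - intros x _. pose proof (derive_phi Spherical a Ha x). pose proof (derive_ell x).
      pose proof (Hrho x). pose proof (Haxr x).
      eapply is_derive_eq; [derive_R|cbv beta; field; lra].
    - intros x _. pose proof (Hrho x) as Hr. pose proof (pow_lt _ 2 (Haxr x)) as HR.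
      apply Rdiv_le_0_compat; [|now apply Rmult_lt_0_compat].
      pose proof (axr_sqr Spherical a Ha x) as E. simpl curv in E.
      pose proof (COS_bound (2 * x)). apply Rmult_le_pos; [lra|].
      pose proof (pow2_ge_0 (rho x)). nra. }
  rewrite ph_0, ell_0 in H. lra.
Qed.

(** Since [x0 > 0], the cosine of [ph] never vanishes, so [ph], which starts at 0, cannot cross
    [PI / 2]. *)
Lemma ph_range (s : R) : 0 < s <= s0 -> 0 < ph s <= PI / 2 /\ 0 < cos (ph s) /\ 0 < sin (ph s).
Proof.
  intros Hs. pose proof PI_RGT_0.
  assert (Hcs : forall x, 0 <= x <= s0 -> 0 < cos (ph x)).
  { intros x Hx. pose proof (prof0_pos Spherical r a s0 Hf x ltac:(lra)) as P.
    unfold prof0 in P. pose proof (Haxr x). change (gcos Spherical (ph x)) with (cos (ph x)) in P.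
    apply (Rmult_lt_reg_l (axr Spherical a x)); lra. }
  assert (H0 : 0 < ph s).
  { pose proof (ph_lower_bound s ltac:(lra)).
    assert (0 < 2.59 * c * s) by (apply Rmult_lt_0_compat; lra). lra. }
  assert (H1 : ph s <= PI / 2).
  { destruct (Rle_or_lt (ph s) (PI / 2)) as [|Hgt]; [easy|exfalso].
    destruct (IVT_gen ph 0 s (PI / 2)) as [x [Hx Hxe]].
    - intros x. apply continuity_pt_filterlim.
      apply (is_derive_continuous _ _ _ (derive_phi Spherical a Ha x)).
    - rewrite ph_0, Rmin_left, Rmax_right; lra.
    - rewrite Rmin_left, Rmax_right in Hx by lra.
      pose proof (Hcs x ltac:(lra)) as Q. rewrite Hxe, cos_PI2 in Q. lra. }
  repeat split; try easy; [apply Hcs; lra|]. apply sin_gt_0; lra.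
Qed.

(* [nor0 <= 0] says [drho * tan ph <= c]. *)
Lemma drho_sin_ph (s : R) : 0 < s <= s0 -> drho s * sin (ph s) <= c * cos (ph s).
Proof.
  intros Hs. pose proof (nor0_nonpos s ltac:(lra)) as H. pose proof (Haxr s) as HR.
  assert (E : drho s * sin (ph s) - c * cos (ph s) = nor0 Spherical a s * axr Spherical a s).
  { unfold nor0. change (curv Spherical) with 1.
    change (gsin Spherical (ph s)) with (sin (ph s)).
    change (gcos Spherical (ph s)) with (cos (ph s)). field. lra. }
  assert (0 <= - nor0 Spherical a s * axr Spherical a s) by (apply Rmult_le_pos; lra). lra.
Qed.

(** Combines [drho <= c cot (ph) <= c / ph] with [c * ell <= ph]. *)
Lemma drho_ell (s : R) : 0 < s <= s0 -> drho s * ell s <= 1.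
Proof.
  intros Hs. destruct (ph_range s Hs) as [Hp [HC HS]]. pose proof PI_RGT_0.
  pose proof (drho_sin_ph s Hs). pose proof (x_cos_le_sin (ph s) ltac:(lra)).
  pose proof (drho_pos s Hs). pose proof (ell_le_ph s ltac:(lra)).
  assert (drho s * ph s <= c).
  { apply (Rmult_le_reg_r (cos (ph s))); [easy|].
    assert (drho s * (ph s * cos (ph s)) <= drho s * sin (ph s)) by (apply Rmult_le_compat_l; lra).
    lra. }
  assert (drho s * (c * ell s) <= drho s * ph s) by (apply Rmult_le_compat_l; lra).
  apply (Rmult_le_reg_l c); [easy|]. lra.
Qed.

(** From [drho <= c cot (ph) <= c (1 / ph - ph / 3)], where the last expression decreases in [ph],
    evaluated at the lower bound [2.59 c s] and cleared of denominators. *)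
Lemma drho_bound (s : R) : 0 < s <= s0 ->
  3 * (2.59 * s) * drho s + c ^ 2 * (2.59 * s) ^ 2 <= 3.
Proof.
  intros Hs. destruct (ph_range s Hs) as [Hp [HC HS]]. pose proof PI_RGT_0.
  pose proof (drho_sin_ph s Hs) as H1. pose proof (pade_cotangent (ph s) ltac:(lra)) as H2.
  pose proof (drho_pos s Hs) as Hd. pose proof (ph_lower_bound s ltac:(lra)) as H3.
  assert (Hq : 0 < 3 - ph s ^ 2).
  { destruct (Rlt_or_le 0 (3 - ph s ^ 2)) as [|Hn]; [easy|].
    assert (0 < ph s * cos (ph s)) by (apply Rmult_lt_0_compat; lra).
    assert ((3 - ph s ^ 2) * sin (ph s) <= 0) by nra. lra. }
  assert (H4 : drho s * (3 * ph s) <= c * (3 - ph s ^ 2)).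
  { apply (Rmult_le_reg_r (cos (ph s))); [easy|].
    assert (drho s * (3 * ph s * cos (ph s)) <= drho s * ((3 - ph s ^ 2) * sin (ph s)))
      by (apply Rmult_le_compat_l; lra).
    assert ((3 - ph s ^ 2) * (drho s * sin (ph s)) <= (3 - ph s ^ 2) * (c * cos (ph s)))
      by (apply Rmult_le_compat_l; lra).
    lra. }
  set (q := 2.59 * c * s) in *.
  assert (0 < q) by (unfold q; apply Rmult_lt_0_compat; lra).
  assert (drho s * (3 * q) <= drho s * (3 * ph s)) by (apply Rmult_le_compat_l; lra).
  assert (c * (3 - ph s ^ 2) <= c * (3 - q ^ 2)) by (apply Rmult_le_compat_l; nra).
  apply (Rmult_le_reg_l c); [easy|].
  transitivity (drho s * (3 * q) + c * q ^ 2); [right; unfold q; ring|]. lra.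
Qed.

Lemma rho_ge_rho_0 (s : R) : rho 0 <= rho s.
Proof.
  pose proof a_neg. pose proof (Hrho 0). pose proof (Hrho s).
  assert (rho 0 ^ 2 <= rho s ^ 2).
  { rewrite !rho_sqr, Rmult_0_r, cos_0. pose proof (COS_bound (2 * s)). nra. }
  nra.
Qed.

(** Up to [PI / 4] the integrand is at most [cos (2 t) / rho 0], whose integral is [1 / (2 rho 0)];
    beyond [PI / 4] it is nonpositive. *)
Lemma ell_upper_bound (s : R) : PI / 4 <= s <= PI / 2 -> 2 * rho 0 * ell s <= 1.
Proof.
  intros Hs. pose proof PI_RGT_0. pose proof (Hrho 0) as H0.
  assert (H1 : sin (2 * 0) - 2 * rho 0 * ell 0
            <= sin (2 * (PI / 4)) - 2 * rho 0 * ell (PI / 4)).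
  { apply (derive_nonneg_le (fun s => sin (2 * s) - 2 * rho 0 * ell s)
      (fun s => 2 * cos (2 * s) * (rho s - rho 0) / rho s)); [lra|..].
    - intros x _. pose proof (Hrho x). pose proof (derive_ell x).
      eapply is_derive_eq; [derive_R|cbv beta; field; lra].
    - intros x Hx. pose proof (Hrho x). pose proof (rho_ge_rho_0 x).
      apply Rdiv_le_0_compat; [|easy]. apply Rmult_le_pos; [|lra].
      apply Rmult_le_pos; [lra|]. apply cos_ge_0; lra. }
  assert (H2 : - ell (PI / 4) <= - ell s).
  { apply (derive_nonneg_le (fun s => - ell s) (fun s => - cos (2 * s) / rho s)); [lra|..].
    - intros x _. pose proof (derive_ell x).
      eapply is_derive_eq; [derive_R|unfold Rdiv; ring].
    - intros x Hx. apply Rdiv_le_0_compat; [|apply Hrho].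
      pose proof (cos_le_0 (2 * x) ltac:(lra) ltac:(lra)). lra. }
  replace (2 * (PI / 4)) with (PI / 2) in H1 by field.
  rewrite Rmult_0_r, sin_0, sin_PI2, ell_0 in H1.
  assert (2 * rho 0 * ell s <= 2 * rho 0 * ell (PI / 4)) by (apply Rmult_le_compat_l; lra). lra.
Qed.

Lemma ell_nonneg (s : R) : 0 <= s <= PI / 4 -> 0 <= ell s.
Proof.
  intros Hs. rewrite <- ell_0.
  apply (derive_nonneg_le ell (fun s => cos (2 * s) / rho s)); [lra|..].
  - intros x _. apply derive_ell.
  - intros x Hx. apply Rdiv_le_0_compat; [|apply Hrho]. apply cos_ge_0; lra.
Qed.

(** A long annulus forces [a] to be small: at [PI / 4], where [rho^2 = 1/2] and [rho * drho = - a],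
    [drho_bound] becomes a quadratic inequality in [a]. *)
Lemma neck_bound : PI / 4 <= s0 -> - a <= 0.27.
Proof.
  intros Hs. pose proof PI_lower_bound. pose proof a_neg.
  pose proof (drho_bound (PI / 4) ltac:(lra)) as B. pose proof (drho_pos (PI / 4) ltac:(lra)) as Hd.
  pose proof (rho_sqr (PI / 4)) as E1. pose proof (rho_drho (PI / 4)) as E2.
  pose proof (Hrho (PI / 4)) as Hr.
  replace (2 * (PI / 4)) with (PI / 2) in E1, E2 by field.
  rewrite cos_PI2 in E1. rewrite sin_PI2 in E2. pose proof c_sqr as Ec.
  set (d := drho (PI / 4)) in *. set (q := rho (PI / 4)) in *.
  assert (q <= 0.7072) by nra.
  assert (- a <= 0.7072 * d) by nra.
  (* The value 0.78 is [3.12 / 4], a lower bound for [PI / 4]. *)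
  assert (3 * (2.59 * 0.78) * d <= 3 * (2.59 * (PI / 4)) * d) by (apply Rmult_le_compat_r; lra).
  assert (0 <= c ^ 2) by apply pow2_ge_0.
  assert (c ^ 2 * (2.59 * 0.78) ^ 2 <= c ^ 2 * (2.59 * (PI / 4)) ^ 2).
  { apply Rmult_le_compat_l; [easy|]. apply pow_incr. lra. }
  simpl in Ha. destruct (Rle_or_lt (- a) 0.27) as [|Hn]; [easy|exfalso]. nra.
Qed.

(** The same argument at [3 PI / 8], with 1.17 a lower bound for this point. *)
Lemma neck_bound_far : 3 * (PI / 8) <= s0 -> - a <= 0.11.
Proof.
  intros Hs. pose proof PI_lower_bound. pose proof a_neg.
  pose proof (neck_bound ltac:(lra)) as Hb.
  pose proof (drho_bound (3 * (PI / 8)) ltac:(lra)) as B.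
  pose proof (drho_pos (3 * (PI / 8)) ltac:(lra)) as Hd.
  pose proof (rho_sqr (3 * (PI / 8))) as E1. pose proof (rho_drho (3 * (PI / 8))) as E2.
  pose proof (Hrho (3 * (PI / 8))) as Hr.
  replace (2 * (3 * (PI / 8))) with (3 * (PI / 4)) in E1, E2 by field.
  rewrite cos_3PI4 in E1. rewrite sin_3PI4 in E2. pose proof c_sqr as Ec.
  pose proof inv_sqrt2_bounds as Hw.
  replace (-1 / sqrt 2) with (- (1 / sqrt 2)) in E1 by (unfold Rdiv; ring).
  set (v := 1 / sqrt 2) in *. clearbody v.
  set (d := drho (3 * (PI / 8))) in *. set (q := rho (3 * (PI / 8))) in *.
  assert (q ^ 2 <= 0.691) by nra.
  assert (q <= 0.8313) by nra.
  assert (- a * 0.7071 <= 0.8313 * d) by nra.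
  assert (3 * (2.59 * 1.17) * d <= 3 * (2.59 * (3 * (PI / 8))) * d) by (apply Rmult_le_compat_r; lra).
  assert (0 <= c ^ 2) by apply pow2_ge_0.
  assert (c ^ 2 * (2.59 * 1.17) ^ 2 <= c ^ 2 * (2.59 * (3 * (PI / 8))) ^ 2).
  { apply Rmult_le_compat_l; [easy|]. apply pow_incr. lra. }
  destruct (Rle_or_lt (- a) 0.11) as [|Hn]; [easy|exfalso]. nra.
Qed.

(* The quotient [zeta'/zeta] has the right sign at the boundary: the second eigenvalue of the
   rotationally invariant even functions is nonnegative. *)
Lemma wzeta_boundary : wzeta s0 <= 0.
Proof.
  pose proof PI_lower_bound as HPI. pose proof a_neg as Hneg. pose proof s0_lt_half_pi as Hlt.
  pose proof (Hrho s0) as Hr. pose proof (rho_sqr s0) as E1. pose proof (rho_drho s0) as E2.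
  pose proof c_sqr as Ec. simpl in Ha.
  (* The claim multiplied by [rho s0]. Below, its left side is rewritten as [ell s0] times
     [- a (- 2 a - cos (2 s0))]. *)
  assert (Goal' : ell s0 * (rho s0 ^ 2 - 2 * c ^ 2) <= rho s0 * sin (2 * s0)).
  2: { unfold wzeta. apply (Rmult_le_reg_l (rho s0)); [easy|].
       replace (rho s0 * (- sin (2 * s0) + ell s0 * (rho s0 - 2 * c ^ 2 / rho s0)))
         with (ell s0 * (rho s0 ^ 2 - 2 * c ^ 2) - rho s0 * sin (2 * s0)) by (field; lra). lra. }
  assert (Hsin2 : 0 < sin (2 * s0)) by (apply sin_gt_0; lra).
  replace (rho s0 ^ 2 - 2 * c ^ 2) with (- a * (- 2 * a - cos (2 * s0))) by (rewrite E1, Ec; field).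
  set (y := cos (2 * s0)) in *. set (S2 := sin (2 * s0)) in *.
  pose proof (sin2_cos2 (2 * s0)) as SC. unfold Rsqr in SC. fold S2 y in SC.
  destruct (Rle_or_lt s0 (PI / 4)) as [H4|H4].
  - pose proof (ell_nonneg s0 ltac:(lra)) as Hl.
    assert (Hy : 0 <= y <= 1) by (split; [apply cos_ge_0; lra|apply COS_bound]).
    destruct (Rle_or_lt (- 2 * a - y) 0) as [Hz|Hz].
    + assert (0 < rho s0 * S2) by now apply Rmult_lt_0_compat.
      assert (0 <= ell s0 * (- a * - (- 2 * a - y))).
      { apply Rmult_le_pos; [easy|]. apply Rmult_le_pos; lra. }
      lra.
    (* With [drho * ell <= 1] the claim reduces to [- 2 a - y <= S2^2], which holds because
       [- 2 a < 1] and [y^2 <= y]. *)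
    + pose proof (drho_ell s0 ltac:(lra)) as Hx.
      assert (Hx' : - a * S2 * ell s0 <= rho s0).
      { rewrite <- E2. assert (rho s0 * (drho s0 * ell s0) <= rho s0 * 1) by (apply Rmult_le_compat_l; lra).
        lra. }
      assert (Hyy : - 2 * a - y <= S2 * S2) by nra.
      apply (Rmult_le_reg_l S2); [easy|].
      assert ((- a * S2 * ell s0) * (- 2 * a - y) <= rho s0 * (- 2 * a - y))
        by (apply Rmult_le_compat_r; lra).
      assert (rho s0 * (- 2 * a - y) <= rho s0 * (S2 * S2)) by (apply Rmult_le_compat_l; lra).
      lra.
  (* Beyond [PI / 4] both sides are estimated by constants; a second cut at [3 PI / 8] is made
     because [sin (2 s0)] becomes small near [PI / 2]. *)
  - pose proof (neck_bound ltac:(lra)) as Hb. pose proof (ell_upper_bound s0 ltac:(lra)) as Hl.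
    pose proof (rho_sqr 0) as E0. rewrite Rmult_0_r, cos_0 in E0. pose proof (Hrho 0) as Hr0.
    assert (Hy : -1 <= y <= 0).
    { split; [apply COS_bound|apply cos_le_0; lra]. }
    assert (Hr7 : 0.7071 <= rho s0) by nra.
    assert (HB : 0 <= - a * (- 2 * a - y)) by (apply Rmult_le_pos; lra).
    destruct (Rle_or_lt s0 (3 * (PI / 8))) as [H8|H8].
    + assert (Hw : 0.7071 <= S2 /\ - 0.7072 <= y).
      { pose proof inv_sqrt2_bounds as Hw. split.
        - apply Rle_trans with (1 / sqrt 2); [easy|]. rewrite <- sin_3PI4.
          apply sin_decr_1; lra.
        - apply Rle_trans with (-1 / sqrt 2).
          + replace (-1 / sqrt 2) with (- (1 / sqrt 2)) by (unfold Rdiv; ring). lra.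
          + rewrite <- cos_3PI4. apply cos_decr_1; lra. }
      assert (0.479 <= rho 0) by nra.
      assert (ell s0 <= 1.044).
      { destruct (Rle_or_lt (ell s0) 1.044) as [|Hn]; [easy|exfalso]. nra. }
      assert (ell s0 * (- a * (- 2 * a - y)) <= 1.044 * (- a * (- 2 * a - y)))
        by (apply Rmult_le_compat_r; lra).
      assert (- a * (- 2 * a - y) <= 0.27 * (0.54 + 0.7072)) by (apply Rmult_le_compat; lra).
      assert (0.7071 * 0.7071 <= rho s0 * S2) by (apply Rmult_le_compat; lra).
      lra.
    + pose proof (neck_bound_far ltac:(lra)) as Hb'.
      assert (0.6244 <= rho 0) by nra.
      assert (ell s0 <= 0.801).
      { destruct (Rle_or_lt (ell s0) 0.801) as [|Hn]; [easy|exfalso]. nra. }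
      assert (ell s0 * (- a * (- 2 * a - y)) <= 0.801 * (- a * (- 2 * a - y)))
        by (apply Rmult_le_compat_r; lra).
      assert (- a * (- 2 * a - y) <= 0.11 * (0.22 + 1)) by (apply Rmult_le_compat; lra).
      (* The term [c^2 (2.59 s0)^2 <= 3] of [drho_bound], with [c^2 = 1/4 - a^2], keeps [s0] away
         from [PI / 2]. *)
      assert (Hs : s0 <= 1.3712).
      { pose proof (drho_bound s0 ltac:(lra)) as B. pose proof (drho_pos s0 ltac:(lra)).
        assert (0 <= 3 * (2.59 * s0) * drho s0) by (apply Rmult_le_pos; lra).
        assert (0.2379 <= c ^ 2) by nra.
        assert (0.2379 * (2.59 * s0) ^ 2 <= c ^ 2 * (2.59 * s0) ^ 2)
          by (apply Rmult_le_compat_r; [apply pow2_ge_0|easy]).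
        nra. }
      (* Here [PI - 2 s0] is at least [3.12 - 2 * 1.3712 = 0.3776] and at most [PI / 4], and
         [sin x >= x cos x]. *)
      assert (HS2 : 0.26 <= S2).
      { unfold S2. replace (2 * s0) with (PI - (PI - 2 * s0)) by ring. rewrite sin_PI_x.
        pose proof (x_cos_le_sin (PI - 2 * s0) ltac:(lra)) as Hx.
        assert (Hq : 0.7 <= cos (PI - 2 * s0)).
        { apply Rle_trans with (cos (PI / 4)).
          - rewrite cos_PI4. pose proof inv_sqrt2_bounds. lra.
          - apply cos_decr_1; lra. }
        assert (0.3776 * 0.7 <= (PI - 2 * s0) * cos (PI - 2 * s0)) by (apply Rmult_le_compat; lra).
        lra. }
      assert (0.7071 * 0.26 <= rho s0 * S2) by (apply Rmult_le_compat; lra).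
      lra.
Qed.

(** The point [sigma] is independent of [y], so that [y sigma = 0] is one linear condition. Up to
    [sigma] the comparison function is [zeta], whose derivative vanishes at 0; beyond [sigma] it is
    [- zeta]. *)
Lemma zero_mode_half :
  exists sigma, 0 < sigma <= s0 /\
  forall y dy : R -> R,
  (forall s, is_derive y s (dy s)) -> (forall s, continuous dy s) -> y sigma = 0 ->
  0 <= RInt (fun s => rho s ^ 3 * dy s ^ 2 - (rho s + 2 * c ^ 2 / rho s) * y s ^ 2) 0 s0.
Proof.
  assert (Cr : forall s, continuous rho s) by (intros s; apply (is_derive_continuous _ _ _ (Drho s))).
  assert (Cz : forall s, continuous zeta s) by (intros s; apply (is_derive_continuous _ _ _ (derive_zeta s))).
  assert (Cq : forall s, continuous (fun s => rho s + 2 * c ^ 2 / rho s) s).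
  { intros s. pose proof (Hrho s). continuity_R. lra. }
  assert (W0 : wzeta 0 / rho 0 ^ 3 = 0).
  { unfold wzeta. rewrite Rmult_0_r, sin_0, ell_0. unfold Rdiv. ring. }
  assert (Deq : forall s, is_derive (fun t => rho t ^ 3 * (wzeta t / rho t ^ 3)) s
      (- (rho s + 2 * c ^ 2 / rho s) * zeta s)).
  { intros s. apply is_derive_ext with wzeta; [|apply derive_wzeta].
    intros t. pose proof (Hrho t). field_R. lra. }
  assert (Hp3 : forall s, 0 < rho s ^ 3) by (intros s; now apply pow_lt).
  assert (Inner : forall sigma, 0 < sigma <= s0 -> (forall s, 0 <= s < sigma -> 0 < zeta s) ->
    forall y dy : R -> R, (forall s, is_derive y s (dy s)) -> (forall s, continuous dy s) ->
    y sigma = 0 ->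
    0 <= RInt (fun s => rho s ^ 3 * dy s ^ 2 - (rho s + 2 * c ^ 2 / rho s) * y s ^ 2) 0 sigma).
  { intros sigma Hsig Hpos y dy Dy Cdy Y0.
    pose proof (picone_right (fun s => rho s ^ 3) (fun s => rho s + 2 * c ^ 2 / rho s) zeta
      (fun s => wzeta s / rho s ^ 3) y dy 0 sigma) as P. cbv beta in P. rewrite W0 in P.
    eapply Rle_trans; [|apply P; clear P; auto].
    - right. unfold Rdiv. ring.
    - lra.
    - apply continuous_rho_cube.
    - apply derive_zeta.
    - destruct (Req_dec (zeta sigma) 0) as [Z|]; [right|now left].
      now apply wzeta_zero_of_zeta. }
  destruct (Rlt_or_le (zeta s0) 0) as [Hneg|Hpos].
  - assert (Hz0 : 0 < zeta 0).
    { unfold zeta. rewrite drho_0, Rmult_0_r, cos_0. pose proof (Hrho 0).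
      replace ((1 - 0 * ell 0) / rho 0) with (/ rho 0) by (field; lra). now apply Rinv_0_lt_compat. }
    destruct (IVT_gen zeta 0 s0 0) as [sigma [Hsig Hzs]].
    { intros x. apply continuity_pt_filterlim, Cz. }
    { rewrite Rmin_right, Rmax_left by lra. lra. }
    rewrite Rmin_left, Rmax_right in Hsig by lra.
    assert (Hs : 0 < sigma < s0).
    { split; apply Rnot_le_lt; intros Hn.
      - replace sigma with 0 in Hzs by lra. lra.
      - replace sigma with s0 in Hzs by lra. lra. }
    exists sigma. split; [lra|]. intros y dy Dy Cdy Y0.
    assert (Cy : forall s, continuous y s) by (intros s; apply (is_derive_continuous _ _ _ (Dy s))).
    set (I := fun s => rho s ^ 3 * dy s ^ 2 - (rho s + 2 * c ^ 2 / rho s) * y s ^ 2).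
    assert (CI : forall s, continuous I s).
    { intros s. apply continuous_Rminus.
      - apply (continuous_Rmult (fun s => rho s ^ 3)); [apply continuous_rho_cube|continuity_R].
      - apply (continuous_Rmult (fun s => rho s + 2 * c ^ 2 / rho s)); [apply Cq|continuity_R]. }
    rewrite (RInt_Chasles_R _ 0 sigma s0 CI). apply Rplus_le_le_0_compat.
    + apply Inner; auto; [lra|]. intros s Hs'. apply (zeta_sign_pos s sigma); lra.
    (* On this piece the boundary term at [s0] is nonnegative by [wzeta_boundary]. *)
    + pose proof (picone_left (fun s => rho s ^ 3) (fun s => rho s + 2 * c ^ 2 / rho s)
        (fun s => - zeta s) (fun s => - (wzeta s / rho s ^ 3)) y dy sigma s0) as P. cbv beta in P.
      eapply Rle_trans; [|apply P; clear P; auto].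
      * apply Rmult_le_pos; [|apply pow2_ge_0]. pose proof wzeta_boundary. pose proof (Hrho s0).
        replace (rho s0 ^ 3 * - (wzeta s0 / rho s0 ^ 3) / - zeta s0)
          with (- wzeta s0 / - zeta s0) by (field; lra).
        apply Rdiv_le_0_compat; lra.
      * lra.
      * apply continuous_rho_cube.
      * intros s. apply derive_opp, derive_zeta.
      * intros s. apply is_derive_ext with (fun t => - (rho t ^ 3 * (wzeta t / rho t ^ 3))).
        { intros t. ring_R. }
        eapply is_derive_eq; [apply derive_opp, Deq|ring].
      * intros s Hs'. pose proof (zeta_sign_neg sigma s ltac:(lra) ltac:(lra) Hzs). lra.
      * right. pose proof (wzeta_zero_of_zeta sigma ltac:(lra) Hzs). lra.
  (* Here [zeta] is positive before [s0], and the condition on [y] is imposed at the boundary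
     itself. *)
  - exists s0. split; [lra|]. apply Inner; [lra|].
    intros s Hs. apply (zeta_sign_pos s s0); lra.
Qed.

(** * Upper bound *)

(** The weights are even, so the half-interval inequality applies to [y] and to its reflection; this
    is why the mean needs a condition at both [sigma] and [- sigma]. *)
Lemma fourier_form_nonneg (q y : R -> R) (sigma : R) :
  (forall s, continuous q s) -> (forall s, q (- s) = q s) ->
  (forall y dy : R -> R, (forall s, is_derive y s (dy s)) -> (forall s, continuous dy s) ->
     y sigma = 0 -> 0 <= RInt (fun s => rho s ^ 3 * dy s ^ 2 - q s * y s ^ 2) 0 s0) ->
  (forall s, ex_derive y s) -> (forall s, continuous (Derive y) s) ->
  y sigma = 0 -> y (- sigma) = 0 ->
  0 <= fourier_form a q s0 y.
Proof.
  intros Cq Eq Half Ey Cdy Y1 Y2.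
  assert (Dy : forall s, is_derive y s (Derive y s)) by (intros s; apply Derive_correct, Ey).
  assert (Cy : forall s, continuous y s) by (intros s; apply (is_derive_continuous _ _ _ (Dy s))).
  unfold fourier_form.
  set (I := fun s => rho s ^ 3 * Derive y s ^ 2 - q s * y s ^ 2).
  assert (CI : forall s, continuous I s).
  { intros s. apply continuous_Rminus; [|continuity_R].
    apply (continuous_Rmult (fun s => rho s ^ 3)); [apply continuous_rho_cube|continuity_R]. }
  change (0 <= RInt I (- s0) s0).
  rewrite (RInt_Chasles_R I (- s0) 0 s0 CI). apply Rplus_le_le_0_compat; [|now apply Half].
  rewrite <- (RInt_reflect I (- s0) 0 CI), Ropp_0, Ropp_involutive.
  pose proof (Half (fun s => y (- s)) (fun s => - Derive y (- s))) as H.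
  eapply Rle_trans; [apply H; clear H; [| |exact Y2]|].
  - intros s. eapply is_derive_eq; [apply (derive_comp y (fun s => - s)); [apply Dy|derive_R]|ring].
  - intros s. apply continuous_Ropp, (continuous_comp (fun t => - t) (Derive y));
      [continuity_R|apply Cdy].
  - right. apply RInt_ext_R. intros s. unfold I. rewrite rad_opp, Eq. ring.
Qed.

Lemma mode_quotient_regular (w : R -> R) (u : R -> R -> R) :
  smooth u -> (forall t, ex_derive w t) ->
  (forall s, ex_derive (fun s => mode w u s / rho s) s) /\
  (forall s, continuous (Derive (fun s => mode w u s / rho s)) s).
Proof.
  intros Hu Hw. split; intros s.
  - eexists. now apply derive_mode_quotient.
  - apply continuous_ext with
      (fun s => (mode w (pd Ds u) s - drho s / rho s * mode w u s) / rho s).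
    { intros t. symmetry. apply is_derive_unique. now apply derive_mode_quotient. }
    pose proof (is_derive_continuous _ _ _ (derive_mode w u s Hu Hw)).
    pose proof (is_derive_continuous _ _ _ (derive_mode w (pd Ds u) s (smooth_ds u Hu) Hw)).
    pose proof (is_derive_continuous _ _ _ (Drho s)).
    pose proof (is_derive_continuous _ _ _ (Ddrho s)).
    pose proof (Hrho s). continuity_R; lra.
Qed.

Lemma mode_combination (w : R -> R) (p q : R) (u v : R -> R -> R) (s : R) :
  smooth u -> smooth v -> (forall t, ex_derive w t) ->
  mode w (fun s t => p * u s t + q * v s t) s = p * mode w u s + q * mode w v s.
Proof.
  intros Hu Hv Hw. unfold mode.
  assert (C : forall f, smooth f -> forall t, continuous (fun t => f s t * w t) t).
  { intros f Sf t. apply (continuity_2d_slice (fun s t => f s t * w t)).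
    now apply continuous_smooth_product. }
  pose proof (C u Hu). pose proof (C v Hv).
  rewrite (RInt_ext_R _ (fun t => p * (u s t * w t) + q * (v s t * w t))) by (intros; ring).
  assert (Cp : forall z f, (forall t, continuous f t) -> forall t : R, continuous (fun t => z * f t) t).
  { intros z f Cf t. apply (continuous_Rmult (fun _ => z)); [apply continuous_const|apply Cf]. }
  rewrite RInt_plus_R by now apply Cp. now rewrite !RInt_scal_R.
Qed.

Lemma spherical_index_at_most : index_at_most Spherical r s0 (catenoid Spherical a) 4.
Proof.
  destruct zero_mode_half as [sigma [Hsig Hzero]].
  intros V [VS [V0 [Vplus Vscal]]] Hneg [b [Vb Free]].
  assert (Sb : forall i, (1 <= i <= 5)%nat -> smooth (b i)) by (intros i Hi; apply (VS _ (Vb i Hi))).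
  assert (E1 : forall t, ex_derive (fun _ : R => 1) t) by (intros; apply ex_derive_const).
  assert (Ec : forall t, ex_derive cos t) by (intros t; eexists; apply is_derive_cos).
  assert (Es : forall t, ex_derive sin t) by (intros t; eexists; apply is_derive_sin).
  (* Five independent functions and four linear conditions leave a nonzero combination satisfying
     all of them, on which the form is nonnegative. *)
  destruct (homogeneous_system_solution 4 (fun j i =>
    match j with
    | 1%nat => mode (fun _ => 1) (b i) sigma
    | 2%nat => mode (fun _ => 1) (b i) (- sigma)
    | 3%nat => mode cos (b i) 0
    | _ => mode sin (b i) 0
    end)) as [c' [[i0 [Hi0 Hci0]] Hsys]].
  (* Partial sums, so that membership in [V] and linearity of [mode] follow by induction on [m]; the
     factor [1] in [Eu] matches [mode_combination]. *)
  set (u := fun m s t => sum_n_m (fun i => c' i * b i s t) 1 m).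
  assert (Eu : forall m, u (S m) = fun s t => 1 * u m s t + c' (S m) * b (S m) s t).
  { intros m. apply functional_extensionality; intros s. apply functional_extensionality; intros t.
    unfold u. rewrite sum_n_m_Sm. ring_R. }
  assert (Eu0 : u 0%nat = fun _ _ => 0).
  { apply functional_extensionality; intros s. apply functional_extensionality; intros t.
    unfold u. apply sum_n_m_0. }
  assert (Vu : forall m, (m <= 5)%nat -> V (u m)).
  { induction m as [|m IH]; intros Hm; [now rewrite Eu0|].
    rewrite Eu. apply (Vplus (fun s t => 1 * u m s t) (fun s t => c' (S m) * b (S m) s t));
      apply Vscal; [apply IH|apply Vb]; lia. }
  assert (Mu : forall w, (forall t, ex_derive w t) -> forall s m, (m <= 5)%nat ->
     mode w (u m) s = sum_n_m (fun i => c' i * mode w (b i) s) 1 m).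
  { intros w Hw s. induction m as [|m IH]; intros Hm.
    - rewrite Eu0, sum_n_m_0. unfold mode. rewrite (RInt_ext_R _ (fun _ => 0)).
      + rewrite RInt_const_R. ring_R.
      + intros t. ring.
    - rewrite Eu, sum_n_m_Sm, mode_combination, IH; [ring_R|lia| |apply Sb; lia|exact Hw].
      apply (VS (u m)), Vu. lia. }
  assert (Hnv : ~ vanishes_on_annulus s0 (u 5%nat)).
  { intros Hv. apply Hci0. apply (Free c' Hv i0 Hi0). }
  pose proof (Vu 5%nat ltac:(lia)) as V5. pose proof (Hneg _ V5 Hnv) as Hlt.
  destruct (conormal_boundary Spherical r a s0 Ha Hs0 Hsin Hf) as [_ [_ Hcot]].
  pose proof (index_form_reduction a Ha r s0 (u 5%nat) Hs0 Hcot (VS _ V5)) as Hred.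
  pose proof (proj1 (VS _ V5)) as S5. pose proof PI_RGT_0 as HPI.
  pose proof (Hsys 1%nat ltac:(lia)) as L1. pose proof (Hsys 2%nat ltac:(lia)) as L2.
  pose proof (Hsys 3%nat ltac:(lia)) as L3. pose proof (Hsys 4%nat ltac:(lia)) as L4.
  cbv beta iota in L1, L2, L3, L4.
  rewrite <- (Mu _ E1) in L1, L2 by lia. rewrite <- (Mu _ Ec) in L3 by lia.
  rewrite <- (Mu _ Es) in L4 by lia.
  assert (Cr : forall s, continuous rho s) by (intros s; apply (is_derive_continuous _ _ _ (Drho s))).
  assert (F1 : 0 <= fourier_form a (fun s => rho s + 2 * c ^ 2 / rho s) s0
     (fun s => mode (fun _ => 1) (u 5%nat) s / rho s)).
  { destruct (mode_quotient_regular _ _ S5 E1) as [Q1 Q2].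
    apply (fourier_form_nonneg _ _ sigma); try assumption.
    - intros s. pose proof (Hrho s). continuity_R. lra.
    - intros s. now rewrite rad_opp.
    - rewrite L1. unfold Rdiv. ring.
    - rewrite L2. unfold Rdiv. ring. }
  assert (Hone : forall w, (forall t, ex_derive w t) -> mode w (u 5%nat) 0 = 0 ->
     0 <= fourier_form a (fun s => 2 * c ^ 2 / rho s) s0 (fun s => mode w (u 5%nat) s / rho s)).
  { intros w Hw L. destruct (mode_quotient_regular _ _ S5 Hw) as [Q1 Q2].
    apply (fourier_form_nonneg _ _ 0); try assumption.
    - intros s. pose proof (Hrho s). continuity_R. lra.
    - intros s. now rewrite rad_opp.
    - apply first_mode_half.
    - rewrite L. unfold Rdiv. ring.
    - rewrite Ropp_0, L. unfold Rdiv. ring. }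
  pose proof (Hone _ Ec L3) as F2. pose proof (Hone _ Es L4) as F3.
  assert (P1 : 0 < / (2 * PI)) by (apply Rinv_0_lt_compat; lra).
  assert (P2 : 0 < / PI) by (apply Rinv_0_lt_compat; lra).
  pose proof (Rmult_le_pos _ _ (Rlt_le _ _ P1) F1).
  pose proof (Rmult_le_pos _ _ (Rlt_le _ _ P2) F2).
  pose proof (Rmult_le_pos _ _ (Rlt_le _ _ P2) F3).
  apply (Rlt_irrefl 0). eapply Rle_lt_trans; [|exact Hlt]. eapply Rle_trans; [|exact Hred]. lra.
Qed.

End Spherical.

Theorem theorem1p4 :
  (forall r a s0 : R,
     0 < r < PI / 2 ->
     critical_spherical_catenoid Spherical r a s0 ->
     has_index Spherical r s0 (catenoid Spherical a) 4) /\
  (forall r a s0 : R,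
     0 < r ->
     critical_spherical_catenoid Hyperbolic r a s0 ->
     index_at_least Hyperbolic r s0 (catenoid Hyperbolic a) 4).
Proof.
  split; intros r a s0 Hr [Ha [Hs0 Hf]].
  - assert (Hsin : 0 < gsin Spherical r) by (apply sin_gt_0; lra).
    assert (Hcos : 0 < gcos Spherical r) by (apply cos_gt_0; lra).
    split; [now apply coordinates_index|now apply spherical_index_at_most].
  - apply coordinates_index; try assumption.
    + simpl. rewrite <- sinh_0. now apply sinh_lt.
    + simpl. pose proof (cosh_ge_1 r). lra.
Qed.
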